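(* Let $\mathbb G$ be a homogeneous Carnot group, $1\le m\le l$, $\beta\in\mathbb R$, and $z=(\xi_1,\dots,\xi_m)$ (the first $m$ coordinates). (1) Let $1<p<\infty$ and $\Omega\subset\mathbb G$ open; if $m+\beta<0$ assume also $\Omega\subset(\mathbb R^m\setminus\{0\})\times\mathbb R^{N-m}$. Then for every $u\in C^1_0(\Omega)$, $$\Big(\frac{|m+\beta|}{p}\Big)^p\int_\Omega|u|^p|z|^\beta d\xi\le\int_\Omega|\nabla_Lu|^p|z|^{p+\beta}d\xi;$$ in particular $\big(\frac{|m-p|}{p}\big)^p\int_\Omega\frac{|u|^p}{N_S^p}d\xi\le\big(\frac{|m-p|}{p}\big)^p\int_\Omega\frac{|u|^p}{|z|^p}d\xi\le\int_\Omega|\nabla_Lu|^pd\xi$, and for any homogeneous norm $N$ and $p\ne m$ there is $c>0$ with $c\int_\Omega\frac{|u|^p}{N^p}d\xi\le\int_\Omega|\nabla_Lu|^pd\xi$ for all $u\in C^1_0(\Omega)$. (2) Let $p=m>1$, $R>0$, $\Omega=\{(z,\xi_{m+1},\dots,\xi_N):|z|<R\}$, $\beta<-1$. Then for every $u\in C^1_0(\Omega)$, $$\Big(\frac{|\beta+1|}{p}\Big)^p\int_\Omega\frac{|u|^p}{|z|^p}\Big(\ln\frac R{|z|}\Big)^\beta d\xi\le\int_\Omega|\nabla_Lu|^p\Big(\ln\frac R{|z|}\Big)^{p+\beta}d\xi,$$ in particular $\big(\frac{p-1}{p}\big)^p\int_\Omega\frac{|u|^p}{(|z|\ln(R/|z|))^p}d\xi\le\int_\Omega|\nabla_Lu|^pd\xi$.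 Moreover, if $\mathbb G$ is of H-type, $m=l$ and $(B^l_\rho\setminus\{0\})\times B^{N-l}_\rho\subset\Omega$ for some $\rho>0$, then the constants $(|m+\beta|/p)^p$ in (1) and $(|\beta+1|/p)^p$ in (2) are sharp.
   Context: A homogeneous Carnot group $\mathbb G=(\mathbb R^N,\circ,\delta_\lambda)$: $\mathbb R^N=\mathbb R^{n_1}\times\dots\times\mathbb R^{n_r}$, $\xi=(\xi^{(1)},\dots,\xi^{(r)})$, $\circ$ is a Lie group law on $\mathbb R^N$ for which the dilations $\delta_\lambda(\xi)=(\lambda\xi^{(1)},\lambda^2\xi^{(2)},\dots,\lambda^r\xi^{(r)})$ ($\lambda>0$) are group automorphisms; for $i=1,\dots,l:=n_1$, $X_i$ is the left-invariant vector field agreeing with $\partial/\partial\xi^{(1)}_i$ at the origin, and $X_1,\dots,X_l$ generate the whole Lie algebra of left-invariant vector fields. $\nabla_L=(X_1,\dots,X_l)^T$. A homogeneous norm is a continuous $N:\mathbb R^N\to[0,\infty)$ with $N(\xi^{-1})=N(\xi)$, $N(\xi)=0$ iff $\xi=0$, $N(\delta_\lambda\xi)=\lambda N(\xi)$; $N_S(\xi)=\big(\sum_{i=1}^r|\xi^{(i)}|^{2r!/i}\big)^{1/(2r!)}$. $\mathbb G$ is of H-type if it has step $2$, Lie algebra $V_1\oplus V_2$ with a scalar product on $V_1$, and the map $J:V_2\to\mathrm{End}(V_1)$ defined by $\langle J(\eta)\hat\xi,\tilde\xi\rangle=\langle[\hat\xi,\tilde\xi],\eta\rangle$ satisfies $J(\eta)^2=-|\eta|^2\mathrm{Id}$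 for all $\eta\in V_2$. $B^s_\rho$ is the Euclidean ball in $\mathbb R^s$ of radius $\rho$ centred at $0$. ''Sharp'' means the constant cannot be replaced by any larger one. *)

(* Defs.v *)
From HB Require Import structures.
From mathcomp Require Import all_boot all_order all_algebra.
From mathcomp Require Import all_classical all_reals all_analysis.
Set Implicit Arguments. Unset Strict Implicit. Unset Printing Implicit Defensive.
Import Order.TTheory GRing.Theory Num.Theory.
Import numFieldNormedType.Exports.
Local Open Scope classical_set_scope.
Local Open Scope ring_scope.

Section Carnot.
Variable R : realType.

Definition ebas (n : nat) (i : 'I_n) : 'rV[R]_n := delta_mx 0 i.

Definition iterD (n : nat) (s : seq 'I_n) (f : 'rV[R]_n -> R) : 'rV[R]_n -> R :=
  foldr (fun i g => fun x => derive g x (ebas i)) f s.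

Definition smooth (n : nat) (f : 'rV[R]_n -> R) : Prop :=
  forall s : seq 'I_n,
    continuous (iterD s f) /\ forall (i : 'I_n) x, derivable (iterD s f) x (ebas i).

Definition C1 (n : nat) (f : 'rV[R]_n -> R) : Prop :=
  forall i : 'I_n, (forall x, derivable f x (ebas i)) /\
                   continuous (fun x => derive f x (ebas i)).

Definition C1_0 (n : nat) (Om : set 'rV[R]_n) (f : 'rV[R]_n -> R) : Prop :=
  C1 f /\ exists K : set 'rV[R]_n, compact K /\ K `<=` Om /\
                                  forall x, ~ K x -> f x = 0.

(* ---------- Lebesgue integral over R^n of a nonnegative function,
   defined as the iterated one-dimensional Lebesgue integral ---------- *)
Definition cons_row (n : nat) (t : R) (v : 'rV[R]_n) : 'rV[R]_n.+1 :=
  \row_(i < n.+1) match unlift ord0 i with None => t | Some j => v 0 j end.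

Fixpoint iint (n : nat) : ('rV[R]_n -> \bar R) -> \bar R :=
  match n with
  | 0 => fun f => f 0
  | n'.+1 => fun f =>
      (\int[@lebesgue_measure R]_t iint (fun v => f (cons_row t v)))%E
  end.

Definition intOm (n : nat) (Om : set 'rV[R]_n) (g : 'rV[R]_n -> R) : \bar R :=
  iint (fun x => (\1_Om x * g x)%:E).

Variable N : nat.
(* deg k = index of the layer the coordinate k belongs to *)
Variable deg : 'I_N -> nat.
Variable op : 'rV[R]_N -> 'rV[R]_N -> 'rV[R]_N.
Variable inv : 'rV[R]_N -> 'rV[R]_N.
Variable e : 'rV[R]_N.

Definition dil (lam : R) (x : 'rV[R]_N) : 'rV[R]_N :=
  \row_(k < N) (lam ^+ deg k * x 0 k).

(* left-invariant vector field whose value at the identity is v :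
   (X_v f)(x) = d/dt f(x o (e + t v)) at t = 0 *)
Definition Xf (v : 'rV[R]_N) (f : 'rV[R]_N -> R) (x : 'rV[R]_N) : R :=
  derive (fun y => f (op x y)) e v.

Definition brk (v w u : 'rV[R]_N) : Prop :=
  forall f : 'rV[R]_N -> R, smooth f ->
    forall x, Xf v (Xf w f) x - Xf w (Xf v f) x = Xf u f x.

Definition subspace (S : set 'rV[R]_N) : Prop :=
  S 0 /\ forall (a : R) v w, S v -> S w -> S (a *: v + w).

Definition is_hom_carnot : Prop :=
  (* grading R^N = R^{n_1} x ... x R^{n_r} *)
  (forall k, (1 <= deg k)%N) /\ {homo deg : i j / (i <= j)%N} /\
  (forall x y z, op (op x y) z = op x (op y z)) /\
  (forall x, op e x = x /\ op x e = x) /\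
  (forall x, op x (inv x) = e /\ op (inv x) x = e) /\
  (forall j : 'I_N, smooth (fun w : 'rV[R]_(N + N) => op (lsubmx w) (rsubmx w) 0 j)) /\
  (forall j : 'I_N, smooth (fun x => inv x 0 j)) /\
  (forall lam x y, 0 < lam -> dil lam (op x y) = op (dil lam x) (dil lam y)) /\
  (* X_1, ..., X_l generate the Lie algebra of left-invariant vector fields *)
  (forall S : set 'rV[R]_N, subspace S ->
     (forall k, deg k = 1%N -> S (ebas k)) ->
     (forall v w u, S v -> S w -> brk v w u -> S u) ->
     S = setT).

Definition lay1 : nat := #|[set k | deg k == 1%N]|.

Definition gradL (f : 'rV[R]_N -> R) (x : 'rV[R]_N) : R :=
  Num.sqrt (\sum_(k < N | deg k == 1%N) (Xf (ebas k) f x) ^+ 2).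

Definition znorm (m : nat) (x : 'rV[R]_N) : R :=
  Num.sqrt (\sum_(k < N | (k < m)%N) (x 0 k) ^+ 2).

Definition step : nat := \max_(k < N) deg k.
Definition layer_norm (i : nat) (x : 'rV[R]_N) : R :=
  Num.sqrt (\sum_(k < N | deg k == i) (x 0 k) ^+ 2).
Definition NS (x : 'rV[R]_N) : R :=
  (\sum_(1 <= i < step.+1) layer_norm i x `^ ((2 * step`!)%:R / i%:R))
    `^ (1 / (2 * step`!)%:R).

Definition hom_norm (Nf : 'rV[R]_N -> R) : Prop :=
  continuous Nf /\ (forall x, 0 <= Nf x) /\ (forall x, Nf (inv x) = Nf x) /\
  (forall x, Nf x = 0 <-> x = 0) /\
  (forall lam x, 0 < lam -> Nf (dil lam x) = lam * Nf x).

(* H-type: step 2, inner product on the Lie algebra (identified with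
   R^N = T_e) restricted to V1 and V2, and J(eta)^2 = -|eta|^2 Id *)
Definition V1 (v : 'rV[R]_N) : Prop := forall k, deg k != 1%N -> v 0 k = 0.
Definition V2 (v : 'rV[R]_N) : Prop := forall k, deg k != 2%N -> v 0 k = 0.

Definition is_Htype : Prop :=
  (forall k, (deg k <= 2)%N) /\ (exists k, deg k = 2%N) /\
  exists Q : 'M[R]_N, Q^T = Q /\
    (forall v : 'rV[R]_N, v != 0 -> 0 < (v *m Q *m v^T) 0 0) /\
    let ip (v w : 'rV[R]_N) := (v *m Q *m w^T) 0 0 in
    exists J : 'rV[R]_N -> 'rV[R]_N -> 'rV[R]_N,
      forall eta, V2 eta ->
        (forall a, V1 a -> V1 (J eta a)) /\
        (forall (c : R) a b, V1 a -> V1 b -> J eta (c *: a + b) = c *: J eta a + J eta b) /\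
        (forall a b u, V1 a -> V1 b -> brk a b u -> ip (J eta a) b = ip u eta) /\
        (forall a, V1 a -> J eta (J eta a) = - ip eta eta *: a).

End Carnot.

Section Extra.
Variable R : realType.
Variable N : nat.
Definition wnorm (m : nat) (x : 'rV[R]_N) : R :=
  Num.sqrt (\sum_(k < N | (m <= k)%N) (x 0 k) ^+ 2).
End Extra.

Section ERealHelpers.
Variable R : realType.
(* plain abbreviations, to keep the statement in ring_scope *)
Definition eLe (a b : \bar R) : Prop := (a <= b)%E.
Definition eLt (a b : \bar R) : Prop := (a < b)%E.
Definition eScale (c : R) (a : \bar R) : \bar R := (c%:E * a)%E.
End ERealHelpers.

(* Main.v *)
(** The Hardy inequalities come from the divergence theorem for the field
    [|u|^p z phi(|z|)]: since [X_i xi_j = delta_ij] on the first layer and the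
    coefficients of the [X_i] are divergence free, integrating
    [sum_i X_i (|u|^p z_i phi(|z|))] to zero bounds the integral of
    [|u|^p (m phi + |z| phi')] by that of [p |u|^(p-1) |nabla_L u| |z| |phi|], and
    Young's inequality concludes with [phi(r) = r^beta] or
    [phi(r) = ln(R/r)^(beta+1) / r^p]; [phi] is cut off near [z = 0] and the cutoff
    removed by monotone convergence.

    For sharpness, put [l r = ln r] or [l r = - ln (ln (R/r))] and test with
    [exp(- kap l(|z|)) psi(l(|z|)/L + 3) theta(|w|^2)], [w] the remaining
    coordinates.  In the variable [t = l r] both weighted measures become a multiple of
    Lebesgue measure, so both integrals grow like [L] while the derivatives of
    [psi] contribute a lower order; in step two [X_i theta = O(|z|)], which is
    negligible on the support as it lies over [t < - 2 L]. *)

Require Import Defs.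
From HB Require Import structures.
From mathcomp Require Import all_boot all_order all_algebra.
From mathcomp Require Import all_classical all_reals all_analysis.
From mathcomp Require Import measurable_realfun ring lra.
Set Implicit Arguments. Unset Strict Implicit. Unset Printing Implicit Defensive.
Import Order.TTheory GRing.Theory Num.Theory.
Import numFieldNormedType.Exports.
Local Open Scope classical_set_scope.
Local Open Scope ring_scope.

(** * Iterated integrals of compactly supported continuous functions *)

Section Cc.
Context {R : realType}.
Notation mu := (@lebesgue_measure R).

(** The shape is dictated by [iint], an iterated integral whose inner integrals need not depend
    measurably on the outer variables. Signed integrands are therefore integrated only when they are
    [Cc], through the real-valued [J]; a derivative is integrated in the slice of its own variable,
    so the order of integration is never exchanged. Other nonnegative integrands are only compared
    by monotonicity or bounded by suprema of increasing [Cc] sequences. What is known about the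
    [X_k] comes from the dilations: a coefficient of [X_k] is continuous and homogeneous, so degree
    zero makes it constant and degree one makes it linear, while a derivative of negative degree
    vanishes. Sharpness needs integrals in [|z|] but no polar coordinates: the field
    [z |z|^(-m) G(l |z|) q(|w|^2)] is differentiated in the first [m] variables, and its divergence
    shows that the radial integral depends only on the mass of the profile in [t = l r]. The
    profiles compared are rescaled copies of one explicit bump with explicit primitive, so no
    integral is ever evaluated. *)

Definition Cc (V : normedModType R) (f : V -> R) : Prop :=
  continuous f /\ exists M : R, forall x, M < `|x| -> f x = 0.

Lemma Cc_add (V : normedModType R) (f g : V -> R) :
  Cc f -> Cc g -> Cc (fun x => f x + g x).
Proof.
move=> [cf [M hM]] [cg [M' hM']]; split.
  by move=> x; apply: continuousD; [exact: cf|exact: cg].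
exists (Num.max M M') => x; rewrite gt_max => /andP[h1 h2].
by rewrite hM// hM'// addr0.
Qed.

Lemma Cc_mull (V : normedModType R) (f g : V -> R) :
  continuous f -> Cc g -> Cc (fun x => f x * g x).
Proof.
move=> cf [cg [M hM]]; split; first by move=> x; apply: continuousM; [exact: cf|exact: cg].
by exists M => x h; rewrite hM// mulr0.
Qed.

Lemma Cc_scale (V : normedModType R) (c : R) (g : V -> R) :
  Cc g -> Cc (fun x => c * g x).
Proof. by apply: Cc_mull => x; exact: cst_continuous. Qed.

Lemma Cc0 (V : normedModType R) : Cc (fun _ : V => 0 : R).
Proof. by split; [move=> x; exact: cst_continuous|exists 0]. Qed.

Lemma Cc_sum (V : normedModType R) (I : Type) (r : seq I) (P : pred I) (F : I -> V -> R) :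
  (forall i, P i -> Cc (F i)) -> Cc (fun x => \sum_(i <- r | P i) F i x).
Proof.
move=> h; elim: r => [|i r IH].
  by under eq_fun do rewrite big_nil; exact: Cc0.
by case E: (P i); under eq_fun do rewrite big_cons E; last exact: IH; apply: Cc_add => //; apply: h.
Qed.

Lemma continuous_epsP (V W : normedModType R) (f : V -> W) (x : V) :
  (forall e, 0 < e -> exists d, 0 < d /\ forall y, `|x - y| < d -> `|f x - f y| <= e) ->
  {for x, continuous f}.
Proof.
move=> h; apply/cvgrPdist_le => e /h [d [d0 hd]].
by apply/nbhs_ballP; exists d => // y; rewrite -ball_normE => /hd.
Qed.

Lemma continuous_epsE (V W : normedModType R) (f : V -> W) (x : V) :
  {for x, continuous f} ->
  forall e, 0 < e -> exists d, 0 < d /\ forall y, `|x - y| < d -> `|f x - f y| < e.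
Proof.
move=> cf e e0; move/cvgrPdist_lt : cf => /(_ _ e0).
move=> /nbhs_ballP [d /= d0 hd]; exists d; split => // y xy.
by apply: hd; rewrite -ball_normE.
Qed.

Lemma Cc_unif (n : nat) (f : 'rV[R]_n -> R) : Cc f ->
  forall e, 0 < e -> exists d, [/\ 0 < d & forall x y, `|x - y| < d -> `|f x - f y| < e].
Proof.
move=> [cf [M hM]] e e0.
pose K := [set x : 'rV[R]_n | `|x| <= M + 1].
have cK : compact K.
  apply: bounded_closed_compact.
    by exists (M + 1); split => [|y My x]; [exact: num_real|move=> /= /le_trans; apply; exact: ltW].
  rewrite (_ : K = (fun x : 'rV[R]_n => `|x|) @^-1` [set t | t <= M + 1]); last by [].
  apply: closed_comp; last exact: closed_le.
  by move=> x _; exact: norm_continuous.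
have /compact_near_coveringP := cK.
pose P (d : R) x := forall y, `|x - y| < d -> `|f x - f y| < e.
move=> /(_ R (0^'+) P _) H.
have /H H' : forall x, K x -> \forall x' \near x & d \near 0^'+, P d x'.
  move=> x Kx.
  have e20 : 0 < e / 2 by rewrite divr_gt0.
  have /cvgrPdist_lt /(_ _ e20) := cf x.
  rewrite -nbhs_ballE => -[r /= r0 hr].
  have r2 : 0 < r / 2 by rewrite divr_gt0.
  exists (ball x (r / 2), [set d | d < r / 2]) => /=.
    split; first exact: nbhsx_ballx.
    exact: nbhs_right_lt.
  move=> [x' d] /= [bx' dr] y xy.
  have -> : f x' - f y = (f x - f y) - (f x - f x') by lra.
  move: bx'; rewrite -ball_normE /= => bx'.
  apply: le_lt_trans (ler_normB _ _) _.
  rewrite [ltRHS]splitr; apply: ltrD; apply: hr; rewrite -ball_normE /=.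
    rewrite -(subrKA x') (le_lt_trans (ler_normD _ _))// [ltRHS]splitr ltrD//.
    exact: lt_trans dr.
  by rewrite (lt_trans bx')// ltr_pdivrMr// ltr_pMr// ltr1n.
have [d [hd d0]] : exists d, (K `<=` P d) /\ 0 < d.
  by apply: (@filter_ex _ (0^'+)); apply: filterI => //; exact: nbhs_right_gt.
(* The cap 1 matches the margin of [K]: if [x] is outside [K], then [y] is still outside the ball of
   radius [M] and both values vanish. *)
exists (Num.min d 1); split; first by rewrite lt_min d0 ltr01.
move=> x y; rewrite lt_min => /andP[h1 h2].
have [Kx|/negP] := pselect (K x).
  exact: (hd x Kx).
rewrite /K /= -ltNge => Mx.
rewrite !hM ?subrr ?normr0//.
  have : `|x| <= `|x - y| + `|y| by rewrite -{1}(subrK y x) ler_normD.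
  lra.
lra.
Qed.

Lemma is_derive_line (V : normedModType R) (f : V -> R) (x v : V) (t : R) :
  derivable f (x + t *: v) v ->
  is_derive t (1 : R) (fun s => f (x + s *: v)) ('D_v f (x + t *: v)).
Proof.
move=> df.
have E : (fun h : R => h^-1 *: (((fun s => f (x + s *: v)) \o shift t) (h *: (1 : R)) - f (x + t *: v))) =
         (fun h : R => h^-1 *: ((f \o shift (x + t *: v)) (h *: v) - f (x + t *: v))).
  apply/funext => h /=; congr (_ *: (f _ - _)).
  by rewrite [h *: 1]mulr1 scalerDl addrCA.
by split; rewrite /derivable /derive E.
Qed.

Lemma Cc1_integrable (f : R -> R) : Cc f -> mu.-integrable setT (EFin \o f).
Proof.
move=> [cf [M hM]].
have -> : EFin \o f = (EFin \o f) \_ `[(- M), M].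
  apply/funext => x; rewrite patchE; case: ifPn => // /negP xM /=.
  rewrite hM// ltNge; apply/negP; rewrite ler_norml => h; apply: xM.
  by rewrite inE /= in_itv.
apply/integrable_restrict => //; rewrite setTI.
apply: continuous_compact_integrable; first exact: segment_compact.
by apply: continuous_subspaceT => x; exact: cf.
Qed.

Lemma continuous_emeasurable (f : R -> R) : continuous f -> measurable_fun (setT : set R) (fun x => (f x)%:E).
Proof. by move=> cf; apply/measurable_EFinP; apply: continuous_measurable_fun. Qed.

Lemma Rint_bound (f : R -> R) (M C : R) : Cc f -> 0 <= M ->
  (forall x, M < `|x| -> f x = 0) -> (forall x, `|f x| <= C) ->
  `|\int[mu]_x f x| <= 2 * M * C.
Proof.
move=> Cf M0 hM hC.
have fE : f = f \_ `[(- M), M].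
  apply/funext => x; rewrite patchE; case: ifPn => // /negP xM /=.
  rewrite hM// ltNge; apply/negP; rewrite ler_norml => h; apply: xM.
  by rewrite inE /= in_itv.
rewrite {1}fE -Rintegral_mkcond.
have If : mu.-integrable `[(- M), M] (EFin \o f).
  exact: (integrableS _ _ (@subsetT _ _) (Cc1_integrable Cf)).
apply: le_trans (le_normr_Rintegral _ If) _ => //.
have -> : 2 * M * C = \int[mu]_(x in `[(- M), M]) C.
  rewrite Rintegral_cst//= lebesgue_measure_itv /= lte_fin.
  case: ltP => h /=; first by rewrite opprK; lra.
  have -> : M = 0 by lra.
  lra.
apply: le_Rintegral => //.
  exact: (integrable_norm If).
apply: continuous_compact_integrable; first exact: segment_compact.
by apply: continuous_subspaceT => x; exact: cst_continuous.
Qed.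

Lemma Rint_derive (F f : R -> R) : Cc F -> Cc f ->
  (forall x, is_derive x (1 : R) F (f x)) -> \int[mu]_x f x = 0.
Proof.
move=> [cF [M1 hM1]] [cf [M2 hM2]] Ff.
pose M := Num.max 0 (Num.max M1 M2) + 1.
have M_ge : [/\ 0 < M, M1 < M & M2 < M].
  by rewrite /M; split; rewrite ltr_pwDr// ?le_max ?lexx ?orbT.
have [M0 MM1 MM2] := M_ge.
have fE : f = f \_ `[(- M), M].
  apply/funext => x; rewrite patchE; case: ifPn => // /negP xM /=.
  rewrite hM2// (lt_trans MM2)// ltNge; apply/negP; rewrite ler_norml => h; apply: xM.
  by rewrite inE /= in_itv.
rewrite fE -Rintegral_mkcond /Rintegral (@continuous_FTC2 _ f F) //.
- have -> : F M = 0 by apply: hM1; rewrite gtr0_norm.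
  have -> : F (- M) = 0 by apply: hM1; rewrite normrN gtr0_norm.
  by rewrite -EFinB subrr.
- by rewrite gtrN.
- by apply: continuous_subspaceT => x; exact: cf.
- split.
  + by move=> x _; exact: ex_derive.
  + by apply: cvg_at_right_filter; exact: cF.
  + by apply: cvg_at_left_filter; exact: cF.
- by move=> x _; rewrite derive1E derive_val.
Qed.

Lemma Rint_gt0 (f : R -> R) (x0 : R) : Cc f -> (forall x, 0 <= f x) -> 0 < f x0 ->
  0 < \int[mu]_x f x.
Proof.
move=> Cf f0 fx0.
have /cvgrPdist_lt /(_ (f x0 / 2)) := Cf.1 x0.
rewrite divr_gt0// => /(_ isT); rewrite -nbhs_ballE => -[r /= r0 hr].
have r20 : 0 < r / 2 by rewrite divr_gt0.
have Ic : mu.-integrable `[x0 - r / 2, x0 + r / 2] (EFin \o cst (f x0 / 2)).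
  apply: continuous_compact_integrable; first exact: segment_compact.
  by apply: continuous_subspaceT => x; exact: cst_continuous.
apply: (@lt_le_trans _ _ (\int[mu]_(x in `[x0 - r / 2, x0 + r / 2]) (f x0 / 2))).
  rewrite Rintegral_cst//= lebesgue_measure_itv /= lte_fin ifT; last lra.
  rewrite -EFinB /=; apply: mulr_gt0; first by rewrite divr_gt0.
  lra.
rewrite Rintegral_mkcond; apply: le_Rintegral => //.
- by rewrite -restrict_EFin; apply/integrable_restrict => //; rewrite setTI.
- exact: Cc1_integrable.
move=> x _; rewrite patchE; case: ifPn => // /[!inE] /=; rewrite in_itv /= => /andP[h1 h2].
have : `|f x0 - f x| < f x0 / 2.
  apply: hr; rewrite -ball_normE /=; rewrite ltr_norml; apply/andP; split; lra.
rewrite ltr_norml; lra.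
Qed.


Lemma rV_norm_le n (x : 'rV[R]_n) (c : R) : 0 <= c ->
  (forall i, `|x 0 i| <= c) -> `|x| <= c.
Proof.
move=> c0 h; rewrite [leLHS]/Num.Def.normr/= mx_normrE; apply: bigmax_le => // -[i j] _ /=.
by rewrite ord1.
Qed.

Lemma rV_coord_le n (x : 'rV[R]_n) i : `|x 0 i| <= `|x|.
Proof.
rewrite [leRHS]/Num.Def.normr/= mx_normrE.
exact: (le_bigmax _ (fun ij : 'I_1 * 'I_n => `|x ij.1 ij.2|) (0, i)).
Qed.

Lemma cons_row0 n t (v : 'rV[R]_n) : cons_row t v 0 ord0 = t.
Proof. by rewrite mxE unlift_none. Qed.

Lemma cons_rowS n t (v : 'rV[R]_n) j : cons_row t v 0 (lift ord0 j) = v 0 j.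
Proof. by rewrite mxE liftK. Qed.

Lemma cons_row_dist n t t' (v v' : 'rV[R]_n) :
  `|cons_row t v - cons_row t' v'| <= Num.max `|t - t'| `|v - v'|.
Proof.
apply: rV_norm_le; first by rewrite le_max normr_ge0.
move=> i; rewrite mxE [X in _ + X]mxE; case: (unliftP ord0 i) => [j|] ->.
  rewrite !cons_rowS le_max; apply/orP; right.
  by have := rV_coord_le (v - v') j; rewrite mxE [X in _ + X]mxE.
by rewrite !cons_row0 le_max lexx.
Qed.

Lemma cons_row_norm n t (v : 'rV[R]_n) : `|t| <= `|cons_row t v| /\ `|v| <= `|cons_row t v|.
Proof.
split; first by rewrite -{1}(cons_row0 t v); exact: rV_coord_le.
by apply: rV_norm_le => // j; rewrite -(cons_rowS t v); exact: rV_coord_le.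
Qed.

Lemma Cc_slice n (f : 'rV[R]_n.+1 -> R) t : Cc f -> Cc (fun v => f (cons_row t v)).
Proof.
move=> [cf [M hM]]; split; last first.
  by exists M => v Mv; apply: hM; apply: lt_le_trans Mv (cons_row_norm t v).2.
move=> v; apply: (@continuous_comp _ _ _ (cons_row t) f); last exact: cf.
apply: continuous_epsP => e e0; exists e; split=> // w vw.
by apply: le_trans (cons_row_dist _ _ _ _) _; rewrite subrr normr0 ge_max !ltW.
Qed.

(** Real-valued counterpart of [iint], equal to it on [Cc] functions by [iint_J]; differences make
    sense here. *)
Fixpoint J (n : nat) : ('rV[R]_n -> R) -> R :=
  match n with
  | 0 => fun f => f 0
  | n'.+1 => fun f => \int[mu]_t J (fun v => f (cons_row t v))
  end.

(** The properties are proved together because the step from [n] to [n.+1] needs the slice integral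
    to be integrable in the outer variable, and its continuity already uses linearity and the sup
    bound in dimension [n]. *)
Definition J_good n :=
  [/\ forall f g : 'rV[R]_n -> R, Cc f -> Cc g -> J (fun x => f x + g x) = J f + J g,
      forall (c : R) (f : 'rV[R]_n -> R), Cc f -> J (fun x => c * f x) = c * J f,
      forall (f : 'rV[R]_n -> R) M C, Cc f -> 0 <= M ->
        (forall x, M < `|x| -> f x = 0) -> (forall x, `|f x| <= C) ->
        `|J f| <= (2 * M) ^+ n * C &
      forall f : 'rV[R]_n -> R, Cc f -> (forall x, 0 <= f x) -> 0 <= J f].

Lemma Cc_support (V : normedModType R) (f : V -> R) : Cc f ->
  exists M, 0 <= M /\ forall x, M < `|x| -> f x = 0.
Proof.
move=> [_ [M hM]]; exists (Num.max 0 M); split; first by rewrite le_max lexx.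
by move=> x; rewrite gt_max => /andP[_ /hM].
Qed.

(** By uniform continuity two nearby slices differ by little everywhere, and the common support
    turns this sup bound into a bound on the difference of integrals. *)
Lemma J_slice_Cc n (f : 'rV[R]_n.+1 -> R) : J_good n -> Cc f ->
  Cc (fun t => J (fun v => f (cons_row t v))).
Proof.
move=> [Ja Js Jb _] Cf.
have J0 : J (fun _ : 'rV[R]_n => 0 : R) = 0.
  rewrite -[RHS](mul0r (J (fun _ : 'rV[R]_n => 0 : R))) -Js; last exact: Cc0.
  by congr J; apply/funext => x; rewrite mul0r.
have [M [M0 hM]] := Cc_support Cf.
split; last first.
  exists M => t Mt; rewrite -[RHS]J0; congr J; apply/funext => v; apply: hM.
  exact: lt_le_trans Mt (cons_row_norm t v).1.
move=> t; apply/cvgrPdist_le => e e0.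
(* The added 1 keeps the divisor positive when [M = 0]. *)
have K0 : 0 < (2 * M) ^+ n + 1 by rewrite ltr_pwDr// exprn_ge0// mulr_ge0.
have [d [d0 hd]] := Cc_unif Cf (divr_gt0 e0 K0).
near=> s.
have -> : J (fun v => f (cons_row t v)) - J (fun v => f (cons_row s v)) =
          J (fun v => f (cons_row t v) + -1 * f (cons_row s v)).
  rewrite Ja; [|exact: Cc_slice|by apply: Cc_scale; exact: Cc_slice].
  by rewrite Js; [rewrite mulN1r|exact: Cc_slice].
apply: (@le_trans _ _ ((2 * M) ^+ n * (e / ((2 * M) ^+ n + 1)))); last first.
  rewrite mulrA ler_pdivrMr// mulrDr mulr1 mulrC lerDl; exact: ltW.
apply: Jb => //.
- by apply: Cc_add; [|apply: Cc_scale]; exact: Cc_slice.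
- move=> v Mv; rewrite !hM ?mulr0 ?addr0//; apply: (lt_le_trans Mv); exact: (cons_row_norm _ v).2.
- move=> v; rewrite mulN1r ltW//; apply: hd; apply: le_lt_trans (cons_row_dist _ _ _ _) _.
  rewrite subrr normr0 gt_max d0 andbT; near: s; exact: cvgr_dist_lt.
Unshelve. all: by end_near. Qed.

Lemma J_goodP n : J_good n.
Proof.
elim: n => [|n IH].
  split => //=; first by move=> f M C _ _ _ h; rewrite expr0 mul1r.
have [Ja Js Jb Jp] := IH.
have Cs (f : 'rV[R]_n.+1 -> R) : Cc f -> Cc (fun t => J (fun v => f (cons_row t v))).
  exact: J_slice_Cc.
split=> /=.
- move=> f g Cf Cg; rewrite -RintegralD//; [|exact: Cc1_integrable (Cs _ _)..].
  by congr (Rintegral _ _ _); apply/funext => t; apply: Ja; exact: Cc_slice.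
- move=> c f Cf; rewrite -RintegralZl//; last exact: Cc1_integrable (Cs _ _).
  by congr (Rintegral _ _ _); apply/funext => t; apply: Js; exact: Cc_slice.
- move=> f M C Cf M0 hM hC; rewrite exprS -mulrA; apply: Rint_bound => //.
  + exact: Cs.
  + move=> t Mt.
    have J0 : J (fun _ : 'rV[R]_n => 0 : R) = 0.
      rewrite -[RHS](mul0r (J (fun _ : 'rV[R]_n => 0 : R))) -Js; last exact: Cc0.
      by congr J; apply/funext => x; rewrite mul0r.
    rewrite -[RHS]J0; congr J; apply/funext => v; apply: hM.
    exact: lt_le_trans Mt (cons_row_norm t v).1.
  + move=> t; apply: Jb => //; first exact: Cc_slice.
    by move=> v Mv; apply: hM; apply: (lt_le_trans Mv); exact: (cons_row_norm _ v).2.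
- move=> f Cf f0; apply: Rintegral_ge0 => t _; apply: Jp => //; exact: Cc_slice.
Qed.

Lemma JD n (f g : 'rV[R]_n -> R) : Cc f -> Cc g -> J (fun x => f x + g x) = J f + J g.
Proof. by have [h _ _ _] := J_goodP n; exact: h. Qed.

Lemma JZ n (c : R) (f : 'rV[R]_n -> R) : Cc f -> J (fun x => c * f x) = c * J f.
Proof. by have [_ h _ _] := J_goodP n; exact: h. Qed.

Lemma J_bound n (f : 'rV[R]_n -> R) M C : Cc f -> 0 <= M ->
  (forall x, M < `|x| -> f x = 0) -> (forall x, `|f x| <= C) -> `|J f| <= (2 * M) ^+ n * C.
Proof. by have [_ _ h _] := J_goodP n; exact: h. Qed.

Lemma J_ge0 n (f : 'rV[R]_n -> R) : Cc f -> (forall x, 0 <= f x) -> 0 <= J f.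
Proof. by have [_ _ _ h] := J_goodP n; exact: h. Qed.

Lemma J_slice n (f : 'rV[R]_n.+1 -> R) : Cc f -> Cc (fun t => J (fun v => f (cons_row t v))).
Proof. by move=> ?; apply: J_slice_Cc => //; exact: J_goodP. Qed.

Lemma JB n (f g : 'rV[R]_n -> R) : Cc f -> Cc g -> J (fun x => f x - g x) = J f - J g.
Proof.
move=> Cf Cg; rewrite -mulN1r -JZ// -JD//; last exact: Cc_scale.
by congr J; apply/funext => x; rewrite mulN1r.
Qed.

Lemma Cc_sub (V : normedModType R) (f g : V -> R) :
  Cc f -> Cc g -> Cc (fun x => f x - g x).
Proof.
move=> Cf Cg; rewrite (_ : (fun x => _) = (fun x => f x + -1 * g x)).
  by apply: Cc_add => //; exact: Cc_scale.
by apply/funext => x; rewrite mulN1r.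
Qed.

Lemma J_le n (f g : 'rV[R]_n -> R) : Cc f -> Cc g -> (forall x, f x <= g x) -> J f <= J g.
Proof.
move=> Cf Cg fg; rewrite -subr_ge0 -JB//; apply: J_ge0; first exact: Cc_sub.
by move=> x; rewrite subr_ge0.
Qed.

Lemma J0 n : J (fun _ : 'rV[R]_n => 0 : R) = 0.
Proof.
rewrite -[RHS](mul0r (J (fun _ : 'rV[R]_n => 0 : R))) -JZ; last exact: Cc0.
by congr J; apply/funext => x; rewrite mul0r.
Qed.

Lemma J_sum n (I : Type) (r : seq I) (P : pred I) (F : I -> 'rV[R]_n -> R) :
  (forall i, P i -> Cc (F i)) ->
  J (fun x => \sum_(i <- r | P i) F i x) = \sum_(i <- r | P i) J (F i).
Proof.
move=> h; elim: r => [|i r IH].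
  by under eq_fun do rewrite big_nil; rewrite big_nil J0.
under eq_fun do rewrite big_cons; rewrite big_cons.
case E : (P i) => //; rewrite JD ?IH//; [exact: h|].
exact: Cc_sum.
Qed.

Lemma iint_J n (f : 'rV[R]_n -> R) : Cc f -> iint (fun x => (f x)%:E) = (J f)%:E.
Proof.
elim: n f => [//|n IH] f Cf /=.
have E t : iint (fun v => (f (cons_row t v))%:E) = (J (fun v => f (cons_row t v)))%:E.
  by apply: IH; exact: Cc_slice.
under eq_integral => t _ do rewrite E.
by rewrite fineK//; apply: integrable_fin_num => //; exact: Cc1_integrable (J_slice _).
Qed.

Lemma J_gt0 n (f : 'rV[R]_n -> R) x0 : Cc f -> (forall x, 0 <= f x) -> 0 < f x0 -> 0 < J f.
Proof.
elim: n f x0 => [|n IH] f x0 Cf f0 fx0 /=.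
  by rewrite (_ : 0 = x0)// ; apply/rowP => -[].
apply: (@Rint_gt0 _ (x0 0 ord0)); first exact: J_slice.
  by move=> t; apply: J_ge0 => //; exact: Cc_slice.
apply: (IH _ (\row_j x0 0 (lift ord0 j))) => //; first exact: Cc_slice.
rewrite (_ : cons_row _ _ = x0)//; apply/rowP => i.
by case: (unliftP ord0 i) => [j|] ->; rewrite ?cons_rowS ?cons_row0// mxE.
Qed.


Lemma derivable_cons_row n (F : 'rV[R]_n.+1 -> R) t v j :
  derivable F (cons_row t v) (ebas R (lift ord0 j)) ->
  is_derive v (ebas R j) (fun w => F (cons_row t w)) (derive F (cons_row t v) (ebas R (lift ord0 j))).
Proof.
move=> dF.
have E : (fun h : R => h^-1 *: (((fun w => F (cons_row t w)) \o shift v) (h *: ebas R j) - F (cons_row t v))) =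
         (fun h : R => h^-1 *: ((F \o shift (cons_row t v)) (h *: ebas R (lift ord0 j)) - F (cons_row t v))).
  apply/funext => h /=; congr (_ *: (F _ - _)); apply/rowP => i.
  rewrite [RHS]mxE [X in _ = X + _]mxE [X in _ = _ * X + _]mxE eqxx /=.
  case: (unliftP ord0 i) => [k|] ->.
    by rewrite !cons_rowS !mxE eqxx /= (inj_eq lift_inj).
  by rewrite !cons_row0 (negbTE (neq_lift _ _)) mulr0 add0r.
by split; rewrite /derivable /derive E.
Qed.

Lemma cons_row_line n (t s : R) (v : 'rV[R]_n) :
  cons_row s v = cons_row t v + (s - t) *: ebas R ord0.
Proof.
apply/rowP => i; rewrite [RHS]mxE [X in _ = _ + X]mxE [X in _ = _ + _ * X]mxE eqxx /=.
case: (unliftP ord0 i) => [k|] ->; rewrite ?cons_rowS ?cons_row0.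
  by rewrite eq_sym (negbTE (neq_lift _ _)) mulr0 addr0.
by rewrite eqxx mulr1 subrKC.
Qed.

(** Differentiation under the integral sign: by the mean value theorem the difference quotient
    equals [D] at an intermediate slice, and uniform continuity of [D] makes the convergence uniform
    in [v]. The slice integral of [F] is thus a primitive with compact support. *)
Lemma J_derive0 n (F D : 'rV[R]_n.+1 -> R) : Cc F -> Cc D ->
  (forall x, is_derive x (ebas R ord0) F (D x)) -> J D = 0.
Proof.
move=> CF CD FD /=.
apply: (@Rint_derive (fun t => J (fun v => F (cons_row t v)))); try exact: J_slice.
move=> t.
have dl v s : is_derive s (1 : R) (fun r => F (cons_row r v)) (D (cons_row s v)).
  have -> : (fun r => F (cons_row r v)) = (fun r => F (cons_row 0 v + r *: ebas R ord0)).
    by apply/funext => r; rewrite (cons_row_line 0 r) subr0.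
  have E : cons_row s v = cons_row 0 v + s *: ebas R ord0 by rewrite (cons_row_line 0 s) subr0.
  have FDs := FD (cons_row s v); rewrite E in FDs *.
  by rewrite -(@derive_val _ _ _ _ _ _ _ FDs); apply: is_derive_line; exact: ex_derive.
have [M1 [M10 hM1]] := Cc_support CF.
have [M2 [M20 hM2]] := Cc_support CD.
pose M := Num.max M1 M2.
have M0 : 0 <= M by rewrite le_max M10.
have K0 : 0 < (2 * M) ^+ n + 1 by rewrite ltr_pwDr// exprn_ge0// mulr_ge0.
suff H : (fun h : R => h^-1 *: (((fun t => J (fun v => F (cons_row t v))) \o shift t) (h *: (1 : R)) -
    J (fun v => F (cons_row t v)))) @ 0^' --> J (fun v => D (cons_row t v)).
  by split; [apply/cvg_ex; eexists; exact: H|exact: cvg_lim H].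
apply/cvgrPdist_le => e e0.
have [d [d0 hd]] := Cc_unif CD (divr_gt0 e0 K0).
near=> h.
have h0 : h != 0 by near: h; exact: nbhs_dnbhs_neq.
have hd' : `|h| < d by near: h; exact: dnbhs0_lt.
rewrite /= [h *: 1]mulr1.
have Cs s : Cc (fun v => F (cons_row s v)) by exact: Cc_slice.
have Ds s : Cc (fun v => D (cons_row s v)) by exact: Cc_slice.
rewrite [_ *: _]mulrC -JB// mulrC -JZ; last exact: Cc_sub.
rewrite -JB//; last by apply: Cc_scale; exact: Cc_sub.
apply: (@le_trans _ _ ((2 * M) ^+ n * (e / ((2 * M) ^+ n + 1)))); last first.
  rewrite mulrA ler_pdivrMr// mulrDr mulr1 mulrC lerDl; exact: ltW.
apply: J_bound => //.
- by apply: Cc_sub => //; apply: Cc_scale; exact: Cc_sub.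
- move=> v; rewrite gt_max => /andP[h1 h2].
  rewrite hM2; last exact: lt_le_trans h2 (cons_row_norm _ _).2.
  rewrite !hM1 ?subrr ?mulr0 ?subr0//; exact: lt_le_trans h1 (cons_row_norm _ _).2.
move=> v.
have cl : continuous (fun r => F (cons_row r v)).
  move=> r; apply/differentiable_continuous/derivable1_diffP; exact: (@ex_derive _ _ _ _ _ _ _ (dl v r)).
have [c [ct cE]] : exists c, `|t - c| <= `|h| /\
    F (cons_row (h + t) v) - F (cons_row t v) = D (cons_row c v) * h.
  case: (ltgtP h 0) h0 => // hs _.
    have lt : h + t < t by rewrite gtrDr.
    have [c] := @MVT _ _ (fun r => D (cons_row r v)) _ _ lt (fun r _ => dl v r) (continuous_subspaceT cl).
    rewrite in_itv /= => /andP[c1 c2] E; exists c; split.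
      by rewrite (ltr0_norm hs) ger0_norm; lra.
    by rewrite -[LHS]opprB E; ring.
  have lt : t < h + t by rewrite ltrDr.
  have [c] := @MVT _ _ (fun r => D (cons_row r v)) _ _ lt (fun r _ => dl v r) (continuous_subspaceT cl).
  rewrite in_itv /= => /andP[c1 c2] E; exists c; split.
    by rewrite (gtr0_norm hs) ler0_norm; lra.
  by rewrite E; ring.
rewrite cE mulrCA mulVf// mulr1 ltW//; apply: hd.
apply: le_lt_trans (cons_row_dist _ _ _ _) _.
by rewrite subrr normr0 gt_max d0 andbT (le_lt_trans ct).
Unshelve. all: by end_near. Qed.

(** For an inner variable every slice already integrates to zero by induction; only the outermost
    variable requires differentiating under the integral. *)
Lemma J_derive n (F D : 'rV[R]_n -> R) i : Cc F -> Cc D ->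
  (forall x, is_derive x (ebas R i) F (D x)) -> J D = 0.
Proof.
elim: n F D i => [F D [] //|n IH] F D i CF CD FD.
case: (unliftP ord0 i) FD => [j|] -> FD; last exact: (J_derive0 CF CD).
have E t : J (fun v => D (cons_row t v)) = 0.
  apply: (IH (fun v => F (cons_row t v)) _ j); try exact: Cc_slice.
  move=> v; have FDv := FD (cons_row t v).
  by rewrite -(@derive_val _ _ _ _ _ _ _ FDv); apply: derivable_cons_row; exact: ex_derive.
by rewrite /= /Rintegral; under eq_integral do rewrite E; rewrite integral0.
Qed.

(** The integral of a nonnegative function is a supremum over the simple functions below it, so
    monotonicity holds without measurability. *)
Lemma ge0_le_integralT (f g : R -> \bar R) :
  (forall x, 0 <= f x)%E -> (forall x, f x <= g x)%E ->
  (\int[mu]_x f x <= \int[mu]_x g x)%E.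
Proof.
move=> f0 fg; rewrite !ge0_integralTE//; last by move=> x; exact: le_trans (fg x).
apply: le_ereal_sup => _ [h hf <-]; exists h => // x; exact: le_trans (fg x).
Qed.

Lemma iint_ge0 n (f : 'rV[R]_n -> \bar R) : (forall x, 0 <= f x)%E -> (0 <= iint f)%E.
Proof.
elim: n f => [|n IH] f f0 /=; first exact: f0.
by apply: integral_ge0 => t _; apply: IH => v; exact: f0.
Qed.

Lemma le_iint n (f g : 'rV[R]_n -> \bar R) : (forall x, 0 <= f x)%E ->
  (forall x, f x <= g x)%E -> (iint f <= iint g)%E.
Proof.
elim: n f g => [|n IH] f g f0 fg /=; first exact: fg.
apply: ge0_le_integralT => t; first exact: iint_ge0.
by apply: IH => v; [exact: f0|exact: fg].
Qed.

Definition Cc_chain n (fk : nat -> 'rV[R]_n -> R) : Prop :=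
  [/\ forall k, Cc (fk k), forall k x, 0 <= fk k x & forall x, nondecreasing_seq (fk^~ x)].

Lemma Cc_chain_slice n (fk : nat -> 'rV[R]_n.+1 -> R) t : Cc_chain fk ->
  Cc_chain (fun k v => fk k (cons_row t v)).
Proof.
by move=> [h1 h2 h3]; split=> [k|k x|x]; [exact: Cc_slice|exact: h2|exact: h3].
Qed.

Lemma J_chain_nd n (fk : nat -> 'rV[R]_n -> R) : Cc_chain fk ->
  nondecreasing_seq (fun k => (J (fk k))%:E).
Proof.
by move=> [h1 h2 h3] k l kl; rewrite lee_fin; apply: J_le => // x; exact: h3.
Qed.

(** [F] may fail to be measurable, so it is compared with the limit [G] of the slice integrals,
    which are continuous in [t]. The bound may fail at [t = 0]: there [G'] takes the value [+oo],
    and removing one point changes no integral. *)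
Lemma mct_slice n (fk : nat -> 'rV[R]_n.+1 -> R) (F : R -> \bar R) :
  Cc_chain fk -> (forall t, 0 <= F t)%E ->
  (forall t, (t != 0)%R -> F t <= ereal_sup (range (fun k => (J (fun v => fk k (cons_row t v)))%:E)))%E ->
  (\int[mu]_t F t <= ereal_sup (range (fun k => (J (fk k))%:E)))%E.
Proof.
move=> hk F0 FG.
pose g k t := (J (fun v => fk k (cons_row t v)))%:E.
pose G : R -> \bar R := fun t => limn (g^~ t).
have [h1 h2 h3] := hk.
have Gsup t : G t = ereal_sup (range (g^~ t)).
  apply/cvg_lim => //; apply: ereal_nondecreasing_cvgn.
  exact: J_chain_nd (Cc_chain_slice t hk).
have mg k : measurable_fun setT (g k).
  by apply: continuous_emeasurable; have [] := J_slice (h1 k).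
have g0 k t : (0 <= g k t)%E.
  by rewrite lee_fin; apply: J_ge0 => [|v]; [exact: Cc_slice|exact: h2].
have gnd t : nondecreasing_seq (g^~ t) by exact: J_chain_nd (Cc_chain_slice t hk).
have mG : measurable_fun setT G.
  apply: (emeasurable_fun_cvg g) => // t _.
  by rewrite Gsup; exact: ereal_nondecreasing_cvgn.
pose G' t := if t == 0 then +oo%E else G t.
have FG' t : (F t <= G' t)%E.
  by rewrite /G'; case: eqP => [_|/eqP t0]; rewrite ?leey// Gsup; exact: FG.
apply: le_trans (ge0_le_integralT F0 FG') _.
have GG' : {in (setT `\ (0:R)), G =1 G'}.
  by move=> t; rewrite inE => -[_ /= /eqP t0]; rewrite /G' (negbTE t0).
have mD : measurable ((setT : set R) `\ 0) by apply: measurableD.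
rewrite -(@integral_setD1 _ G' 0)//; last first.
  apply: (eq_measurable_fun G) => //; exact: measurable_funTS.
have -> : (\int[mu]_(x in (setT : set R) `\ 0%R) G' x = \int[mu]_(x in (setT : set R) `\ 0%R) G x)%E.
  by apply: eq_integral => t tD; rewrite GG'.
rewrite (@integral_setD1 _ G 0)//; last exact: measurable_funTS.
rewrite /G monotone_convergence//.
have -> : (fun k => \int[mu]_t g k t)%E = (fun k => (J (fk k))%:E).
  apply/funext => k /=; rewrite fineK//; apply: integrable_fin_num => //.
  exact: Cc1_integrable (J_slice _).
have /cvg_lim -> // := ereal_nondecreasing_cvgn (J_chain_nd hk).
Qed.

Lemma iint_mct n (f : 'rV[R]_n -> \bar R) (fk : nat -> 'rV[R]_n -> R) :
  Cc_chain fk -> (forall x, 0 <= f x)%E ->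
  (forall x, f x <= ereal_sup (range (fun k => (fk k x)%:E)))%E ->
  (iint f <= ereal_sup (range (fun k => (J (fk k))%:E)))%E.
Proof.
elim: n f fk => [|n IH] f fk hk f0 ffk; first exact: ffk.
apply: mct_slice => // t; first exact: iint_ge0.
by move=> _; apply: IH => //; exact: Cc_chain_slice.
Qed.

(** Discarding a single value of the outermost variable discards a hyperplane, which contains the
    set [z = 0] as soon as [z] has at least one coordinate. *)
Lemma iint_mct_ae n (f : 'rV[R]_n.+1 -> \bar R) (fk : nat -> 'rV[R]_n.+1 -> R) :
  Cc_chain fk -> (forall x, 0 <= f x)%E ->
  (forall x : 'rV[R]_n.+1, (x 0 ord0 != 0)%R -> f x <= ereal_sup (range (fun k => (fk k x)%:E)))%E ->
  (iint f <= ereal_sup (range (fun k => (J (fk k))%:E)))%E.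
Proof.
move=> hk f0 ffk; apply: mct_slice => // t; first exact: iint_ge0.
move=> t0; apply: iint_mct => //; first exact: Cc_chain_slice.
by move=> v; apply: ffk; rewrite cons_row0.
Qed.

End Cc.

(** * Differentiability from continuous partial derivatives, chain rules, powers *)

Section Calculus.
Context {R : realType}.

Lemma MVT_sym (g dg : R -> R) (t h : R) :
  (forall r, `|t - r| <= `|h| -> is_derive r (1 : R) g (dg r)) ->
  exists c, `|t - c| <= `|h| /\ g (h + t) - g t = dg c * h.
Proof.
move=> dl.
have cl a b : (forall r, a <= r <= b -> `|t - r| <= `|h|) -> {within `[a, b], continuous g}.
  move=> ab; apply: continuous_in_subspaceT => r; rewrite inE /= in_itv /= => /ab tr.
  by apply/differentiable_continuous/derivable1_diffP; exact: (@ex_derive _ _ _ _ _ _ _ (dl r tr)).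
case: (ltgtP h 0) => hs.
- have lt : h + t < t by rewrite gtrDr.
  have near r : h + t <= r <= t -> `|t - r| <= `|h|.
    by move=> /andP[? ?]; rewrite (ltr0_norm hs) ger0_norm; lra.
  have dl' r : r \in `]h + t, t[ -> is_derive r (1 : R) g (dg r).
    by rewrite in_itv /= => /andP[? ?]; apply/dl/near; lra.
  have [c] := MVT lt dl' (cl _ _ near).
  rewrite in_itv /= => /andP[c1 c2] E; exists c; split; first by apply: near; lra.
  by rewrite -[LHS]opprB E; ring.
- have lt : t < h + t by rewrite ltrDr.
  have near r : t <= r <= h + t -> `|t - r| <= `|h|.
    by move=> /andP[? ?]; rewrite (gtr0_norm hs) ler0_norm; lra.
  have dl' r : r \in `]t, h + t[ -> is_derive r (1 : R) g (dg r).
    by rewrite in_itv /= => /andP[? ?]; apply/dl/near; lra.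
  have [c] := MVT lt dl' (cl _ _ near).
  rewrite in_itv /= => /andP[c1 c2] E; exists c; split; first by apply: near; lra.
  by rewrite E; ring.
- by exists t; rewrite hs subrr normr0 add0r subrr mulr0.
Qed.

(** A directional derivative sees only the restriction to a line, so it transfers between functions
    on different spaces that agree along their lines. *)
Lemma is_derive_reparam (V V' W : normedModType R) (f : V -> W) (g : V' -> W) a v b w :
  (forall h : R, f (h *: v + a) = g (h *: w + b)) ->
  derivable g b w -> is_derive a v f ('D_w g b).
Proof.
move=> fg dg.
have fgE : (fun h : R => h^-1 *: ((f \o shift a) (h *: v) - f a)) =
           (fun h : R => h^-1 *: ((g \o shift b) (h *: w) - g b)).
  by apply/funext => h /=; rewrite fg; have := fg 0; rewrite !scale0r !add0r => ->.
by split; rewrite /derivable /derive fgE.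
Qed.

Lemma is_derive_comp1 (V : normedModType R) (f : V -> R) (g : R -> R) (x v : V) (df dg : R) :
  is_derive x v f df -> is_derive (f x) (1 : R) g dg ->
  is_derive x v (g \o f) (dg * df).
Proof.
move=> [fd fE] [gd gE].
have E : (fun h : R => h^-1 *: (((g \o f) \o shift x) (h *: v) - (g \o f) x)) =
         (fun h : R => h^-1 *: (((g \o (fun h => f (h *: v + x))) \o shift 0) (h *: (1 : R)) - (g \o (fun h => f (h *: v + x))) 0)).
  by apply/funext => h /=; rewrite addr0 scale0r add0r [h *: 1]mulr1.
have Ef : (fun h : R => h^-1 *: ((f \o shift x) (h *: v) - f x)) =
         (fun h : R => h^-1 *: (((fun h => f (h *: v + x)) \o shift 0) (h *: (1 : R)) - (fun h => f (h *: v + x)) 0)).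
  by apply/funext => h /=; rewrite addr0 scale0r add0r [h *: 1]mulr1.
pose F (h : R) := f (h *: v + x).
have F0 : F 0 = f x by rewrite /F scale0r add0r.
have Fd : is_derive (0 : R) (1 : R) F df.
  by split; rewrite ?/derivable -?fE ?/derive -/F -?Ef.
have Gd : is_derive (F 0) (1 : R) g dg by rewrite F0.
have := @is_derive1_comp _ g F 0 _ _ Gd Fd.
by move=> [h1 h2]; split; [rewrite /derivable E|rewrite /derive E].
Qed.

Lemma is_derive_coord n (x v : 'rV[R]_n) i : is_derive x v (fun y : 'rV[R]_n => y 0 i) (v 0 i).
Proof.
have dm : differentiable (fun y : 'rV[R]_n => y 0 i) x by exact: differentiable_coord.
have E : (fun h : R => h^-1 *: (((fun y : 'rV[R]_n => y 0 i) \o shift x) (h *: v) - x 0 i)) =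
   (fun h : R => h^-1 *: (h * v 0 i)).
  by apply/funext => h /=; rewrite !mxE addrK.
have H : (fun h : R => h^-1 *: (h * v 0 i)) @ 0^' --> v 0 i.
  apply: cvg_near_cst; near=> h.
  by rewrite [_ *: _]mulrA mulVf ?mul1r//; near: h; exact: nbhs_dnbhs_neq.
by split; rewrite /derivable /derive E; [apply/cvg_ex; eexists; exact: H|exact: cvg_lim H].
Unshelve. all: by end_near. Qed.

Definition C1at n (f : 'rV[R]_n -> R) (x : 'rV[R]_n) : Prop :=
  forall i, (\forall y \near x, derivable f y (ebas R i)) /\
            {for x, continuous (fun y => 'D_(ebas R i) f y)}.

Definition pgrad n (c : 'I_n -> R) (h : 'rV[R]_n) : R^o := \sum_i h 0 i * c i.

Lemma pgrad_is_linear n (c : 'I_n -> R) : linear (pgrad c).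
Proof.
move=> a x y; rewrite /pgrad scaler_sumr -big_split; apply: eq_bigr => i _ /=.
by rewrite !mxE mulrDl -mulrA.
Qed.

HB.instance Definition _ n (c : 'I_n -> R) :=
  GRing.isLinear.Build R 'rV[R]_n R^o _ (pgrad c) (pgrad_is_linear c).

Lemma continuous_coord n i : continuous (fun y : 'rV[R]_n => y 0 i).
Proof. by move=> x; apply: differentiable_continuous; exact: differentiable_coord. Qed.

Lemma continuous_sum (V : normedModType R) (I : Type) (r : seq I) (P : pred I)
    (F : I -> V -> R) x : (forall i, P i -> {for x, continuous (F i)}) ->
  {for x, continuous (fun y => \sum_(i <- r | P i) F i y)}.
Proof.
move=> h; elim: r => [|i r IH].
  have -> : (fun y => \sum_(i <- [::] | P i) F i y) = (fun=> 0).
    by apply/funext => y; rewrite big_nil.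
  exact: cst_continuous.
case E : (P i).
  have -> : (fun y => \sum_(j <- i :: r | P j) F j y) = (fun y => F i y + \sum_(j <- r | P j) F j y).
    by apply/funext => y; rewrite big_cons E.
  by apply: continuousD => //; apply: h.
have -> : (fun y => \sum_(j <- i :: r | P j) F j y) = (fun y => \sum_(j <- r | P j) F j y).
  by apply/funext => y; rewrite big_cons E.
exact: IH.
Qed.

(** The increment is telescoped along a path that changes one coordinate at a time, with the mean
    value theorem on each edge. The full differential is what the chain rule for [Xf] requires,
    whereas [C1] speaks of partial derivatives only. *)
Lemma C1at_differentiable n (f : 'rV[R]_n -> R) x : C1at f x ->
  differentiable (f : 'rV[R]_n -> R^o) x.
Proof.
move=> hf.
pose c i := 'D_(ebas R i) f x.
have cc : continuous (pgrad c).
  move=> y; apply: continuous_sum => i _.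
  by apply: continuousM; [exact: continuous_coord|exact: cst_continuous].
have H : (f : 'rV[R]_n -> R^o) \o shift x = cst (f x) + pgrad c +o_ (0 : 'rV[R]_n) id.
  apply/eqaddoP => e e0.
  have n0 : 0 < n%:R + 1 :> R by rewrite ltr_wpDl.
  pose P i y := derivable f y (ebas R i) /\ `|c i - 'D_(ebas R i) f y| < e / (n%:R + 1).
  have Pn : \forall y \near nbhs x, forall i, P i y.
    apply: filter_forall => i; have [h1 h2] := hf i.
    apply: filterI => //; move/cvgrPdist_lt : h2; apply; exact: divr_gt0.
  have /nbhs_ballP [d /= d0 hd] := Pn.
  apply/nbhs_ballP; exists d => //= h; rewrite -ball_normE /= sub0r normrN => hh.
  (* Vertices of the path from 0 to [h]: the first [k] coordinates have already been moved. *)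
  pose tr k : 'rV[R]_n := \row_i (if (i < k)%N then h 0 i else 0).
  have trS (k : 'I_n) : tr k.+1 = tr k + h 0 k *: ebas R k.
    apply/rowP => i; rewrite !mxE ltnS leq_eqVlt eqxx /=.
    case: (eqVneq i k) => [->|ik] /=; first by rewrite eqxx ltnn add0r mulr1.
    by rewrite (negbTE (_ : val i != val k))//= mulr0 addr0.
  have tr0 : tr 0%N = 0 by apply/rowP => i; rewrite !mxE ltn0.
  have trn : tr n = h by apply/rowP => i; rewrite !mxE ltn_ord.
  have step (k : 'I_n) : `|f (x + tr k.+1) - f (x + tr k) - h 0 k * c k| <= `|h| * (e / (n%:R + 1)).
    have nearr r : `|0 - r| <= `|h 0 k| -> `|x - (x + tr k + r *: ebas R k)| < d.
      rewrite sub0r normrN => rh; apply: le_lt_trans hh.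
      rewrite -addrA opprD addrA subrr sub0r normrN; apply: rV_norm_le => // i.
      rewrite !mxE eqxx /=; case: (eqVneq i k) => [->|ik] /=.
        by rewrite ltnn add0r mulr1 (le_trans rh)// rV_coord_le.
      by rewrite mulr0 addr0; case: ifP => _; rewrite ?normr0// rV_coord_le.
    have dP r : `|0 - r| <= `|h 0 k| -> P k (x + tr k + r *: ebas R k).
      by move=> hr; apply: hd; rewrite -ball_normE /=; exact: nearr.
    have [s [hs]] := MVT_sym (fun r hr => is_derive_line (dP r hr).1).
    rewrite addr0 scale0r addr0 -addrA -trS => ->.
    rewrite mulrC -mulrBr normrM; apply: ler_pM => //; first exact: rV_coord_le.
    by rewrite distrC ltW//; exact: (dP s hs).2.
  rewrite /= [X in `|X|](_ : _ = \sum_(k < n) (f (x + tr k.+1) - f (x + tr k) - h 0 k * c k)).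
    apply: le_trans (ler_norm_sum _ _ _) _.
    apply: (@le_trans _ _ (\sum_(k < n) `|h| * (e / (n%:R + 1)))); first exact: ler_sum.
    rewrite sumr_const card_ord -[leLHS]mulr_natr [leRHS]mulrC -!mulrA ler_wpM2l//.
    by rewrite ger_pMr// ler_pdivrMl// mulr1 lerDl ler01.
  rewrite big_split /= sumrN -(big_mkord xpredT (fun k => f (x + tr k.+1) - f (x + tr k))).
  by rewrite telescope_sumr// trn tr0 addr0 -[LHS]/(f (h + x) - (f x + pgrad c h)) [h + x]addrC opprD addrA.
have du : 'd (f : 'rV[R]_n -> R^o) x = pgrad c :> (_ -> _) by exact: diff_unique.
by apply/diff_locallyP; rewrite du.
Qed.

(** Restricting [G] to the line through [e] gives a curve in one real variable, where derivability
    is differentiability, and the usual chain rule applies to it. *)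
Lemma derive_chain (V : normedModType R) m (u : 'rV[R]_m -> R) (G : V -> 'rV[R]_m) (e v : V) :
  differentiable (u : 'rV[R]_m -> R^o) (G e) ->
  (forall j, derivable (fun y => G y 0 j) e v) ->
  is_derive e v (u \o G) (\sum_j 'D_v (fun y => G y 0 j) e * 'D_(ebas R j) u (G e)).
Proof.
move=> du dG.
have dGm : derivable G e v by apply/derivable_mxP => i j; rewrite ord1; exact: dG.
pose g (h : R) := G (h *: v + e).
have g0 : g 0 = G e by rewrite /g scale0r add0r.
have E1 : (fun h : R => h^-1 *: (((u \o G) \o shift e) (h *: v) - (u \o G) e)) =
         (fun h : R => h^-1 *: (((u \o g) \o shift 0) (h *: (1 : R)) - (u \o g) 0)).
  by apply/funext => h /=; rewrite /g addr0 scale0r add0r [h *: 1]mulr1.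
have E2 : (fun h : R => h^-1 *: ((G \o shift e) (h *: v) - G e)) =
         (fun h : R => h^-1 *: ((g \o shift 0) (h *: (1 : R)) - g 0)).
  by apply/funext => h /=; rewrite /g addr0 scale0r add0r [h *: 1]mulr1.
have dg : differentiable g 0 by apply/derivable1_diffP; rewrite /derivable -E2.
have Dg : 'd g 0 1 = 'D_v G e by rewrite -deriveE// /derive -E2.
have dug : differentiable ((u : _ -> R^o) \o g) 0 by apply: differentiable_comp => //; rewrite g0.
have dd : is_derive (0 : R) (1 : R) ((u : _ -> R^o) \o g) ('d (u : _ -> R^o) (G e) ('D_v G e)).
  split; first by apply/derivable1_diffP.
  by rewrite deriveE// diff_comp ?g0//= Dg.
have -> : \sum_j 'D_v (fun y => G y 0 j) e * 'D_(ebas R j) u (G e) = 'd (u : _ -> R^o) (G e) ('D_v G e).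
  rewrite derive_mx// [X in 'd _ _ X]row_sum_delta linear_sum; apply: eq_bigr => j _.
  by rewrite linearZ /= mxE; congr (_ * _); exact: deriveE.
by case: dd => h1 h2; split; [rewrite /derivable E1|rewrite /derive E1].
Qed.

Lemma powRn_small (q e : R) : 0 < q -> 0 < e ->
  exists d, 0 < d /\ forall h : R, `|h| < d -> `|h| `^ q <= e.
Proof.
move=> q0 e0; exists (e `^ q^-1); split; first exact: powR_gt0.
move=> y ye; rewrite -[leRHS](powRr1 (ltW e0)) -(@mulVf _ q) ?gt_eqF// powRrM.
by apply: ge0_ler_powR; rewrite ?nnegrE ?powR_ge0 ?normr_ge0 ?ltW.
Qed.

Lemma powRn_continuous0 (q : R) : 0 < q -> continuous (fun t : R => `|t| `^ q).
Proof.
move=> q0 t; have [->|t0] := eqVneq t 0.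
  apply: continuous_epsP => e /(powRn_small q0) [d [d0 hd]]; exists d; split => // y.
  rewrite sub0r !normrN normr0 powR0 ?gt_eqF// sub0r normrN => /hd.
  by rewrite (ger0_norm (powR_ge0 _ _)).
apply: (@continuous_comp _ _ _ (fun t : R => `|t|) (fun a => a `^ q)); first exact: norm_continuous.
apply/differentiable_continuous/derivable1_diffP; apply: ex_derive; apply: is_derive1_powR.
by rewrite normr_gt0.
Qed.

Lemma powR_continuous_pos (q t : R) : 0 < t -> {for t, continuous (fun a : R => a `^ q)}.
Proof.
by move=> t0; apply/differentiable_continuous/derivable1_diffP; apply: ex_derive; exact: is_derive1_powR.
Qed.

Lemma sg_near (t : R) : t != 0 -> \forall y \near t, Num.sg y = Num.sg t.
Proof.
move=> t0; have [tp|tn] := ltP 0 t.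
  by near=> y; rewrite (gtr0_sg tp) gtr0_sg//; near: y; exact: lt_nbhsr.
have {}tn : t < 0 by rewrite lt_neqAle t0.
by near=> y; rewrite (ltr0_sg tn) ltr0_sg//; near: y; exact: lt_nbhsl.
Unshelve. all: by end_near. Qed.

Lemma sg_powR_continuous (q : R) : 0 < q -> continuous (fun t : R => Num.sg t * `|t| `^ q).
Proof.
move=> q0 t; have [->|t0] := eqVneq t 0.
  apply: continuous_epsP => e e0.
  have [d [d0 hd]] := powRn_small q0 e0.
  exists d; split => // y; rewrite sub0r normrN => /hd h.
  rewrite sgr0 mul0r sub0r normrN normrM; apply: le_trans h.
  rewrite (ger0_norm (powR_ge0 _ _)) -[leRHS]mul1r ler_wpM2r ?powR_ge0// normr_sg.
  by case: (y != 0).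
have H : {for t, continuous (fun y : R => Num.sg t * `|y| `^ q)}.
  by apply: continuousM; [exact: cst_continuous|exact: powRn_continuous0].
by apply: cvg_trans H; apply: near_eq_cvg; apply: filterS (sg_near t0) => y ->.
Qed.

(** At [t = 0] the difference quotient has modulus [|h|^(p-1)], which tends to 0 because [p > 1]. *)
Lemma is_derive_normpow (p t : R) : 1 < p ->
  is_derive t (1 : R) (fun t : R => `|t| `^ p) (p * (Num.sg t * `|t| `^ (p - 1))).
Proof.
move=> p1; have p0 : 0 < p by lra.
have [tp|tn|<-] := ltgtP 0 t.
- apply: (@near_eq_is_derive _ _ _ (fun a => a `^ p)).
    near=> y; rewrite gtr0_norm//; near: y; exact: lt_nbhsr.
  rewrite gtr0_sg// mul1r gtr0_norm//; exact: is_derive1_powR.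
- apply: (@near_eq_is_derive _ _ _ ((fun a => a `^ p) \o -%R)).
    near=> y; rewrite /= ltr0_norm//; near: y; exact: lt_nbhsl.
  have nt : 0 < - t by lra.
  have h := is_derive1_powR p nt.
  have -> : p * (Num.sg t * `|t| `^ (p - 1)) = p * (- t) `^ (p - 1) * -1.
    by rewrite ltr0_sg// ltr0_norm//; ring.
  apply: is_derive1_comp.
- rewrite sgr0 mul0r mulr0.
  have H : (fun h : R => h^-1 *: (((fun t : R => `|t| `^ p) \o shift 0) (h *: (1 : R)) - `|0 : R| `^ p)) @ 0^' --> (0 : R).
    apply/cvgrPdist_le => e e0.
    have p10 : 0 < p - 1 by lra.
    have [d [d0 hd]] := powRn_small p10 e0.
    near=> h.
    have h0 : h != 0 by near: h; exact: nbhs_dnbhs_neq.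
    have hd' : `|h| < d by near: h; exact: dnbhs0_lt.
    rewrite /= sub0r normrN addr0 [h *: 1]mulr1 normr0 powR0 ?gt_eqF// subr0.
    rewrite [_ *: _]mulrC normrM normfV (ger0_norm (powR_ge0 _ _)) -mulr_powRB1// mulrAC mulfV ?normr_eq0// mul1r; exact: hd.
  by split; [apply/cvg_ex; eexists; exact: H|exact: cvg_lim H].
Unshelve. all: by end_near. Qed.

End Calculus.

(** * Coefficients of the left-invariant fields and their homogeneity *)

Section CarnotFacts.
Context {R : realType}.

Lemma is_derive_scale (g1 g2 : R -> R) (c C d1 d2 : R) :
  (forall h, g1 (c * h) = C * g2 h) ->
  is_derive (0 : R) (1 : R) g1 d1 -> is_derive (0 : R) (1 : R) g2 d2 -> c * d1 = C * d2.
Proof.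
move=> h12 D1 D2.
have Dc : is_derive (0 : R) (1 : R) (fun h : R => c * h) c.
  by have := is_deriveZ c (is_derive_id (0 : R) (1 : R)); rewrite [c *: 1]mulr1.
have D1' : is_derive ((fun h : R => c * h) 0) (1 : R) g1 d1 by rewrite mulr0.
have [_ H1] := is_derive1_comp D1' Dc.
have [_ H2] := is_deriveZ C D2.
rewrite mulrC -H1 -[RHS]H2; congr (derive _ _ _); apply/funext => h; exact: h12.
Qed.

Lemma is_derive_affine n (f : 'rV[R]_n -> R) x v d : is_derive x v f d ->
  is_derive (0 : R) (1 : R) (fun h : R => f (h *: v + x)) d.
Proof.
move=> [df <-]; apply: is_derive_reparam df => h.
by rewrite addr0 [h *: 1]mulr1.
Qed.

Variables (N : nat) (deg : 'I_N -> nat).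
Variables (op : 'rV[R]_N -> 'rV[R]_N -> 'rV[R]_N) (inv : 'rV[R]_N -> 'rV[R]_N) (e : 'rV[R]_N).
Hypothesis hC : is_hom_carnot deg op inv e.

Lemma dil0 lam : dil deg lam 0 = 0 :> 'rV[R]_N.
Proof. by apply/rowP => k; rewrite !mxE mulr0. Qed.

Lemma carnot_deg_gt0 k : (0 < deg k)%N.
Proof. by case: hC => + _; exact. Qed.

Lemma dil_op lam x y : 0 < lam -> dil deg lam (op x y) = op (dil deg lam x) (dil deg lam y).
Proof. by case: hC => _ [_ [_ [_ [_ [_ [_ [h _]]]]]]]; exact: h. Qed.

Lemma op_e x : op x e = x.
Proof. by case: hC => _ [_ [_ [h _]]]; have [] := h x. Qed.

Lemma e_op x : op e x = x.
Proof. by case: hC => _ [_ [_ [h _]]]; have [] := h x. Qed.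

(** The dilation by 2 is an automorphism, so it sends [e] to an idempotent, that is to [e]; a vector
    fixed by this dilation is 0 since all degrees are at least 1. *)
Lemma carnot_e0 : e = 0.
Proof.
case: hC => _ [_ [ass [_ [iv _]]]].
have d2 : op (dil deg 2 e) (dil deg 2 e) = dil deg 2 e by rewrite -dil_op// op_e.
have de : dil deg 2 e = e.
  have := congr1 (op (inv (dil deg 2 e))) d2.
  by rewrite -ass (iv _).2 e_op.
apply/rowP => k; rewrite mxE; have := congr1 (fun M : 'rV[R]_N => M 0 k) de.
rewrite mxE => /eqP; rewrite -subr_eq0 -[X in _ - X]mul1r -mulrBl mulf_eq0 => /orP[|/eqP//].
have : (1 : R) < 2 ^+ deg k by rewrite exprn_egt1// ?lt0n_neq0 ?carnot_deg_gt0// ltr1n.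
by rewrite subr_eq0 => /gt_eqF ->.
Qed.

Lemma op0l x : op 0 x = x. Proof. by rewrite -carnot_e0 e_op. Qed.
Lemma op0r x : op x 0 = x. Proof. by rewrite -carnot_e0 op_e. Qed.

(** Coefficient of [d/dx_j] in [X_k], as [Xf_expand] confirms. *)
Definition vfcoef (k j : 'I_N) (x : 'rV[R]_N) : R := 'D_(ebas R k) (fun y => op x y 0 j) 0.

Let G j : 'rV[R]_(N + N) -> R := fun w => op (lsubmx w) (rsubmx w) 0 j.

Let smoothG j : smooth (G j).
Proof. by case: hC => _ [_ [_ [_ [_ [h _]]]]]; exact: h. Qed.

Let ebasr k (h : R) (x y : 'rV[R]_N) : row_mx x (h *: ebas R k + y) = h *: ebas R (rshift N k) + row_mx x y.
Proof.
apply/rowP => i; rewrite !mxE !eqxx /=; case: splitP => j ij; rewrite ?mxE ?eqxx /=.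
  rewrite (_ : (i == rshift N k) = false) ?mulr0 ?add0r//.
  by apply/eqP => /(congr1 val) /=; rewrite ij => h'; have := ltn_ord j; rewrite h' ltnNge leq_addr.
by rewrite (_ : (i == rshift N k) = (j == k))// -val_eqE /= ij eqn_add2l.
Qed.

Let ebasl k (h : R) (x y : 'rV[R]_N) : row_mx (h *: ebas R k + x) y = h *: ebas R (lshift N k) + row_mx x y.
Proof.
apply/rowP => i; rewrite !mxE !eqxx /=; case: splitP => j ij; rewrite ?mxE ?eqxx /=.
  by rewrite (_ : (i == lshift N k) = (j == k))// -val_eqE /= ij.
rewrite (_ : (i == lshift N k) = false) ?mulr0 ?add0r//.
by apply/eqP => /(congr1 val) /=; rewrite ij => h'; have := ltn_ord k; rewrite -h' ltnNge leq_addr.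
Qed.

Lemma vfcoef_is_derive k j x :
  is_derive 0 (ebas R k) (fun y => op x y 0 j) (vfcoef k j x).
Proof.
suff H : is_derive 0 (ebas R k) (fun y => op x y 0 j) ('D_(ebas R (rshift N k)) (G j) (row_mx x 0)).
  by apply: DeriveDef; [exact: ex_derive|].
apply: is_derive_reparam; last by have [_ h] := smoothG j [::]; exact: h.
by move=> h; rewrite /G -ebasr row_mxKl row_mxKr.
Qed.

Let vfcoefE k j : vfcoef k j = fun x => 'D_(ebas R (rshift N k)) (G j) (row_mx x 0).
Proof.
apply/funext => x; apply: derive_val.
apply: is_derive_reparam; last by have [_ h] := smoothG j [::]; exact: h.
by move=> h; rewrite /G -ebasr row_mxKl row_mxKr.
Qed.

Let row_mx0_continuous : continuous (fun x : 'rV[R]_N => row_mx x 0 : 'rV[R]_(N + N)).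
Proof.
move=> x; apply: continuous_epsP => eps eps0; exists eps; split => // y xy.
apply: le_trans (ltW xy); apply: rV_norm_le => // i.
rewrite [in X in `|X|]mxE [in X in _ + X]mxE !mxE; case: splitP => j _.
  by have := rV_coord_le (x - y) j; rewrite !mxE.
by rewrite mxE subrr normr0.
Qed.

Lemma vfcoef_continuous k j : continuous (vfcoef k j).
Proof.
rewrite vfcoefE => x.
apply: (@continuous_comp _ _ _ (fun x => row_mx x 0) (Defs.iterD [:: rshift N k] (G j))).
  exact: row_mx0_continuous.
by have [h _] := smoothG j [:: rshift N k]; exact: h.
Qed.

Definition dvfcoef (k j i : 'I_N) (x : 'rV[R]_N) : R := 'D_(ebas R i) (vfcoef k j) x.

Let dvf k j i x : is_derive x (ebas R i) (vfcoef k j)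
   (Defs.iterD [:: lshift N i; rshift N k] (G j) (row_mx x 0)).
Proof.
rewrite vfcoefE; apply: is_derive_reparam; last first.
  by have [_ h] := smoothG j [:: rshift N k]; exact: h.
by move=> h /=; rewrite ebasl.
Qed.

Lemma dvfcoef_is_derive k j i x : is_derive x (ebas R i) (vfcoef k j) (dvfcoef k j i x).
Proof. by apply: DeriveDef => //; exact: ex_derive. Qed.

Lemma dvfcoef_continuous k j i : continuous (dvfcoef k j i).
Proof.
have -> : dvfcoef k j i = fun x => Defs.iterD [:: lshift N i; rshift N k] (G j) (row_mx x 0).
  by apply/funext => x; exact: derive_val.
move=> x.
apply: (@continuous_comp _ _ _ (fun x => row_mx x 0) (Defs.iterD [:: lshift N i; rshift N k] (G j))).
  exact: row_mx0_continuous.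
by have [h _] := smoothG j [:: lshift N i; rshift N k]; exact: h.
Qed.

Lemma vfcoef_C1at k j x : C1at (vfcoef k j) x.
Proof.
move=> i; split; last exact: dvfcoef_continuous.
by apply/nbhs_ballP; exists 1 => //= y _; exact: (@ex_derive _ _ _ _ _ _ _ (dvfcoef_is_derive k j i y)).
Qed.

Lemma dil_ebas lam k (h : R) x :
  dil deg lam (h *: ebas R k + x) = (lam ^+ deg k * h) *: ebas R k + dil deg lam x.
Proof.
apply/rowP => i; rewrite !mxE eqxx /=; case: (eqVneq i k) => [->|_] /=.
  by rewrite !mulr1 mulrDr.
by rewrite !mulr0 !add0r.
Qed.

(** Homogeneity of degree [deg j - deg k], written without a possibly negative exponent. *)
Lemma vfcoef_dil k j lam x : 0 < lam ->
  lam ^+ deg k * vfcoef k j (dil deg lam x) = lam ^+ deg j * vfcoef k j x.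
Proof.
move=> l0; apply: (is_derive_scale (g1 := fun h => op (dil deg lam x) (h *: ebas R k + 0) 0 j)
   (g2 := fun h => op x (h *: ebas R k + 0) 0 j)).
- by move=> h; rewrite -[X in _ + X](dil0 lam) -dil_ebas -dil_op// mxE.
- exact: (is_derive_affine (vfcoef_is_derive k j (dil deg lam x))).
- exact: (is_derive_affine (vfcoef_is_derive k j x)).
Qed.

Lemma dvfcoef_dil k j i lam x : 0 < lam ->
  lam ^+ deg i * lam ^+ deg k * dvfcoef k j i (dil deg lam x) = lam ^+ deg j * dvfcoef k j i x.
Proof.
move=> l0; rewrite -mulrA [X in _ * X]mulrC mulrA -[LHS]mulrA [X in _ * X]mulrC.
apply: (is_derive_scale (g1 := fun h => lam ^+ deg k * vfcoef k j (h *: ebas R i + dil deg lam x))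
   (g2 := fun h => vfcoef k j (h *: ebas R i + x))).
- by move=> h; rewrite -dil_ebas vfcoef_dil.
- exact: is_deriveZ (is_derive_affine (dvfcoef_is_derive k j i (dil deg lam x))).
- exact: (is_derive_affine (dvfcoef_is_derive k j i x)).
Qed.

Lemma dil_cvg0 (f : 'rV[R]_N -> R) x : continuous f -> forall eps, 0 < eps ->
  exists lam, [/\ 0 < lam, lam <= eps & `|f 0 - f (dil deg lam x)| <= eps].
Proof.
move=> cf eps e0; have [d [d0 hd]] := continuous_epsE (cf 0) e0.
pose lam := Num.min (Num.min 1 eps) (d / (`|x| + 1) / 2).
have x1 : 0 < `|x| + 1 by rewrite ltr_wpDl.
have l0 : 0 < lam by rewrite !lt_min ltr01 e0 !divr_gt0.
exists lam; split => //; first by rewrite !ge_min lexx orbT.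
apply/ltW/hd; rewrite sub0r normrN.
have l1 : lam <= 1 by rewrite !ge_min lexx.
apply: (@le_lt_trans _ _ (lam * (`|x| + 1))).
  apply: rV_norm_le; first by rewrite mulr_ge0// ltW.
  move=> i; rewrite mxE normrM ger0_norm ?exprn_ge0 ?(ltW l0)//.
  apply: ler_pM => //; rewrite ?exprn_ge0 ?(ltW l0)//.
    by rewrite -[leRHS]expr1 ler_wiXn2l ?carnot_deg_gt0// ltW.
  by apply: le_trans (rV_coord_le _ _) _; rewrite lerDl.
rewrite -ltr_pdivlMr//; apply: (@le_lt_trans _ _ (d / (`|x| + 1) / 2)); first by rewrite !ge_min lexx orbT.
by rewrite ltr_pdivrMr// ltr_pMr ?ltr1n// divr_gt0.
Qed.

(** This derivative is homogeneous of degree -1: its value at [x] is [lam] times its value at the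
    dilated point, which stays bounded as [lam] tends to 0. Every term of the divergence of [X_k]
    thus vanishes separately. *)
Lemma dvfcoef_diag k j x : deg k = 1%N -> dvfcoef k j j x = 0.
Proof.
move=> k1; apply/eqP; rewrite -normr_le0; apply/ler_addgt0Pr => eps e0; rewrite add0r.
set M := `|dvfcoef k j j 0| + 1.
have M0 : 0 < M by rewrite ltr_wpDl.
have ee : 0 < Num.min 1 (eps / M) by rewrite lt_min ltr01 divr_gt0.
have [lam [l0 lle hl]] := dil_cvg0 x (@dvfcoef_continuous k j j) ee.
have := dvfcoef_dil k j j x l0; rewrite k1 expr1 -mulrA => /(mulfI (lt0r_neq0 (exprn_gt0 _ l0))) <-.
rewrite normrM gtr0_norm//.
apply: (@le_trans _ _ (eps / M * M)); last by rewrite divfK ?gt_eqF.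
apply: ler_pM => //; first exact: ltW.
  by apply: le_trans lle _; rewrite ge_min lexx orbT.
rewrite /M -lerBlDl; apply: le_trans (lerB_dist _ _) _; rewrite distrC (le_trans hl)//.
by rewrite ge_min lexx.
Qed.

(** A function homogeneous of degree 0 and continuous at the origin is constant, and at the origin
    the group law is [op 0 y = y]. *)
Lemma vfcoef_layer1 k j x : deg k = 1%N -> deg j = 1%N -> vfcoef k j x = (k == j)%:R.
Proof.
move=> k1 j1.
have -> : vfcoef k j x = vfcoef k j 0.
  apply/eqP; rewrite -subr_eq0 -normr_le0; apply/ler_addgt0Pr => eps e0; rewrite add0r.
  have [lam [l0 _ hl]] := dil_cvg0 x (@vfcoef_continuous k j) e0.
  have := vfcoef_dil k j x l0; rewrite k1 j1 => /(mulfI (lt0r_neq0 (exprn_gt0 _ l0))) <-.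
  by rewrite distrC.
rewrite /vfcoef; under eq_fun do rewrite op0l.
have -> := @derive_val _ _ _ _ _ _ _ (is_derive_coord 0 (ebas R k) j).
by rewrite mxE eqxx eq_sym.
Qed.

Lemma Xf_expand (u : 'rV[R]_N -> R) k x : C1at u x ->
  Xf op e (ebas R k) u x = \sum_j vfcoef k j x * 'D_(ebas R j) u x.
Proof.
move=> /C1at_differentiable du; rewrite /Xf carnot_e0.
have dop j : derivable (fun y => op x y 0 j) 0 (ebas R k).
  exact: (@ex_derive _ _ _ _ _ _ _ (vfcoef_is_derive k j x)).
have du' : differentiable (u : 'rV[R]_N -> R^o) (op x 0) by rewrite op0r.
have [_ H] := derive_chain (G := op x) du' dop.
by apply: etrans H _; rewrite op0r.
Qed.

(** Since the coefficient of [d/dx_j] does not vary along [x_j], it can be moved under the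
    derivative, and each term is the integral of a partial derivative. *)
Lemma J_vfcoef k (F : 'rV[R]_N -> R) (dF : 'I_N -> 'rV[R]_N -> R) : deg k = 1%N ->
  Cc F -> (forall j, Cc (dF j)) -> (forall j x, is_derive x (ebas R j) F (dF j x)) ->
  J (fun x => \sum_j vfcoef k j x * dF j x) = 0.
Proof.
move=> k1 CF CdF FdF.
rewrite J_sum; last by move=> j _; apply: Cc_mull => //; exact: vfcoef_continuous.
apply: big1 => j _.
apply: (@J_derive _ _ (fun x => vfcoef k j x * F x) _ j).
- by apply: Cc_mull => //; exact: vfcoef_continuous.
- by apply: Cc_mull => //; exact: vfcoef_continuous.
move=> x.
have := is_deriveM (dvfcoef_is_derive k j j x) (FdF j x).
rewrite dvfcoef_diag// scaler0 addr0; exact.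
Qed.

(** The coefficient is homogeneous of degree 1 and differentiable at 0, so it equals its derivative
    at 0 along the curve of dilates of [x]. *)
Lemma vfcoef_layer2 k j x : deg k = 1%N -> deg j = 2%N ->
  vfcoef k j x = \sum_(i | deg i == 1%N) x 0 i * dvfcoef k j i 0.
Proof.
move=> k1 j2.
have hom lam y : 0 < lam -> vfcoef k j (dil deg lam y) = lam * vfcoef k j y.
  move=> l0; have := vfcoef_dil k j y l0; rewrite k1 j2 expr1 expr2 -mulrA.
  exact: (mulfI (lt0r_neq0 l0)).
have a0 : vfcoef k j 0 = 0.
  by have := hom 2 0 (ltr0n _ _); rewrite dil0; lra.
(* The velocity of this curve at [h = 0] keeps only the first-layer coordinates, the others being of
   order [h ^ 2] or smaller. *)
pose g (h : R) := dil deg h x.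
have g0 : g 0 = 0.
  by apply/rowP => i; rewrite !mxE expr0n (negbTE (lt0n_neq0 (carnot_deg_gt0 i))) mul0r.
have dg i : is_derive (0 : R) (1 : R) (fun h => g h 0 i) (if deg i == 1%N then x 0 i else 0).
  rewrite (_ : (fun h => g h 0 i) = (fun h : R => h ^+ deg i * x 0 i)); last first.
    by apply/funext => h; rewrite mxE.
  have -> : (fun h : R => h ^+ deg i * x 0 i) = id ^+ deg i * cst (x 0 i).
    by apply/funext => h; rewrite !fctE.
  have H := is_deriveM (is_deriveX (deg i) (is_derive_id (0 : R) (1 : R))) (is_derive_cst (x 0 i) (0 : R) (1 : R)).
  apply: is_derive_eq H _.
  rewrite scaler0 add0r /=; case: eqP => [->|].
    by rewrite [LHS](_ : _ = x 0 i * (1 * 1 * 1))// !mulr1.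
  have := carnot_deg_gt0 i; case: (deg i) => [//|[|d]] // _ _.
  by rewrite /= expr0n /= mulr0 scale0r scaler0.
have da : differentiable (vfcoef k j : 'rV[R]_N -> R^o) (g 0).
  by apply: C1at_differentiable; exact: vfcoef_C1at.
have [dS SE0] := derive_chain da (fun i => @ex_derive _ _ _ _ _ _ _ (dg i)).
set S := \sum_(i | _) _.
have SE : 'D_1 (vfcoef k j \o g) 0 = S.
  rewrite SE0 /S [RHS]big_mkcond; apply: eq_bigr => i _.
  by rewrite (@derive_val _ _ _ _ _ _ _ (dg i)) g0; case: ifP => _; rewrite ?mul0r.
apply/eqP; rewrite -subr_eq0 -normr_le0; apply/ler_addgt0Pr => eps e0; rewrite add0r.
move/cvg_ex : dS => [l cl].
have lE : S = l by rewrite -SE; exact: cvg_lim cl.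
rewrite lE; move/cvgrPdist_le : cl => /(_ _ e0) /nbhs_ballP [d /= d0 hd].
have d2 : 0 < d / 2 by rewrite divr_gt0.
have := hd (d / 2); rewrite -ball_normE /= sub0r normrN gtr0_norm//.
rewrite ltr_pdivrMr// ltr_pMr ?ltr1n// => /(_ isT) /(_ (lt0r_neq0 d2)).
rewrite addr0 [_ *: 1]mulr1 g0 a0 subr0 /g hom// [_ *: _]mulKf ?gt_eqF//.
by rewrite distrC.
Qed.

Let card_ltn n : (n <= N)%N -> #|[pred j : 'I_N | (j < n)%N]| = n.
Proof.
move=> nN; rewrite -sum1_card (eq_bigl (fun j : 'I_N => (j < n)%N))//.
by rewrite (big_ord_narrow nN) /= sum_nat_const card_ord muln1.
Qed.

(** Degrees increase with the index, so an index outside the first layer has all of that layer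
    strictly before it. *)
Lemma deg_layer1 m (k : 'I_N) : (m <= lay1 deg)%N -> (k < m)%N -> deg k = 1%N.
Proof.
move=> ml km; apply/eqP; apply: contraT => k1.
have : (lay1 deg <= k)%N.
  rewrite -(card_ltn (ltnW (ltn_ord k))); apply: subset_leq_card.
  apply/fintype.subsetP => j; rewrite !inE => /eqP j1.
  rewrite ltnNge; apply/negP => kj; case: hC => dp [dm _].
  by have := dm _ _ kj; rewrite j1; have := carnot_deg_gt0 k; move: k1; case: (deg k) => [|[]].
by rewrite leqNgt (leq_trans km ml).
Qed.

Lemma layer1_lt (k : 'I_N) : deg k = 1%N -> (k < lay1 deg)%N.
Proof.
move=> k1; rewrite -[X in (X <= _)%N](card_ltn (ltn_ord k)); apply: subset_leq_card.
apply/fintype.subsetP => j; rewrite !inE ltnS => jk.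
case: hC => dp [dm _]; have := dm _ _ jk; rewrite k1 => h.
by change (is_true (deg j == 1%N)); rewrite eqn_leq h dp.
Qed.

End CarnotFacts.

(** * Gluing by zero, the norm of [z], Cauchy-Schwarz and Young inequalities *)

Section Geometry.
Context {R : realType}.

(** Allows weights singular at [z = 0] to be examined on [U] alone: a point outside the closed set
    [K] has a whole neighbourhood on which [f] is 0. *)
Lemma glue_continuous (V W : normedModType R) (K U : set V) (f : V -> W) :
  closed K -> K `<=` U -> (forall x, ~ K x -> f x = 0) ->
  (forall x, U x -> {for x, continuous f}) -> continuous f.
Proof.
move=> cK KU f0 fU x; have [Kx|nKx] := pselect (K x); first exact/fU/KU.
have nK : \forall y \near x, ~ K y by apply: open_nbhs_nbhs; split => //; exact: closed_openC.
rewrite /continuous_at f0//; apply: cvg_near_cst; apply: filterS nK => y; exact: f0.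
Qed.

Lemma glue_derive n (K U : set 'rV[R]_n) (f df : 'rV[R]_n -> R) v :
  closed K -> K `<=` U -> (forall x, ~ K x -> f x = 0) -> (forall x, ~ K x -> df x = 0) ->
  (forall x, U x -> is_derive x v f (df x)) -> forall x, is_derive x v f (df x).
Proof.
move=> cK KU f0 df0 fU x; have [Kx|nKx] := pselect (K x); first exact/fU/KU.
have nK : \forall y \near x, ~ K y by apply: open_nbhs_nbhs; split => //; exact: closed_openC.
rewrite df0//; have Z : is_derive x v (cst 0 : 'rV[R]_n -> R) 0 by exact: is_derive_cst.
by apply: near_eq_is_derive Z; apply: filterS nK => y /f0.
Qed.

Lemma derive_off n (K : set 'rV[R]_n) (f : 'rV[R]_n -> R) v x :
  closed K -> (forall x, ~ K x -> f x = 0) -> ~ K x -> 'D_v f x = 0.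
Proof.
move=> cK f0 nKx.
have nK : \forall y \near x, ~ K y by apply: open_nbhs_nbhs; split => //; exact: closed_openC.
have Z : is_derive x v (cst 0 : 'rV[R]_n -> R) 0 by exact: is_derive_cst.
by apply: derive_val; apply: near_eq_is_derive Z; apply: filterS nK => y /f0.
Qed.

Definition sumsq n (P : pred 'I_n) (x : 'rV[R]_n) : R := \sum_(k < n | P k) x 0 k ^+ 2.

Lemma sumsq_ge0 n (P : pred 'I_n) x : 0 <= sumsq P x.
Proof. by apply: sumr_ge0 => i _; exact: sqr_ge0. Qed.

Lemma sumsq_continuous n (P : pred 'I_n) : continuous (sumsq P).
Proof.
move=> x; apply: continuous_sum => i _.
by apply: continuousM; exact: continuous_coord.
Qed.

Lemma sumsq_coord n (P : pred 'I_n) (x : 'rV[R]_n) k : P k -> x 0 k ^+ 2 <= sumsq P x.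
Proof.
by move=> Pk; rewrite /sumsq (bigD1 k)//= lerDl; apply: sumr_ge0 => i _; exact: sqr_ge0.
Qed.

Lemma sqrt_sumsq_coord n (P : pred 'I_n) (x : 'rV[R]_n) k : P k -> `|x 0 k| <= Num.sqrt (sumsq P x).
Proof. by move=> /(sumsq_coord x) h; rewrite -sqrtr_sqr ler_wsqrtr. Qed.

Lemma is_derive_sumsq n (P : pred 'I_n) x j :
  is_derive x (ebas R j) (sumsq P) (if P j then 2 * x 0 j else 0).
Proof.
have E : sumsq P = \sum_(k < n) (fun y : 'rV[R]_n => if P k then y 0 k * y 0 k else 0).
  apply/funext => y; rewrite /sumsq fct_sumE big_mkcond; apply: eq_bigr => k _.
  by rewrite expr2.
have D k : is_derive x (ebas R j) (fun y : 'rV[R]_n => if P k then y 0 k * y 0 k else 0)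
    (if P k then 2 * x 0 k * (k == j)%:R else 0).
  case: (P k); last exact: is_derive_cst.
  have := is_deriveM (is_derive_coord x (ebas R j) k) (is_derive_coord x (ebas R j) k).
  rewrite !mxE eqxx /= => H; apply: is_derive_eq H _.
  by rewrite -[LHS]/(x 0 k * (k == j)%:R + x 0 k * (k == j)%:R); ring.
rewrite E; apply: is_derive_eq (is_derive_sum D) _.
rewrite (bigD1 j)//= eqxx mulr1 big1 ?addr0// => k /negbTE ->.
by rewrite mulr0; case: ifP.
Qed.

Variable N : nat.
Implicit Types (x : 'rV[R]_N) (m : nat).

Lemma znormE m x : znorm m x = Num.sqrt (sumsq (fun k => (k < m)%N) x).
Proof. by []. Qed.

Lemma znorm_ge0 m x : 0 <= znorm m x. Proof. exact: sqrtr_ge0. Qed.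

Lemma znorm_continuous m : continuous (@znorm R N m).
Proof.
move=> x; apply: (@continuous_comp _ _ _ (sumsq (fun k : 'I_N => (k < m)%N)) Num.sqrt).
  exact: sumsq_continuous.
exact: sqrt_continuous.
Qed.

Lemma znorm_coord m x (k : 'I_N) : (k < m)%N -> `|x 0 k| <= znorm m x.
Proof. by move=> km; rewrite znormE; exact: (@sqrt_sumsq_coord _ (fun k : 'I_N => (k < m)%N)). Qed.

Lemma znorm_sqr m x : znorm m x ^+ 2 = sumsq (fun k => (k < m)%N) x.
Proof. by rewrite sqr_sqrtr// sumsq_ge0. Qed.

Definition dznorm m (j : 'I_N) x : R := if (j < m)%N then x 0 j / znorm m x else 0.

Lemma is_derive_znorm m x j : 0 < znorm m x ->
  is_derive x (ebas R j) (znorm m) (dznorm m j x).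
Proof.
move=> z0.
have s0 : 0 < sumsq (fun k : 'I_N => (k < m)%N) x by rewrite -znorm_sqr exprn_gt0.
have := is_derive_comp1 (is_derive_sumsq (fun k : 'I_N => (k < m)%N) x j) (is_derive1_sqrt s0).
move=> H; apply: is_derive_eq H _; rewrite /dznorm -/(znorm m x); case: ifP => _; last by rewrite mulr0.
by rewrite invfM mulrACA mulVf ?mul1r 1?mulrC// pnatr_eq0.
Qed.

Lemma dznorm_continuous m j x : 0 < znorm m x -> {for x, continuous (dznorm m j)}.
Proof.
move=> z0; rewrite /dznorm; case: (j < m)%N; last exact: cst_continuous.
apply: continuousM; first exact: continuous_coord.
by apply: continuousV; [rewrite gt_eqF|exact: znorm_continuous].
Qed.

Lemma sum_x_dznorm m x : 0 < znorm m x ->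
  \sum_(i < N | (i < m)%N) x 0 i * dznorm m i x = znorm m x.
Proof.
move=> z0; transitivity (\sum_(i < N | (i < m)%N) x 0 i ^+ 2 / znorm m x).
  by apply: eq_bigr => i im; rewrite /dznorm im mulrA.
by rewrite -mulr_suml -[X in X / _]/(sumsq (fun k : 'I_N => (k < m)%N) x) -znorm_sqr expr2 mulfK ?gt_eqF.
Qed.

Lemma cauchy_schwarz (I : finType) (P : pred I) (a b : I -> R) :
  `|\sum_(i | P i) a i * b i| <=
  Num.sqrt (\sum_(i | P i) a i ^+ 2) * Num.sqrt (\sum_(i | P i) b i ^+ 2).
Proof.
set A := Num.sqrt _; set B := Num.sqrt _.
have A2 : A ^+ 2 = \sum_(i | P i) a i ^+ 2 by rewrite sqr_sqrtr// sumr_ge0// => *; exact: sqr_ge0.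
have B2 : B ^+ 2 = \sum_(i | P i) b i ^+ 2 by rewrite sqr_sqrtr// sumr_ge0// => *; exact: sqr_ge0.
have A0 : 0 <= A by exact: sqrtr_ge0.
have B0 : 0 <= B by exact: sqrtr_ge0.
have [A00|An0] := eqVneq A 0.
  have h i : P i -> a i = 0.
    move=> Pi; have : \sum_(i | P i) a i ^+ 2 = 0 by rewrite -A2 A00 expr0n.
    move=> /eqP; rewrite psumr_eq0; last by move=> *; exact: sqr_ge0.
    by move=> /allP /(_ i); rewrite mem_index_enum Pi /= sqrf_eq0 => /(_ isT)/eqP.
  by rewrite big1 ?normr0 ?mulr_ge0// => i /h ->; rewrite mul0r.
have [B00|Bn0] := eqVneq B 0.
  have h i : P i -> b i = 0.
    move=> Pi; have : \sum_(i | P i) b i ^+ 2 = 0 by rewrite -B2 B00 expr0n.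
    move=> /eqP; rewrite psumr_eq0; last by move=> *; exact: sqr_ge0.
    by move=> /allP /(_ i); rewrite mem_index_enum Pi /= sqrf_eq0 => /(_ isT)/eqP.
  by rewrite big1 ?normr0 ?mulr_ge0// => i /h ->; rewrite mulr0.
have Ap : 0 < A by rewrite lt_neqAle eq_sym An0.
have Bp : 0 < B by rewrite lt_neqAle eq_sym Bn0.
apply: (le_trans (ler_norm_sum _ _ _)).
(* Arithmetic-geometric mean with weights chosen so that the two sums contribute [A * B / 2]
   each. *)
apply: (@le_trans _ _ (\sum_(i | P i) (B / A / 2 * a i ^+ 2 + A / B / 2 * b i ^+ 2))).
  apply: ler_sum => i _; rewrite normrM.
  have -> : B / A / 2 * a i ^+ 2 + A / B / 2 * b i ^+ 2 =
     `|a i| * `|b i| + (B * `|a i| - A * `|b i|) ^+ 2 / (2 * A * B).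
    rewrite -(real_normK (num_real (a i))) -(real_normK (num_real (b i))).
    by field; rewrite An0 Bn0.
  by rewrite lerDl divr_ge0 ?sqr_ge0// !mulr_ge0.
rewrite big_split /= -!mulr_sumr -A2 -B2 le_eqVlt; apply/orP; left; apply/eqP.
by field; rewrite An0 Bn0.
Qed.

(** Young's inequality for [A^(p-1)] and [B], with exponents [p / (p-1)] and [p], multiplied by [p];
    equality holds at [A = B], which is what preserves the constant. *)
Lemma young_p (p A B : R) : 1 < p -> 0 <= A -> 0 <= B ->
  p * A `^ (p - 1) * B <= (p - 1) * A `^ p + B `^ p.
Proof.
move=> p1 A0 B0; have p0 : 0 < p by lra. have p10 : 0 < p - 1 by lra.
have := @conjugate_powR _ (A `^ (p - 1)) B (p / (p - 1)) p (powR_ge0 _ _) B0 (divr_gt0 p0 p10) p0.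
have -> : (p / (p - 1))^-1 + p^-1 = 1 by field; rewrite !gt_eqF.
have -> : (A `^ (p - 1)) `^ (p / (p - 1)) = A `^ p.
  by rewrite -powRrM; congr (_ `^ _); field; rewrite gt_eqF.
move=> /(_ erefl) H.
have := ler_wpM2l (ltW p0) H; rewrite mulrA => /le_trans; apply.
rewrite le_eqVlt; apply/orP; left; apply/eqP; field.
by rewrite !gt_eqF.
Qed.

End Geometry.

(** * The weighted inequality away from [z = 0] *)

Section Hardy.
Context {R : realType}.
Variables (N : nat) (deg : 'I_N -> nat).
Variables (op : 'rV[R]_N -> 'rV[R]_N -> 'rV[R]_N) (inv : 'rV[R]_N -> 'rV[R]_N) (e : 'rV[R]_N).
Hypothesis hC : is_hom_carnot deg op inv e.

Lemma C1_C1at n (u : 'rV[R]_n -> R) x : C1 u -> C1at u x.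
Proof.
move=> h i; have [h1 h2] := h i; split; last exact: h2.
by apply/nbhs_ballP; exists 1 => //= y _; exact: h1.
Qed.

Lemma C1_continuous n (u : 'rV[R]_n -> R) : C1 u -> continuous u.
Proof.
move=> h x; have := C1at_differentiable (C1_C1at x h).
exact: differentiable_continuous.
Qed.

Lemma Xf_C1 (u : 'rV[R]_N -> R) k : C1 u ->
  Xf op e (ebas R k) u = fun x => \sum_j vfcoef op k j x * 'D_(ebas R j) u x.
Proof. by move=> hu; apply/funext => x; apply: (Xf_expand hC); exact: C1_C1at. Qed.

Lemma Xf_continuous (u : 'rV[R]_N -> R) k : C1 u -> continuous (Xf op e (ebas R k) u).
Proof.
move=> hu; rewrite Xf_C1// => x; apply: continuous_sum => j _.
by apply: continuousM; [exact: (vfcoef_continuous hC)|exact: (hu j).2].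
Qed.

Lemma gradL_continuous (u : 'rV[R]_N -> R) : C1 u -> continuous (gradL deg op e u).
Proof.
move=> hu x.
apply: (@continuous_comp _ _ _ (fun x => \sum_(k < N | deg k == 1%N) Xf op e (ebas R k) u x ^+ 2) Num.sqrt).
  apply: continuous_sum => k _.
  by apply: continuousM; exact: Xf_continuous.
exact: sqrt_continuous.
Qed.

Lemma gradL_ge0 (u : 'rV[R]_N -> R) x : 0 <= gradL deg op e u x.
Proof. exact: sqrtr_ge0. Qed.

Lemma gradL_off (K : set 'rV[R]_N) (u : 'rV[R]_N -> R) x : C1 u -> closed K ->
  (forall x, ~ K x -> u x = 0) -> ~ K x -> gradL deg op e u x = 0.
Proof.
move=> hu cK u0 nKx; rewrite /gradL big1 ?sqrtr0// => k _.
rewrite Xf_C1// big1 ?expr0n// => j _.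
by rewrite (derive_off _ cK u0 nKx) mulr0.
Qed.

Lemma sum_x_Xf (u : 'rV[R]_N -> R) m (x : 'rV[R]_N) : (m <= lay1 deg)%N ->
  `|\sum_(i < N | (i < m)%N) x 0 i * Xf op e (ebas R i) u x| <= znorm m x * gradL deg op e u x.
Proof.
move=> ml; apply: le_trans (cauchy_schwarz _ _ _) _.
rewrite ler_wpM2l ?sqrtr_ge0// /gradL ler_wsqrtr// [leRHS](bigID (fun k : 'I_N => (k < m)%N)) /=.
rewrite (eq_bigl (fun i : 'I_N => (deg i == 1%N) && (i < m)%N)).
  by rewrite lerDl sumr_ge0// => *; exact: sqr_ge0.
by move=> i; case: ltnP => im; rewrite ?andbF// (deg_layer1 hC ml im).
Qed.

Lemma closed_znorm_ge m eps : closed [set x : 'rV[R]_N | eps <= znorm m x].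
Proof.
rewrite (_ : mkset _ = znorm m @^-1` [set t | eps <= t])//.
by apply: closed_comp; [move=> x _; exact: znorm_continuous|exact: closed_ge].
Qed.

(* [F_i = |u|^p x_i phi(|z|)] summed against the [X_i]: all terms but the
   radial one drop out because the [X_i] act as [d/dx_i] on functions of [z]. *)
Definition hfield (p : R) (u : 'rV[R]_N -> R) (m : nat) (phi : R -> R) (i : 'I_N) (x : 'rV[R]_N) : R :=
  `|u x| `^ p * (x 0 i * phi (znorm m x)).

Definition dhfield (p : R) (u : 'rV[R]_N -> R) (m : nat) (phi dphi : R -> R) (i j : 'I_N) (x : 'rV[R]_N) : R :=
  p * (Num.sg (u x) * `|u x| `^ (p - 1)) * 'D_(ebas R j) u x * (x 0 i * phi (znorm m x)) +
  `|u x| `^ p * ((i == j)%:R * phi (znorm m x) + x 0 i * (dphi (znorm m x) * dznorm m j x)).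

Lemma is_derive_hfield p u m phi dphi i j x : 1 < p -> C1 u -> 0 < znorm m x ->
  is_derive (znorm m x) (1 : R) phi (dphi (znorm m x)) ->
  is_derive x (ebas R j) (hfield p u m phi i) (dhfield p u m phi dphi i j x).
Proof.
move=> p1 hu z0 dphiP.
have du : is_derive x (ebas R j) u ('D_(ebas R j) u x) by apply: derivableP; exact: (hu j).1.
have d1 := is_derive_comp1 du (is_derive_normpow (u x) p1).
have d2 := is_derive_comp1 (is_derive_znorm j z0) dphiP.
have d3 := is_deriveM (is_derive_coord x (ebas R j) i) d2.
have d4 := is_deriveM d1 d3.
apply: is_derive_eq d4 _; rewrite /dhfield !mxE eqxx /=.
rewrite -[LHS]/(`|u x| `^ p * (x 0 i * (dphi (znorm m x) * dznorm m j x) +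
  phi (znorm m x) * (i == j)%:R) + x 0 i * phi (znorm m x) *
  (p * (Num.sg (u x) * `|u x| `^ (p - 1)) * 'D_(ebas R j) u x)).
ring.
Qed.

Lemma dhfield_continuous p u m phi dphi i j x : 1 < p -> C1 u -> 0 < znorm m x ->
  {for znorm m x, continuous phi} -> {for znorm m x, continuous dphi} ->
  {for x, continuous (dhfield p u m phi dphi i j)}.
Proof.
move=> p1 hu z0 cphi cdphi.
have cu : {for x, continuous u} by exact: C1_continuous.
have c1 : {for x, continuous (fun y => phi (znorm m y))}.
  by apply: (@continuous_comp _ _ _ (znorm m) phi); [exact: znorm_continuous|exact: cphi].
have c2 : {for x, continuous (fun y => dphi (znorm m y))}.
  by apply: (@continuous_comp _ _ _ (znorm m) dphi); [exact: znorm_continuous|exact: cdphi].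
have c3 : {for x, continuous (fun y => Num.sg (u y) * `|u y| `^ (p - 1))}.
  apply: (@continuous_comp _ _ _ u (fun t => Num.sg t * `|t| `^ (p - 1))) => //.
  by apply: sg_powR_continuous; lra.
have c4 : {for x, continuous (fun y => `|u y| `^ p)}.
  apply: (@continuous_comp _ _ _ u (fun t => `|t| `^ p)) => //.
  by apply: powRn_continuous0; lra.
apply: continuousD.
  apply: continuousM; last by apply: continuousM => //; exact: continuous_coord.
  apply: continuousM; last exact: (hu j).2.
  by apply: continuousM => //; exact: cst_continuous.
apply: continuousM => //; apply: continuousD.
  by apply: continuousM => //; exact: cst_continuous.
apply: continuousM; first exact: continuous_coord.
by apply: continuousM => //; exact: dznorm_continuous.
Qed.

Lemma div_hfield p u m phi dphi x : C1 u -> (m <= lay1 deg)%N -> 0 < znorm m x ->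
  \sum_(i < N | (i < m)%N) \sum_j vfcoef op i j x * dhfield p u m phi dphi i j x =
  p * (Num.sg (u x) * `|u x| `^ (p - 1)) * phi (znorm m x) *
    (\sum_(i < N | (i < m)%N) x 0 i * Xf op e (ebas R i) u x) +
  `|u x| `^ p * (m%:R * phi (znorm m x) + znorm m x * dphi (znorm m x)).
Proof.
move=> hu ml z0.
have mN : (m <= N)%N by apply: leq_trans ml _; rewrite -[leqRHS]card_ord; exact: max_card.
have vl (i j : 'I_N) : (i < m)%N -> (j < m)%N -> vfcoef op i j x = (i == j)%:R.
  by move=> im jm; apply: (vfcoef_layer1 hC); exact: (deg_layer1 hC ml).
set c := p * _; set w := `|u x| `^ p; set f := phi _; set df := dphi _.
transitivity (\sum_(i < N | (i < m)%N) (c * f * (x 0 i * Xf op e (ebas R i) u x) +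
   (w * f + w * df * (x 0 i * dznorm m i x)))).
  apply: eq_bigr => i im; rewrite Xf_C1//.
  transitivity (\sum_j (c * f * x 0 i * (vfcoef op i j x * 'D_(ebas R j) u x) +
    (w * f * (vfcoef op i j x * (i == j)%:R) + w * df * x 0 i * (vfcoef op i j x * dznorm m j x)))).
    by apply: eq_bigr => j _; rewrite /dhfield -/c -/w -/f -/df; ring.
  rewrite !big_split /= -!mulr_sumr; congr (_ + _); first by rewrite mulrA.
  congr (_ + _).
    rewrite (bigD1 i)//= eqxx vl// eqxx mulr1 big1 ?addr0 ?mulr1// => j /negbTE ji.
    by rewrite eq_sym ji mulr0.
  rewrite -mulrA; congr (_ * (_ * _)).
  rewrite (bigD1 i)//= vl// eqxx mul1r big1 ?addr0// => j ji.
  rewrite /dznorm; case: ifP => jm; last by rewrite mulr0.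
  by rewrite vl// eq_sym (negbTE ji) mul0r.
rewrite !big_split /= -!mulr_sumr sum_x_dznorm//; congr (_ + _).
rewrite sumr_const (_ : #|_| = m); last first.
  by rewrite -sum1_card (big_ord_narrow mN) /= sum_nat_const card_ord muln1.
by rewrite -mulr_natr; ring.
Qed.

(** [kap] is the [p]-th root of the Hardy constant. The last two hypotheses on the weights bound the
    divergence of [s z phi] below by [kap * p * W] and split the size of the field between [W] and
    [V] as Young requires; [s = -1] serves the case [m + beta < 0]. The disjunction lists the two
    ways to stay clear of [z = 0]: [u] vanishes there, or the weights have been cut off. *)
Lemma hardy_core (p kap s eps R0 : R) (m : nat) (phi dphi W V : R -> R)
    (u : 'rV[R]_N -> R) (K : set 'rV[R]_N) :
  (m <= lay1 deg)%N -> 1 < p -> 0 <= kap -> `|s| <= 1 -> 0 < eps ->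
  C1 u -> compact K -> (forall x, ~ K x -> u x = 0) ->
  (forall x, K x -> znorm m x < R0) ->
  (forall r, 0 < r < R0 -> is_derive r (1 : R) phi (dphi r)) ->
  (forall r, 0 < r < R0 -> {for r, continuous dphi}) ->
  (forall r, 0 < r < R0 -> {for r, continuous W}) ->
  (forall r, 0 < r < R0 -> {for r, continuous V}) ->
  (forall r, 0 <= W r) -> (forall r, 0 <= V r) ->
  (forall x, znorm m x < eps -> u x = 0) \/
    (forall r, r < eps -> [/\ phi r = 0, dphi r = 0, W r = 0 & V r = 0]) ->
  (forall r, 0 < r < R0 -> kap * p * W r <= s * (m%:R * phi r + r * dphi r)) ->
  (forall r, 0 < r < R0 -> r * `|phi r| <= W r `^ ((p - 1) / p) * V r `^ p^-1) ->
  [/\ Cc (fun x => `|u x| `^ p * W (znorm m x)),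
      Cc (fun x => gradL deg op e u x `^ p * V (znorm m x)) &
      kap `^ p * J (fun x => `|u x| `^ p * W (znorm m x)) <=
      J (fun x => gradL deg op e u x `^ p * V (znorm m x))].
Proof.
move=> ml p1 kap0 s1 eps0 hu cptK u0 KR dphiP cdphi cW cV W0 V0 low c1 c2.
have p0 : 0 < p by lra.
have cK : closed K by apply: compact_closed cptK; exact: norm_hausdorff.
have [M [Mr hM]] := compact_bounded cptK.
(* All integrands vanish off this closed set, which lies where the weights are regular. *)
pose K' := K `&` [set x | eps <= znorm m x].
pose U := [set x : 'rV[R]_N | 0 < znorm m x < R0].
have cK' : closed K' by apply: closedI => //; exact: closed_znorm_ge.
have KU : K' `<=` U.
  by move=> x [Kx /= ex]; rewrite /U /= KR// andbT (lt_le_trans eps0).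
have K'M : exists M', forall f : 'rV[R]_N -> R, (forall x, ~ K' x -> f x = 0) ->
    forall x, M' < `|x| -> f x = 0.
  exists (M + 1) => f f0 x Mx; apply: f0 => -[Kx _].
  have MM : M < M + 1 by rewrite ltrDl.
  by have := hM _ MM _ Kx; rewrite /= leNgt Mx.
have [M' hM'] := K'M.
have mkCc f : (forall x, ~ K' x -> f x = 0) -> (forall x, U x -> {for x, continuous f}) -> Cc f.
  move=> f0 cf; split; first exact: (glue_continuous cK' KU f0 cf).
  by exists M'; exact: hM'.
have pw0 : `|0 : R| `^ p = 0 by rewrite normr0 powR0// gt_eqF.
have X0 x : znorm m x < eps -> (forall x, znorm m x < eps -> u x = 0) -> gradL deg op e u x = 0.
  move=> zx uz; apply: (gradL_off hu (K := [set x | eps <= znorm m x])) => //.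
  - exact: closed_znorm_ge.
  - by move=> y /negP; rewrite -ltNge => /uz.
  - by apply/negP; rewrite -ltNge.
have offP x : ~ K' x -> (u x = 0 /\ gradL deg op e u x = 0) \/
    [/\ phi (znorm m x) = 0, dphi (znorm m x) = 0, W (znorm m x) = 0 & V (znorm m x) = 0].
  have [Kx nK'|nKx _] := pselect (K x); last first.
    by left; split; [exact: u0|exact: (gradL_off hu cK u0 nKx)].
  have zx : znorm m x < eps by rewrite ltNge; apply/negP => h; apply: nK'.
  by case: low => h; [left; split; [exact: h|exact: X0]|right; exact: h].
have cz (f : R -> R) x : {for znorm m x, continuous f} -> {for x, continuous (fun y => f (znorm m y))}.
  by move=> cf; apply: (@continuous_comp _ _ _ (znorm m) f) => //; exact: znorm_continuous.
have CW : Cc (fun x => `|u x| `^ p * W (znorm m x)).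
  apply: mkCc => [x /offP [[-> _]|[_ _ -> _]]|x Ux]; rewrite ?pw0 ?mul0r ?mulr0//.
  apply: continuousM; last exact/cz/cW.
  apply: (@continuous_comp _ _ _ u (fun t => `|t| `^ p)); first exact: C1_continuous.
  by apply: powRn_continuous0; lra.
have CV : Cc (fun x => gradL deg op e u x `^ p * V (znorm m x)).
  apply: mkCc => [x /offP [[_ ->]|[_ _ _ ->]]|x Ux]; rewrite ?powR0 ?gt_eqF ?mul0r ?mulr0//.
  apply: continuousM; last exact/cz/cV.
  rewrite (_ : (fun _ => _) = (fun y => `|gradL deg op e u y| `^ p)); last first.
    by apply/funext => y; rewrite ger0_norm// gradL_ge0.
  apply: (@continuous_comp _ _ _ (gradL deg op e u) (fun t => `|t| `^ p)); first exact: gradL_continuous.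
  by apply: powRn_continuous0; lra.
split => //.
have cphi r : 0 < r < R0 -> {for r, continuous phi}.
  by move=> /dphiP h; apply/differentiable_continuous/derivable1_diffP; exact: (@ex_derive _ _ _ _ _ _ _ h).
have hf0 i x : ~ K' x -> hfield p u m phi i x = 0.
  by move=> /offP [[ux _]|[ph _ _ _]]; rewrite /hfield ?ux ?ph ?pw0 ?mul0r ?mulr0.
have dhf0 i j x : ~ K' x -> dhfield p u m phi dphi i j x = 0.
  move=> /offP [[ux _]|[ph dph _ _]]; rewrite /dhfield.
    by rewrite ux sgr0 pw0 !mul0r mulr0 !mul0r addr0.
  by rewrite ph dph !(mulr0, mul0r, addr0).
have dhf i j x : is_derive x (ebas R j) (hfield p u m phi i) (dhfield p u m phi dphi i j x).
  apply: (glue_derive cK' KU) => // [y|y|y Uy]; [exact: hf0|exact: dhf0|].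
  apply: is_derive_hfield => //; last exact: dphiP.
  by case/andP: Uy.
have Chf i : Cc (hfield p u m phi i).
  apply: mkCc => [x|x Ux]; first exact: hf0.
  apply: continuousM.
    apply: (@continuous_comp _ _ _ u (fun t => `|t| `^ p)); first exact: C1_continuous.
    by apply: powRn_continuous0; lra.
  by apply: continuousM; [exact: continuous_coord|exact/cz/cphi].
have Cdhf i j : Cc (dhfield p u m phi dphi i j).
  apply: mkCc => [x|x Ux]; first exact: dhf0.
  apply: dhfield_continuous => //; [by case/andP: Ux|exact: cphi|exact: cdphi].
pose D x := \sum_(i < N | (i < m)%N) \sum_j vfcoef op i j x * dhfield p u m phi dphi i j x.
have CDi i : Cc (fun x => \sum_j vfcoef op i j x * dhfield p u m phi dphi i j x).
  by apply: Cc_sum => j _; apply: Cc_mull => //; exact: (vfcoef_continuous hC).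
have CD : Cc D by apply: Cc_sum => i _; exact: CDi.
have JD0 : J D = 0.
  rewrite /D J_sum; last by move=> i _; exact: CDi.
  apply: big1 => i im; apply: (J_vfcoef hC (deg_layer1 hC ml im) (Chf i)) => // j x; exact: dhf.
(* The inequality holds pointwise up to a multiple of the divergence [D], whose integral is zero. *)
have key x : kap `^ p * (`|u x| `^ p * W (znorm m x)) - gradL deg op e u x `^ p * V (znorm m x) <=
    kap `^ (p - 1) * s * D x.
  have [K'x|/[dup] nK' /offP off] := pselect (K' x); last first.
    have -> : D x = 0.
      by rewrite /D big1// => i _; rewrite big1// => j _; rewrite dhf0// mulr0.
    rewrite mulr0 subr_le0; case: off => [[-> _]|[_ _ -> _]]; rewrite ?pw0 ?(mul0r, mulr0).
      by rewrite mulr_ge0// powR_ge0.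
    by rewrite mulr_ge0// powR_ge0.
  have Ux := KU _ K'x; have z0 : 0 < znorm m x by case/andP: Ux.
  rewrite /D (div_hfield _ _ _ hu ml z0).
  set z := znorm m x in Ux z0 *; set g := gradL _ _ _ _ _.
  set S := \sum_(i < N | _) _; set a := `|u x|.
  have S_le : `|S| <= z * g by exact: sum_x_Xf.
  have a0 : 0 <= a by exact: normr_ge0.
  have g0 : 0 <= g by exact: gradL_ge0.
  set A := W z `^ p^-1; set B := V z `^ p^-1.
  have A0 : 0 <= A by exact: powR_ge0.
  have B0 : 0 <= B by exact: powR_ge0.
  have AW : A `^ p = W z by rewrite -powRrM mulVf ?gt_eqF// powRr1.
  have BV : B `^ p = V z by rewrite -powRrM mulVf ?gt_eqF// powRr1.
  have AW1 : W z `^ ((p - 1) / p) = A `^ (p - 1) by rewrite -powRrM mulrC.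
  (* With [kap] absorbed in the first factor, the divergence gives [p * kap^p] and Young costs
     [(p - 1) * kap^p], leaving exactly [kap^p]. *)
  have Y := young_p p1 (mulr_ge0 (mulr_ge0 kap0 a0) A0) (mulr_ge0 g0 B0).
  rewrite !powRM ?mulr_ge0// AW BV in Y.
  have h1 : kap * p * W z <= s * (m%:R * phi z + z * dphi z) by exact: c1.
  have h2 : z * `|phi z| <= A `^ (p - 1) * B by rewrite -AW1; exact: c2.
  have kk : kap * kap `^ (p - 1) = kap `^ p by exact: mulr_powRB1.
  have k10 : 0 <= kap `^ (p - 1) by exact: powR_ge0.
  have ap0 : 0 <= a `^ p by exact: powR_ge0.
  have a10 : 0 <= a `^ (p - 1) by exact: powR_ge0.
  have t1 : kap `^ (p - 1) * a `^ p * (kap * p * W z) <= kap `^ (p - 1) * a `^ p * (s * (m%:R * phi z + z * dphi z)).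
    by rewrite ler_wpM2l// mulr_ge0.
  have t2 : `|kap `^ (p - 1) * s * (p * (Num.sg (u x) * a `^ (p - 1)) * phi z * S)| <=
      p * (kap `^ (p - 1) * a `^ (p - 1) * A `^ (p - 1)) * (g * B).
    rewrite !normrM (ger0_norm k10) (ger0_norm (ltW p0)) (ger0_norm a10).
    apply: (@le_trans _ _ (kap `^ (p - 1) * 1 * (p * (1 * a `^ (p - 1)) * `|phi z| * (z * g)))).
      have X1 : 0 <= kap `^ (p - 1) * `|s| by rewrite mulr_ge0.
      have X2 : 0 <= p * (`|Num.sg (u x)| * a `^ (p - 1)) * `|phi z|.
        by rewrite !mulr_ge0// ltW.
      have X3 : 0 <= p * (`|Num.sg (u x)| * a `^ (p - 1)) * `|phi z| * `|S| by rewrite mulr_ge0.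
      apply: ler_pM => //; first by rewrite ler_wpM2l.
      apply: ler_pM => //.
      rewrite ler_wpM2r// ler_wpM2l ?(ltW p0)// ler_wpM2r// normr_sg.
      by case: (u x != 0).
    have -> : kap `^ (p - 1) * 1 * (p * (1 * a `^ (p - 1)) * `|phi z| * (z * g)) =
      (kap `^ (p - 1) * p * a `^ (p - 1) * g) * (z * `|phi z|) by ring.
    have -> : p * (kap `^ (p - 1) * a `^ (p - 1) * A `^ (p - 1)) * (g * B) =
      (kap `^ (p - 1) * p * a `^ (p - 1) * g) * (A `^ (p - 1) * B) by ring.
    by rewrite ler_wpM2l// !mulr_ge0// ltW.
  have t3 := le_trans t2 Y.
  have t4 : kap `^ (p - 1) * a `^ p * (kap * p * W z) = p * (kap `^ p * a `^ p * W z).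
    by rewrite -kk; ring.
  rewrite t4 in t1.
  rewrite mulrDr; move: t3; rewrite ler_norml => /andP[t3 _].
  have -> : kap `^ (p - 1) * s * (a `^ p * (m%:R * phi z + z * dphi z)) =
    kap `^ (p - 1) * a `^ p * (s * (m%:R * phi z + z * dphi z)) by ring.
  have -> : kap `^ p * (a `^ p * W z) = kap `^ p * a `^ p * W z by ring.
  set Q := kap `^ p * a `^ p * W z in t1 t3 *.
  clear -t1 t3; lra.
rewrite -subr_le0 -JZ// -JB//; last exact: Cc_scale.
apply: (@le_trans _ _ (J (fun x => kap `^ (p - 1) * s * D x))).
  apply: J_le => //; last exact: Cc_scale.
  by apply: Cc_sub => //; exact: Cc_scale.
by rewrite JZ// JD0 mulr0.
Qed.

End Hardy.

(** * Removal of the cutoff, power weights and logarithmic weights *)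

Section HardyApplications.
Context {R : realType}.

(** The squared positive part is continuously differentiable; every cutoff and bump below is built
    from it. *)
Lemma is_derive_pos2 (t : R) :
  is_derive t (1 : R) (fun t => Num.max 0 t ^+ 2) (2 * Num.max 0 t).
Proof.
have [tp|tn|<-] := ltgtP 0 t.
- have H := is_deriveX 2 (is_derive_id t (1 : R)).
  apply: (@near_eq_is_derive _ _ _ (id ^+ 2 : R -> R)).
    by near=> y; rewrite !fctE/= max_r// ltW//; near: y; exact: lt_nbhsr.
  by apply: is_derive_eq H _; rewrite /= [_ *: _]mulr1.
- rewrite mulr0; have Z : is_derive t (1 : R) (cst 0 : R -> R) 0 by exact: is_derive_cst.
  apply: near_eq_is_derive Z.
  by near=> y; rewrite max_l ?expr0n//= ltW//; near: y; exact: lt_nbhsl.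
- rewrite mulr0.
  have H : (fun h : R => h^-1 *: (((fun t : R => Num.max 0 t ^+ 2) \o shift 0) (h *: (1 : R)) - Num.max 0 (0 : R) ^+ 2)) @ 0^' --> (0 : R).
    apply/cvgrPdist_le => e e0; near=> h.
    have h0 : h != 0 by near: h; exact: nbhs_dnbhs_neq.
    have he : `|h| <= e by near: h; exact: dnbhs0_le.
    rewrite /= sub0r normrN addr0 [h *: 1]mulr1 maxxx expr0n subr0.
    have [hp|hn] := leP 0 h; last by rewrite expr0n /= scaler0 normr0 ltW.
    by rewrite expr2 [_ *: _]mulKf.
  by split; [apply/cvg_ex; eexists; exact: H|exact: cvg_lim H].
Unshelve. all: by end_near. Qed.

Lemma max0_continuous : continuous (fun t : R => Num.max 0 t).
Proof. by move=> t; apply: continuous_max; [exact: cst_continuous|exact: cvg_id]. Qed.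

(** For [r > 0] this cutoff is nondecreasing in [r], so its derivative only increases the
    divergence, and it increases to 1 as [eps] decreases to 0, as monotone convergence demands. *)
Definition cut (eps r : R) : R := Num.max 0 (r - eps) ^+ 2 * r ^- 2.
Definition dcut (eps r : R) : R :=
  2 * Num.max 0 (r - eps) * (r - Num.max 0 (r - eps)) * r ^- 3.

Lemma cut_ge0 eps r : 0 <= cut eps r.
Proof. by rewrite mulr_ge0 ?sqr_ge0// invr_ge0 sqr_ge0. Qed.

Lemma cut_le1 eps r : 0 <= eps -> 0 < r -> cut eps r <= 1.
Proof.
move=> e0 r0; rewrite /cut ler_pdivrMr ?exprn_gt0// mul1r ler_sqr ?nnegrE ?le_max ?lexx ?(ltW r0)//.
by rewrite ge_max; lra.
Qed.

Lemma cut_low eps r : r < eps -> cut eps r = 0 /\ dcut eps r = 0.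
Proof.
move=> re; rewrite /cut /dcut max_l; last lra.
by rewrite expr0n /= mul0r mulr0 !mul0r.
Qed.

Lemma dcut_ge0 eps r : 0 < eps -> 0 < r -> 0 <= dcut eps r.
Proof.
move=> e0 r0; have h : Num.max 0 (r - eps) <= r by rewrite ge_max; lra.
rewrite /dcut mulr_ge0 ?invr_ge0 ?exprn_ge0 ?(ltW r0)// mulr_ge0 ?mulr_ge0 ?le_max ?lexx//.
by rewrite subr_ge0.
Qed.

Lemma cut_mono e1 e2 r : e1 <= e2 -> cut e2 r <= cut e1 r.
Proof.
move=> e12; rewrite /cut ler_wpM2r ?invr_ge0 ?sqr_ge0//.
have h0 t : 0 <= Num.max 0 t :> R by rewrite le_max lexx.
rewrite ler_sqr ?nnegrE ?h0// ge_max h0 /= le_max; apply/orP; right; lra.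
Qed.

Lemma cut_lower eps r : 0 < eps -> 0 < r -> 1 - 2 * eps / r <= cut eps r.
Proof.
move=> e0 r0; have [h|h] := leP r eps.
  apply: le_trans (cut_ge0 _ _); rewrite subr_le0 ler_pdivlMr// mul1r; lra.
rewrite /cut max_r; last lra.
have -> : (r - eps) ^+ 2 * r ^- 2 = 1 - 2 * eps / r + (eps / r) ^+ 2 by field; rewrite gt_eqF.
by rewrite lerDl sqr_ge0.
Qed.

Lemma is_derive_cut (eps r : R) : 0 < r -> is_derive r (1 : R) (cut eps) (dcut eps r).
Proof.
move=> r0; have rn : r != 0 by rewrite gt_eqF.
have ds : is_derive r (1 : R) (fun r => r - eps) 1.
  have := is_deriveB (is_derive_id r (1 : R)) (is_derive_cst eps r (1 : R)).
  by rewrite subr0.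
have d1 := is_derive_comp1 ds (is_derive_pos2 (r - eps)).
have d2 : is_derive r (1 : R) (fun r : R => r ^- 2) (- 2 * r ^- 3).
  apply: (@near_eq_is_derive _ _ _ (fun a => a `^ (-2))).
    near=> y; rewrite powRN -powR_mulrn// ltW//; near: y; exact: lt_nbhsr.
  apply: is_derive_eq (is_derive1_powR (-2) r0) _.
  by rewrite (_ : -2 - 1 = - 3%:R :> R) ?powR_invn ?(ltW r0)//; lra.
apply: is_derive_eq (is_deriveM d1 d2) _.
rewrite -[LHS]/(Num.max 0 (r - eps) ^+ 2 * (- 2 * r ^- 3) + r ^- 2 * (2 * Num.max 0 (r - eps) * 1)) /dcut.
by field.
Unshelve. all: by end_near. Qed.

Lemma dcut_continuous eps r : 0 < r -> {for r, continuous (dcut eps)}.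
Proof.
move=> r0.
have cm : {for r, continuous (fun r => Num.max 0 (r - eps))}.
  apply: (@continuous_comp _ _ _ (fun r => r - eps) (fun t => Num.max 0 t)); last exact: max0_continuous.
  by apply: continuousB; [exact: cvg_id|exact: cst_continuous].
apply: continuousM.
  apply: continuousM; last by apply: continuousB => //; exact: cvg_id.
  by apply: continuousM => //; exact: cst_continuous.
apply: continuousV; first by rewrite gt_eqF// exprn_gt0.
exact: exprn_continuous.
Qed.

Lemma cut_continuous eps r : 0 < r -> {for r, continuous (cut eps)}.
Proof.
move=> r0; apply/differentiable_continuous/derivable1_diffP.
exact: (@ex_derive _ _ _ _ _ _ _ (is_derive_cut eps r0)).
Qed.

Lemma znorm_gt0_ord0 n m (x : 'rV[R]_n.+1) : (0 < m)%N -> x 0 ord0 != 0 -> 0 < znorm m x.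
Proof.
move=> m0 x0; apply: (@lt_le_trans _ _ `|x 0 ord0|); first by rewrite normr_gt0.
exact: znorm_coord.
Qed.

Lemma iint_mct_z N m (f : 'rV[R]_N -> \bar R) (fk : nat -> 'rV[R]_N -> R) :
  (0 < m <= N)%N -> Cc_chain fk -> (forall x, 0 <= f x)%E ->
  (forall x, (0 < znorm m x)%R -> f x <= ereal_sup (range (fun k => (fk k x)%:E)))%E ->
  (iint f <= ereal_sup (range (fun k => (J (fk k))%:E)))%E.
Proof.
case: N f fk => [|n] f fk /andP[m0 mN]; first by rewrite leqNgt m0 in mN.
move=> hk f0 ffk; apply: iint_mct_ae => // x x0; apply: ffk.
exact: znorm_gt0_ord0.
Qed.

Lemma EFin_le_sup (y : R) (c : nat -> R) : 0 <= y ->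
  (forall d, 0 < d -> exists k, 1 - d <= c k) ->
  (y%:E <= ereal_sup (range (fun k => (y * c k)%:E)))%E.
Proof.
move=> y0 hc; apply/lee_addgt0Pr => d d0.
have y1 : 0 < y + 1 by lra.
have [k hk] := hc _ (divr_gt0 d0 y1).
apply: (@le_trans _ _ ((y * c k)%:E + d%:E)%E); last first.
  by rewrite leeD2r//; apply: ereal_sup_ubound; exists k.
rewrite -EFinD lee_fin -lerBlDr; apply: le_trans (ler_wpM2l y0 hk).
rewrite mulrBr mulr1 lerD2l lerN2 mulrCA -[leRHS]mulr1 ler_wpM2l ?(ltW d0)//.
by rewrite ler_pdivrMr// mul1r; lra.
Qed.

Definition epsk (k : nat) : R := k.+1%:R^-1.

Lemma epsk_gt0 k : 0 < epsk k. Proof. by rewrite invr_gt0. Qed.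

Lemma cut_limit r : 0 < r -> forall d, 0 < d -> exists k, 1 - d <= cut (epsk k) r.
Proof.
(* Chosen so that the error [2 * epsk k / r] of [cut_lower] is at most [d]. *)
move=> r0 d d0; exists (Num.truncn (2 / (r * d))).
apply: le_trans (cut_lower (epsk_gt0 _) r0); rewrite lerD2l lerN2 ler_pdivrMr//.
have h := truncnS_gt (2 / (r * d)); rewrite ltr_pdivrMr ?mulr_gt0// in h.
by rewrite /epsk ler_pdivrMr// mulrC [d * r]mulrC ltW.
Qed.

Lemma compact_fun_bound (V : topologicalType) (K : set V) (f : V -> R) :
  compact K -> continuous f -> exists B, 0 < B /\ forall x, K x -> f x < B.
Proof.
move=> cK cf.
have : compact (f @` K) by apply: continuous_compact => //; exact: continuous_subspaceT.
move=> /compact_bounded [M [Mr hM]]; exists (Num.max 0 M + 2); split.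
  by rewrite ltr_wpDl// le_max lexx.
move=> x Kx; have MM : M < Num.max 0 M + 1 by rewrite ltr_pwDr// le_max lexx orbT.
have /= := hM _ MM (f x) (ex_intro2 _ _ x Kx erefl).
move=> /(le_trans (ler_norm _)) /le_lt_trans; apply; lra.
Qed.

Lemma compact_fun_pos (V : topologicalType) (K : set V) (f : V -> R) :
  compact K -> continuous f -> (forall x, K x -> 0 < f x) ->
  exists B, 0 < B /\ forall x, K x -> B <= f x.
Proof.
move=> cK cf f0; have [K0|nK] := pselect (K !=set0); last first.
  exists 1; split => // x Kx; exfalso; apply: nK; by exists x.
have [c Kc hc] := compact_EVT_min K0 cK (continuous_subspaceT cf).
exists (f c); split; first by apply: f0; rewrite inE in Kc.
by move=> x Kx; apply: hc; rewrite inE.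
Qed.

(** The value [c = 0] is treated apart since [a] may be infinite; the product is then 0 by
    convention. *)
Lemma escale_le_sup (c : R) (a b : \bar R) (g : nat -> R) : 0 <= c -> (0 <= b)%E ->
  (a <= ereal_sup (range (fun k => (g k)%:E)))%E -> (forall k, (c * g k)%:E <= b)%E ->
  (c%:E * a <= b)%E.
Proof.
rewrite le_eqVlt => /predU1P[<- b0 _ _|c0 b0 ha hb]; first by rewrite mul0e.
rewrite -lee_pdivlMl//; apply: le_trans ha _; apply: ge_ereal_sup => _ [k _ <-].
by rewrite lee_pdivlMl// -EFinM.
Qed.

Lemma powRDp (x r s : R) : 0 < x -> x `^ (r + s) = x `^ r * x `^ s.
Proof. by move=> x0; rewrite powRD// (gt_eqF x0) implybT. Qed.

Lemma powR_mul1 (r q : R) : 0 < r -> r * r `^ q = r `^ (1 + q).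
Proof. by move=> r0; rewrite powRD ?powRr1 ?(ltW r0)// (gt_eqF r0) implybT. Qed.

Variables (N : nat) (deg : 'I_N -> nat).
Variables (op : 'rV[R]_N -> 'rV[R]_N -> 'rV[R]_N) (inv : 'rV[R]_N -> 'rV[R]_N) (e : 'rV[R]_N).
Hypothesis hC : is_hom_carnot deg op inv e.
Variable m : nat.
Hypothesis m0 : (0 < m)%N.
Hypothesis ml : (m <= lay1 deg)%N.

Lemma m_bounds : (0 < m <= N)%N.
Proof. by rewrite m0 /=; apply: leq_trans ml _; rewrite -[leqRHS]card_ord; exact: max_card. Qed.

(** [hardy_core] is applied to [phi], [W], [V] multiplied by the same cutoff. The derivative of the
    cutoff adds a nonnegative term to the divergence because [phi >= 0], and the Young condition
    survives since the exponents [(p-1)/p] and [1/p] add up to 1. The integrands [f] and [g] are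
    prescribed only off [z = 0], where singular weights have their true values. *)
Lemma hardy_limit (p kap R0 : R) (phi dphi W V : R -> R)
    (u : 'rV[R]_N -> R) (K : set 'rV[R]_N) (f g : 'rV[R]_N -> \bar R) :
  1 < p -> 0 <= kap -> C1 u -> compact K -> (forall x, ~ K x -> u x = 0) ->
  (forall x, K x -> znorm m x < R0) ->
  (forall r, 0 < r < R0 -> is_derive r (1 : R) phi (dphi r)) ->
  (forall r, 0 < r < R0 -> {for r, continuous dphi}) ->
  (forall r, 0 < r < R0 -> {for r, continuous W}) ->
  (forall r, 0 < r < R0 -> {for r, continuous V}) ->
  (forall r, 0 <= phi r) -> (forall r, 0 <= W r) -> (forall r, 0 <= V r) ->
  (forall r, 0 < r < R0 -> kap * p * W r = m%:R * phi r + r * dphi r) ->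
  (forall r, 0 < r < R0 -> r * phi r = W r `^ ((p - 1) / p) * V r `^ p^-1) ->
  (forall x, 0 <= f x)%E -> (forall x, 0 <= g x)%E ->
  (forall x, 0 < znorm m x -> f x = (`|u x| `^ p * W (znorm m x))%:E) ->
  (forall x, 0 < znorm m x -> g x = (gradL deg op e u x `^ p * V (znorm m x))%:E) ->
  ((kap `^ p)%:E * iint f <= iint g)%E.
Proof.
move=> p1 kap0 hu cK u0 KR dphiP cdphi cW cV phi0 W0 V0 c1 c2 f0 g0 hf hg.
have p0 : 0 < p by lra.
pose cu k r := cut (epsk k) r.
have core k := @hardy_core R N deg op inv e hC p kap 1 (epsk k) R0 m
  (fun r => cu k r * phi r) (fun r => dcut (epsk k) r * phi r + cu k r * dphi r)
  (fun r => cu k r * W r) (fun r => cu k r * V r) u K ml p1 kap0.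
have {}core k : [/\ Cc (fun x => `|u x| `^ p * (cu k (znorm m x) * W (znorm m x))),
      Cc (fun x => gradL deg op e u x `^ p * (cu k (znorm m x) * V (znorm m x))) &
      kap `^ p * J (fun x => `|u x| `^ p * (cu k (znorm m x) * W (znorm m x))) <=
      J (fun x => gradL deg op e u x `^ p * (cu k (znorm m x) * V (znorm m x)))].
  have cphi r : 0 < r < R0 -> {for r, continuous phi}.
    by move=> /dphiP h; apply/differentiable_continuous/derivable1_diffP; exact: (@ex_derive _ _ _ _ _ _ _ h).
  apply: core => //.
  - by rewrite normr1.
  - exact: epsk_gt0.
  - move=> r rr; have r0 : 0 < r by case/andP: rr.
    have := is_deriveM (is_derive_cut (epsk k) r0) (dphiP r rr).
    move=> H; apply: is_derive_eq H _.
    by rewrite -[LHS]/(cu k r * dphi r + phi r * dcut (epsk k) r); ring.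
  - move=> r rr; have r0 : 0 < r by case/andP: rr.
    apply: continuousD; apply: continuousM; [exact: dcut_continuous|exact: cphi|exact: cut_continuous|exact: cdphi].
  - by move=> r rr; have r0 : 0 < r by [case/andP: rr]; apply: continuousM; [exact: cut_continuous|exact: cW].
  - by move=> r rr; have r0 : 0 < r by [case/andP: rr]; apply: continuousM; [exact: cut_continuous|exact: cV].
  - by move=> r; rewrite mulr_ge0 ?cut_ge0.
  - by move=> r; rewrite mulr_ge0 ?cut_ge0.
  - right => r re; rewrite /cu; have [-> ->] := cut_low re.
    by rewrite !mul0r addr0.
  - move=> r rr; have r0 : 0 < r by case/andP: rr.
    rewrite mul1r; have h := c1 r rr.
    have -> : kap * p * (cu k r * W r) = cu k r * (kap * p * W r) by ring.
    rewrite h; have -> : m%:R * (cu k r * phi r) + r * (dcut (epsk k) r * phi r + cu k r * dphi r) =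
      cu k r * (m%:R * phi r + r * dphi r) + r * (dcut (epsk k) r * phi r) by ring.
    rewrite lerDl; apply: mulr_ge0; first exact: ltW.
    by apply: mulr_ge0 => //; apply: dcut_ge0 => //; exact: epsk_gt0.
  - move=> r rr; have r0 : 0 < r by case/andP: rr.
    have cu0 : 0 <= cu k r by exact: cut_ge0.
    rewrite normrM (ger0_norm cu0) (ger0_norm (phi0 r)) mulrCA c2//.
    move: (cu k r) cu0 => c cu0.
    rewrite (powRM _ cu0 (W0 r)) (powRM _ cu0 (V0 r)) mulrACA; apply: ler_wpM2r; first by rewrite mulr_ge0 ?powR_ge0.
    have [->|cn] := eqVneq c 0; first by rewrite mulr_ge0 ?powR_ge0.
    rewrite -powRD; last by rewrite cn implybT.
    by rewrite (_ : _ + _ = 1) ?powRr1//; field; rewrite gt_eqF.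
pose fk k x := `|u x| `^ p * W (znorm m x) * cu k (znorm m x).
have fkE k : fk k = (fun x => `|u x| `^ p * (cu k (znorm m x) * W (znorm m x))).
  by apply/funext => x; rewrite /fk; ring.
have chain : Cc_chain fk.
  split; first by move=> k; rewrite fkE; have [] := core k.
    by move=> k x; rewrite /fk mulr_ge0 ?cut_ge0// mulr_ge0 ?powR_ge0.
  move=> x k l kl; rewrite /fk ler_wpM2l ?mulr_ge0 ?powR_ge0//.
  by apply: cut_mono; rewrite /epsk lef_pV2 ?posrE// ler_nat.
apply: (@escale_le_sup _ _ _ (fun k => J (fk k))).
- exact: powR_ge0.
- exact: iint_ge0.
- apply: (iint_mct_z m_bounds chain f0) => x z0; rewrite hf//.
  apply: EFin_le_sup; first by rewrite mulr_ge0 ?powR_ge0.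
  exact: cut_limit.
move=> k; have [h1 h2 h3] := core k.
rewrite fkE; apply: (@le_trans _ _ (J (fun x => gradL deg op e u x `^ p * (cu k (znorm m x) * V (znorm m x))))%:E).
  by rewrite lee_fin.
rewrite -iint_J//; apply: le_iint => x.
  by rewrite lee_fin; apply: mulr_ge0; [exact: powR_ge0|apply: mulr_ge0; [exact: cut_ge0|exact: V0]].
have := znorm_ge0 m x; rewrite le_eqVlt => /predU1P[z0|z0]; last first.
  rewrite hg// lee_fin ler_wpM2l ?powR_ge0// ler_piMl// cut_le1// ltW// epsk_gt0//.
by rewrite -z0 /cu (cut_low (epsk_gt0 k)).1 mul0r mulr0.
Qed.

Lemma intOm_le (Om : set 'rV[R]_N) (f g : 'rV[R]_N -> R) :
  (forall x, 0 <= f x) -> (forall x, Om x -> f x <= g x) ->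
  (intOm Om f <= intOm Om g)%E.
Proof.
move=> f0 fg; apply: le_iint => x; first by rewrite lee_fin mulr_ge0.
rewrite lee_fin indicE; case: (boolP (x \in Om)) => [|_]; last by rewrite !mul0r.
by rewrite inE => /fg h; rewrite !mul1r.
Qed.

Lemma intOm_ge0 (Om : set 'rV[R]_N) (f : 'rV[R]_N -> R) :
  (forall x, 0 <= f x) -> (0 <= intOm Om f)%E.
Proof. by move=> f0; apply: iint_ge0 => x; rewrite lee_fin mulr_ge0. Qed.

Lemma indic_drop (Om K : set 'rV[R]_N) (f : 'rV[R]_N -> R) x : K `<=` Om ->
  (forall x, ~ K x -> f x = 0) -> \1_Om x * f x = f x.
Proof.
move=> KO f0; rewrite indicE; case: (boolP (x \in Om)) => [_|]; first by rewrite mul1r.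
by rewrite notin_setE => nO; rewrite f0 ?mulr0// => /KO.
Qed.

Lemma hardy_power (p beta : R) (Om : set 'rV[R]_N) (u : 'rV[R]_N -> R) :
  1 < p -> (m%:R + beta < 0 -> forall x, Om x -> znorm m x != 0) -> C1_0 Om u ->
  eLe (eScale ((`|m%:R + beta| / p) `^ p)
     (intOm Om (fun x => `|u x| `^ p * znorm m x `^ beta)))
  (intOm Om (fun x => gradL deg op e u x `^ p * znorm m x `^ (p + beta))).
Proof.
rewrite /eLe /eScale => p1 Omz [hu [K [cptK [KO u0]]]].
have p0 : 0 < p by lra.
have cK : closed K by apply: compact_closed cptK; exact: norm_hausdorff.
have pw0 : `|0 : R| `^ p = 0 by rewrite normr0 powR0// gt_eqF.
have hf x : \1_Om x * (`|u x| `^ p * znorm m x `^ beta) = `|u x| `^ p * znorm m x `^ beta.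
  by apply: (indic_drop (f := fun x => `|u x| `^ p * znorm m x `^ beta) x KO) => y /u0 ->; rewrite pw0 mul0r.
have hg x : \1_Om x * (gradL deg op e u x `^ p * znorm m x `^ (p + beta)) =
    gradL deg op e u x `^ p * znorm m x `^ (p + beta).
  apply: (indic_drop (f := fun x => gradL deg op e u x `^ p * znorm m x `^ (p + beta)) x KO) => y nKy.
  by rewrite (gradL_off hC hu cK u0 nKy) powR0 ?gt_eqF// mul0r.
have f0 x : (0 <= (\1_Om x * (`|u x| `^ p * znorm m x `^ beta))%:E)%E.
  by rewrite hf lee_fin mulr_ge0 ?powR_ge0.
have g0 x : (0 <= (\1_Om x * (gradL deg op e u x `^ p * znorm m x `^ (p + beta)))%:E)%E.
  by rewrite hg lee_fin mulr_ge0 ?powR_ge0.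
have [R0 [R00 KR]] := compact_fun_bound cptK (@znorm_continuous R N m).
have dpow r : 0 < r < R0 -> is_derive r (1 : R) (fun r => r `^ beta) (beta * r `^ (beta - 1)).
  by move=> /andP[r0 _]; exact: is_derive1_powR.
have cpow q r : 0 < r < R0 -> {for r, continuous (fun r => r `^ q)}.
  by move=> /andP[r0 _]; exact: powR_continuous_pos.
have cdpow r : 0 < r < R0 -> {for r, continuous (fun r => beta * r `^ (beta - 1))}.
  by move=> rr; apply: continuousM; [exact: cst_continuous|exact: cpow].
have rpow r : 0 < r -> r * (beta * r `^ (beta - 1)) = beta * r `^ beta.
  move=> r0; rewrite mulrCA; congr (_ * _).
  by rewrite powR_mul1//; congr (_ `^ _); ring.
have wv r : 0 < r -> r * r `^ beta = (r `^ beta) `^ ((p - 1) / p) * (r `^ (p + beta)) `^ p^-1.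
  move=> r0; rewrite powR_mul1// -!powRrM -(powRDp _ _ r0).
  by congr (_ `^ _); field; rewrite gt_eqF.
have [mb|mb|mb] := ltgtP (m%:R + beta) 0.
- have zK x : K x -> 0 < znorm m x.
    by move=> /KO /(Omz mb) zx; rewrite lt_neqAle eq_sym zx znorm_ge0.
  have [eps [eps0 heps]] := compact_fun_pos cptK (@znorm_continuous R N m) zK.
  rewrite ltr0_norm//.
  have k0 : 0 <= - (m%:R + beta) / p by rewrite divr_ge0 ?(ltW p0)// oppr_ge0 ltW.
  have := @hardy_core R N deg op inv e hC p (- (m%:R + beta) / p) (-1) eps R0 m
    (fun r => r `^ beta) (fun r => beta * r `^ (beta - 1)) (fun r => r `^ beta) (fun r => r `^ (p + beta)) u K ml p1 k0.
  case => //.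
  + by rewrite normrN normr1.
  + exact: cpow.
  + exact: cpow.
  + by move=> r; exact: powR_ge0.
  + by move=> r; exact: powR_ge0.
  + by left => x zx; apply: u0 => /heps; rewrite leNgt zx.
  + move=> r /andP[r0 _]; rewrite rpow// divfK ?gt_eqF// le_eqVlt; apply/orP; left; apply/eqP; ring.
  + by move=> r /andP[r0 _]; rewrite ger0_norm ?powR_ge0// wv.
  move=> C1 C2 H; rewrite /intOm.
  under eq_fun do rewrite hf; under [X in (_ <= iint X)%E]eq_fun do rewrite hg.
  by rewrite !iint_J// lee_fin.
- rewrite gtr0_norm//.
  apply: (@hardy_limit p ((m%:R + beta) / p) R0 (fun r => r `^ beta) (fun r => beta * r `^ (beta - 1))
     (fun r => r `^ beta) (fun r => r `^ (p + beta)) u K) => //.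
  + by rewrite divr_ge0 ?(ltW p0)// ltW.
  + exact: cpow.
  + exact: cpow.
  + by move=> r; exact: powR_ge0.
  + by move=> r; exact: powR_ge0.
  + by move=> r; exact: powR_ge0.
  + by move=> r /andP[r0 _]; rewrite rpow// divfK ?gt_eqF//; ring.
  + by move=> r /andP[r0 _]; exact: wv.
  + by move=> x _; rewrite hf.
  + by move=> x _; rewrite hg.
- rewrite mb normr0 mul0r powR0 ?gt_eqF// mul0e.
  by apply: iint_ge0 => x; exact: g0.
Qed.

(** The term [i = 1] of the sum defining [NS] is the first-layer norm to the power inverted by the
    outer exponent; the other terms are nonnegative. *)
Lemma znorm_le_NS (x : 'rV[R]_N) : znorm m x <= NS deg x.
Proof.
have zl : znorm m x <= layer_norm deg 1 x.
  rewrite /znorm /layer_norm ler_wsqrtr// [leRHS](bigID (fun k : 'I_N => (k < m)%N)) /=.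
  rewrite (eq_bigl (fun i : 'I_N => (deg i == 1%N) && (i < m)%N)).
    by rewrite lerDl sumr_ge0// => *; exact: sqr_ge0.
  by move=> i; case: ltnP => im; rewrite ?andbF// (deg_layer1 hC ml im).
apply: le_trans zl _; rewrite /NS.
set q := (2 * (step deg)`!)%:R : R.
have q0 : 0 < q by rewrite ltr0n muln_gt0 fact_gt0.
have st : (0 < step deg)%N.
  case/andP: m_bounds => _ mN; pose k := Ordinal (leq_trans m0 mN).
  have : (deg k <= step deg)%N by exact: leq_bigmax.
  by apply: leq_trans; exact: carnot_deg_gt0 hC k.
have l0 : 0 <= layer_norm deg 1 x by exact: sqrtr_ge0.
have E : layer_norm deg 1 x = (layer_norm deg 1 x `^ q) `^ q^-1.
  by rewrite -powRrM mulfV ?gt_eqF// powRr1.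
rewrite [leLHS]E div1r.
apply: ge0_ler_powR; rewrite ?nnegrE ?powR_ge0 ?invr_ge0 ?(ltW q0)//.
  by apply: sumr_ge0 => *; exact: powR_ge0.
rewrite big_ltn// divr1 lerDl; apply: sumr_ge0 => *; exact: powR_ge0.
Qed.

Lemma hardy_unweighted (p : R) (Om : set 'rV[R]_N) (u : 'rV[R]_N -> R) :
  1 < p -> (m%:R - p < 0 -> forall x, Om x -> znorm m x != 0) -> C1_0 Om u ->
  eLe (eScale ((`|m%:R - p| / p) `^ p)
     (intOm Om (fun x => `|u x| `^ p / znorm m x `^ p)))
  (intOm Om (fun x => gradL deg op e u x `^ p)).
Proof.
move=> p1 hz hu; have := @hardy_power p (- p) Om u p1 hz hu.
rewrite (_ : (fun x => _ * _ `^ (- p)) = (fun x => `|u x| `^ p / znorm m x `^ p)); last first.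
  by apply/funext => x; rewrite powRN.
rewrite (_ : (fun x => _ * _ `^ (p - p)) = (fun x => gradL deg op e u x `^ p))//.
by apply/funext => x; rewrite subrr powRr0 mulr1.
Qed.

Lemma hardy_log (p R0 beta : R) (u : 'rV[R]_N -> R) :
  p = m%:R -> 1 < p -> 0 < R0 -> beta < -1 -> C1_0 [set x | znorm m x < R0] u ->
  eLe (eScale ((`|beta + 1| / p) `^ p)
     (intOm [set x | znorm m x < R0]
        (fun x => `|u x| `^ p / znorm m x `^ p * ln (R0 / znorm m x) `^ beta)))
  (intOm [set x | znorm m x < R0]
        (fun x => gradL deg op e u x `^ p * ln (R0 / znorm m x) `^ (p + beta))).
Proof.
rewrite /eLe /eScale => pm p1 R00 b1 [hu [K [cptK [KO u0]]]].
have p0 : 0 < p by lra.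
have cK : closed K by apply: compact_closed cptK; exact: norm_hausdorff.
have pw0 : `|0 : R| `^ p = 0 by rewrite normr0 powR0// gt_eqF.
set Om := [set x | _].
pose T r := ln (R0 / r).
have Tpos r : 0 < r < R0 -> 0 < T r.
  by move=> /andP[r0 rR]; rewrite /T ln_gt0// ltr_pdivlMr// mul1r.
have dT r : 0 < r < R0 -> is_derive r (1 : R) T (- r^-1).
  move=> /andP[r0 rR].
  have H := is_deriveB (is_derive_cst (ln R0) r (1 : R)) (is_derive1_ln r0).
  rewrite sub0r in H; apply: near_eq_is_derive H.
  by near=> y; rewrite !fctE /T ln_div ?posrE//; near: y; exact: lt_nbhsr.
have cT r : 0 < r < R0 -> {for r, continuous T}.
  by move=> /dT h; apply/differentiable_continuous/derivable1_diffP; exact: (@ex_derive _ _ _ _ _ _ _ h).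
have cTp q r : 0 < r < R0 -> {for r, continuous (fun r => T r `^ q)}.
  move=> rr; apply: (@continuous_comp _ _ _ T (fun t => t `^ q)); first exact: cT.
  by apply: powR_continuous_pos; exact: Tpos.
have dTp q r : 0 < r < R0 -> is_derive r (1 : R) (fun r => T r `^ q) (q * T r `^ (q - 1) * - r^-1).
  by move=> rr; exact: is_derive1_comp (is_derive1_powR q (Tpos r rr)) (dT r rr).
have cpow q r : 0 < r < R0 -> {for r, continuous (fun r => r `^ q)}.
  by move=> /andP[r0 _]; exact: powR_continuous_pos.
have bE : `|beta + 1| = - (beta + 1) by rewrite ltr0_norm//; lra.
rewrite bE.
(* Because [p = m], differentiating [r^(-p)] cancels [m * phi]; only the derivative of the logarithm
   remains, with the positive factor [- (beta + 1)]. *)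
pose phi r := r `^ (- p) * T r `^ (beta + 1).
pose dphi r := - p * r `^ (- p - 1) * T r `^ (beta + 1) +
  r `^ (- p - 1) * ((- (beta + 1)) * T r `^ beta).
have rm r : 0 < r -> r `^ (- p - 1) = r `^ (- p) / r.
  by move=> r0; rewrite (powRDp _ _ r0) powR_inv1// ltW.
apply: (@hardy_limit p (- (beta + 1) / p) R0 phi dphi
     (fun r => (r `^ p)^-1 * T r `^ beta) (fun r => T r `^ (p + beta)) u K) => //.
- by rewrite divr_ge0 ?(ltW p0)//; lra.
- move=> r rr; have r0 : 0 < r by case/andP: rr.
  have := is_deriveM (is_derive1_powR (- p) r0) (dTp (beta + 1) r rr).
  move=> H; apply: is_derive_eq H _.
  rewrite -[LHS]/(r `^ (- p) * ((beta + 1) * T r `^ (beta + 1 - 1) * - r^-1) +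
     T r `^ (beta + 1) * (- p * r `^ (- p - 1))) addrK /dphi rm//.
  by field; rewrite gt_eqF.
- move=> r rr; apply: continuousD; apply: continuousM.
  + by apply: continuousM; [exact: cst_continuous|exact: cpow].
  + exact: cTp.
  + exact: cpow.
  + by apply: continuousM; [exact: cst_continuous|exact: cTp].
- move=> r rr; apply: continuousM; last exact: cTp.
  by rewrite (_ : (fun _ => _) = (fun r => r `^ (- p))); [exact: cpow|apply/funext => y; rewrite powRN].
- by move=> r rr; exact: cTp.
- by move=> r; rewrite mulr_ge0 ?powR_ge0.
- by move=> r; rewrite mulr_ge0 ?invr_ge0 ?powR_ge0.
- by move=> r; exact: powR_ge0.
- move=> r rr; have r0 : 0 < r by case/andP: rr.
  rewrite divfK ?gt_eqF// /phi /dphi rm// -pm -powRN.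
  by field; rewrite gt_eqF.
- move=> r rr; have r0 : 0 < r by case/andP: rr.
  have t0 := Tpos r rr.
  rewrite -powRN powRM ?powR_ge0// /phi -!powRrM -mulrA -(powRDp _ _ t0).
  rewrite [r * (_ * _)]mulrA (powR_mul1 _ r0).
  by congr (_ `^ _ * _ `^ _); field; rewrite gt_eqF.
- move=> x; rewrite lee_fin mulr_ge0// mulr_ge0 ?powR_ge0// mulr_ge0 ?invr_ge0 ?powR_ge0//.
- by move=> x; rewrite lee_fin mulr_ge0// mulr_ge0 ?powR_ge0.
- move=> x _; congr (_%:E); rewrite -mulrA.
  apply: (indic_drop (f := fun x => `|u x| `^ p * ((znorm m x `^ p)^-1 * ln (R0 / znorm m x) `^ beta)) x KO) => y /u0 ->.
  by rewrite pw0 mul0r.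
- move=> x _; congr (_%:E).
  apply: (indic_drop (f := fun x => gradL deg op e u x `^ p * ln (R0 / znorm m x) `^ (p + beta)) x KO) => y nKy.
  by rewrite (gradL_off hC hu cK u0 nKy) powR0 ?gt_eqF// mul0r.
Unshelve. all: by end_near. Qed.

Lemma hardy_log_unweighted (p R0 : R) (u : 'rV[R]_N -> R) :
  p = m%:R -> 1 < p -> 0 < R0 -> C1_0 [set x | znorm m x < R0] u ->
  eLe (eScale (((p - 1) / p) `^ p)
     (intOm [set x | znorm m x < R0]
        (fun x => `|u x| `^ p / (znorm m x * ln (R0 / znorm m x)) `^ p)))
  (intOm [set x | znorm m x < R0] (fun x => gradL deg op e u x `^ p)).
Proof.
move=> pm p1 R00 hu; have b1 : - p < -1 by lra.
have := hardy_log pm p1 R00 b1 hu.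
have -> : `|- p + 1| = p - 1 by rewrite ltr0_norm; lra.
rewrite (_ : (fun x => _ * _ `^ (p - p)) = (fun x => gradL deg op e u x `^ p)); last first.
  by apply/funext => x; rewrite subrr powRr0 mulr1.
rewrite /eLe /eScale; apply: le_trans; apply: lee_wpmul2l; first by rewrite lee_fin powR_ge0.
apply: intOm_le => [x|x /= zR]; first by rewrite mulr_ge0 ?invr_ge0 ?powR_ge0.
have z0 := znorm_ge0 m x.
have l0 : 0 <= ln (R0 / znorm m x).
  (* At [z = 0] the conventions [0^-1 = 0] and [ln 0 = 0] give the value 0. *)
  move: z0; rewrite le_eqVlt => /predU1P[<-|z0]; first by rewrite invr0 mulr0 ln0.
  by rewrite ln_ge0// ler_pdivlMr// mul1r ltW.
by rewrite powRM// invfM powRN mulrA.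
Qed.

(* Weights need only be compared where [z <> 0], the hyperplane [x_0 = 0]
   being negligible for the outermost integral. *)
Lemma hardy_dominated (p c : R) (Om : set 'rV[R]_N) (u w : 'rV[R]_N -> R) :
  1 < p -> 0 < c -> (m%:R - p < 0 -> forall x, Om x -> znorm m x != 0) ->
  C1_0 Om u -> (forall x, 0 <= w x) ->
  (forall x, 0 < znorm m x -> w x <= c * (znorm m x `^ p)^-1) ->
  eLe (eScale (c^-1 * (`|m%:R - p| / p) `^ p) (intOm Om (fun x => `|u x| `^ p * w x)))
    (eScale ((`|m%:R - p| / p) `^ p)
                 (intOm Om (fun x => `|u x| `^ p / znorm m x `^ p))).
Proof.
rewrite /eLe /eScale => p1 c0 hz [hu [K [cptK [KO u0]]]] w0 wz.
set kp := (_ `^ _).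
have kp0 : 0 <= kp by exact: powR_ge0.
have p0 : 0 < p by lra.
have pw0 : `|0 : R| `^ p = 0 by rewrite normr0 powR0// gt_eqF.
pose f x := `|u x| `^ p / znorm m x `^ p.
have f0 x : 0 <= f x by rewrite mulr_ge0 ?invr_ge0 ?powR_ge0.
have fE x : \1_Om x * f x = f x.
  by apply: (indic_drop (f := f) x KO) => y /u0 uy; rewrite /f uy pw0 mul0r.
pose fk k x := f x * cut (epsk k) (znorm m x).
have Cfk k : Cc (fk k).
  have cK : closed K by apply: compact_closed cptK; exact: norm_hausdorff.
  pose K' := K `&` [set x | epsk k <= znorm m x].
  have cK' : closed K' by apply: closedI => //; exact: closed_znorm_ge.
  have fk0 x : ~ K' x -> fk k x = 0.
    move=> nK'; have [Kx|/u0 ux] := pselect (K x); last by rewrite /fk /f ux pw0 !mul0r.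
    have zx : znorm m x < epsk k by rewrite ltNge; apply/negP => h; apply: nK'.
    by rewrite /fk (cut_low zx).1 mulr0.
  split.
    apply: (glue_continuous cK' (U := [set x | 0 < znorm m x]) _ fk0).
      by move=> x [_ /=]; apply: lt_le_trans; exact: epsk_gt0.
    move=> x /= z0; apply: continuousM; last first.
      apply: (@continuous_comp _ _ _ (znorm m) (cut (epsk k))); first exact: znorm_continuous.
      exact: cut_continuous.
    apply: continuousM.
      apply: (@continuous_comp _ _ _ u (fun t => `|t| `^ p)); first exact: C1_continuous.
      exact: powRn_continuous0.
    apply: continuousV; first by rewrite gt_eqF// powR_gt0.
    apply: (@continuous_comp _ _ _ (znorm m) (fun t => t `^ p)); first exact: znorm_continuous.
    exact: powR_continuous_pos.
  have [M [Mr hM]] := compact_bounded cptK.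
  exists (M + 1) => x Mx; apply: fk0 => -[Kx _].
  have MM : M < M + 1 by rewrite ltrDl.
  by have := hM _ MM _ Kx; rewrite /= leNgt Mx.
have chain : Cc_chain (fun k x => c * fk k x).
  split; first by move=> k; exact: Cc_scale.
    by move=> k x; rewrite mulr_ge0 ?(ltW c0)// mulr_ge0 ?cut_ge0.
  move=> x k l kl; rewrite ler_wpM2l ?(ltW c0)// ler_wpM2l//.
  by apply: cut_mono; rewrite /epsk lef_pV2 ?posrE// ler_nat.
apply: (@escale_le_sup _ _ _ (fun k => J (fun x => c * fk k x))).
- by rewrite mulr_ge0 ?invr_ge0 ?(ltW c0).
- by rewrite mule_ge0 ?lee_fin//; apply: intOm_ge0.
- apply: (iint_mct_z m_bounds chain) => [x|x z0].
    by rewrite lee_fin mulr_ge0// mulr_ge0 ?powR_ge0.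
  apply: (@le_trans _ _ (c * f x)%:E).
    rewrite lee_fin (indic_drop (f := fun x => `|u x| `^ p * w x) x KO); last first.
      by move=> y /u0 ->; rewrite pw0 mul0r.
    by rewrite /f mulrCA ler_wpM2l ?powR_ge0// wz.
  rewrite (_ : (fun k => _) = (fun k => (c * f x * cut (epsk k) (znorm m x))%:E)); last first.
    by apply/funext => k; rewrite mulrA.
  apply: EFin_le_sup; first by rewrite mulr_ge0 ?(ltW c0).
  exact: cut_limit.
move=> k; rewrite JZ// (_ : c^-1 * kp * _ = kp * J (fk k)); last by field; rewrite gt_eqF.
rewrite EFinM; apply: lee_wpmul2l; first by rewrite lee_fin.
rewrite -iint_J//; apply: le_iint => x.
  by rewrite lee_fin mulr_ge0 ?cut_ge0.
rewrite fE lee_fin.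
have := znorm_ge0 m x; rewrite le_eqVlt => /predU1P[z0|z0].
  by rewrite /fk -z0 (cut_low (epsk_gt0 k)).1 mulr0.
by rewrite ler_piMr// cut_le1// ltW// epsk_gt0.
Qed.

End HardyApplications.

(** * Comparison with homogeneous norms *)

Section HomogeneousNorm.
Context {R : realType}.
Variables (N : nat) (deg : 'I_N -> nat).
Variables (op : 'rV[R]_N -> 'rV[R]_N -> 'rV[R]_N) (inv : 'rV[R]_N -> 'rV[R]_N) (e : 'rV[R]_N).
Hypothesis hC : is_hom_carnot deg op inv e.
Variable m : nat.
Hypothesis ml : (m <= lay1 deg)%N.

Lemma znorm_dil lam (x : 'rV[R]_N) : 0 < lam -> znorm m (dil deg lam x) = lam * znorm m x.
Proof.
move=> l0; rewrite /znorm.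
rewrite (eq_bigr (fun k : 'I_N => lam ^+ 2 * x 0 k ^+ 2)); last first.
  by move=> k km; rewrite mxE (deg_layer1 hC ml km) expr1 exprMn.
by rewrite -mulr_sumr sqrtrM ?sqr_ge0// sqrtr_sqr gtr0_norm.
Qed.

(** On the compact Euclidean unit sphere [Nf] has a positive lower bound [c]. The intermediate value
    theorem dilates [x] onto the sphere by some [lam]; there [lam * |z| <= 1] and [c <= lam * Nf x],
    which combine to the claim with [C = 1 / c]. *)
Lemma hom_norm_bound (Nf : 'rV[R]_N -> R) : hom_norm deg inv Nf ->
  exists C, 0 < C /\ forall x, 0 < znorm m x -> znorm m x <= C * Nf x.
Proof.
move=> [cN [N0 [_ [Nz Nd]]]].
pose S := [set x : 'rV[R]_N | sumsq xpredT x = 1].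
have cS : compact S.
  apply: bounded_closed_compact.
    exists 1; split => [|M M1 x /= Sx]; first exact: num_real.
    apply: le_trans (ltW M1); apply: rV_norm_le => // i.
    have := @sumsq_coord _ _ xpredT x i isT; rewrite Sx => h.
    by rewrite -(@ler_pXn2r _ 2) ?nnegrE// expr1n real_normK// num_real.
  rewrite (_ : S = sumsq xpredT @^-1` [set 1])//.
  by apply: closed_comp; [move=> x _; exact: sumsq_continuous|exact: closed_eq].
have posS x : S x -> 0 < Nf x.
  move=> Sx; rewrite lt_neqAle N0 andbT eq_sym; apply/eqP => /Nz x0.
  move: Sx; rewrite /S /= x0 /sumsq big1; last by move=> i _; rewrite mxE expr0n.
  by move/esym/eqP; rewrite oner_eq0.
have [c [c0 hc]] := compact_fun_pos cS cN posS.
exists c^-1; split; first by rewrite invr_gt0.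
move=> x z0.
pose f lam := sumsq xpredT (dil deg lam x).
have cf : continuous f.
  move=> t; apply: (@continuous_sum R R) => i _.
  rewrite (_ : (fun lam : R => _) = (fun lam : R => (lam ^+ deg i * x 0 i) * (lam ^+ deg i * x 0 i))).
    by apply: continuousM; apply: continuousM; [exact: exprn_continuous|exact: cst_continuous|exact: exprn_continuous|exact: cst_continuous].
  by apply/funext => lam; rewrite mxE expr2.
have f0 : f 0 = 0.
  rewrite /f /sumsq big1// => i _.
  by rewrite mxE expr0n (negbTE (lt0n_neq0 (carnot_deg_gt0 hC i))) mul0r expr0n.
have zf lam : 0 < lam -> (lam * znorm m x) ^+ 2 <= f lam.
  move=> l0; rewrite -znorm_dil// znorm_sqr /f /sumsq [leRHS](bigID (fun k : 'I_N => (k < m)%N)) /=.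
  by rewrite lerDl sumr_ge0// => *; exact: sqr_ge0.
have f1 : 1 <= f (znorm m x)^-1.
  by apply: le_trans (zf _ _); rewrite ?invr_gt0// mulVf ?expr1n// gt_eqF.
have b0 : 0 <= (znorm m x)^-1 by rewrite invr_ge0 ltW.
have [] := @IVT R f 0 (znorm m x)^-1 1 b0 (continuous_subspaceT cf).
  by rewrite f0 (min_l (le_trans ler01 f1)) (max_r (le_trans ler01 f1)) ler01.
move=> lam; rewrite in_itv /= => /andP[l0 _] fl.
have {}l0 : 0 < lam.
  rewrite lt_neqAle l0 andbT; apply/eqP => l; move: fl; rewrite -l f0 => /eqP.
  by rewrite eq_sym oner_eq0.
have h1 : lam * znorm m x <= 1.
  have := zf _ l0; rewrite fl -[X in _ <= X](expr1n _ 2) ler_pXn2r// ?nnegrE ?ler01//.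
  by rewrite mulr_ge0 ?(ltW l0) ?(ltW z0).
have h2 : c <= lam * Nf x by rewrite -Nd//; apply: hc.
rewrite -(ler_pM2l l0); apply: le_trans h1 _.
by rewrite mulrCA -ler_pdivrMl ?invr_gt0// invrK mulr1.
Qed.

Lemma hardy_hom_norm (p : R) (Om : set 'rV[R]_N) :
  (0 < m)%N -> 1 < p -> (m%:R - p < 0 -> forall x, Om x -> znorm m x != 0) -> p != m%:R ->
  forall Nf : 'rV[R]_N -> R, hom_norm deg inv Nf ->
  exists c : R, 0 < c /\ forall u : 'rV[R]_N -> R, C1_0 Om u ->
     eLe (eScale c (intOm Om (fun x => `|u x| `^ p / Nf x `^ p)))
         (intOm Om (fun x => gradL deg op e u x `^ p)).
Proof.
move=> m0 p1 hz pm Nf hN; have p0 : 0 < p by lra.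
have [C [C0 hNC]] := hom_norm_bound hN.
have Cp0 : 0 < C `^ p by exact: powR_gt0.
exists ((C `^ p)^-1 * (`|m%:R - p| / p) `^ p); split.
  rewrite mulr_gt0 ?invr_gt0// powR_gt0// divr_gt0// normr_gt0 subr_eq0 eq_sym//.
move=> u hu; apply: le_trans (hardy_unweighted hC m0 ml p1 hz hu).
apply: (hardy_dominated m0 ml p1 Cp0 hz hu (w := fun x => (Nf x `^ p)^-1)).
  by move=> x; rewrite invr_ge0 powR_ge0.
move=> x z0; have h := hNC x z0.
have Nx0 : 0 < Nf x by rewrite -(pmulr_rgt0 _ C0) (lt_le_trans z0).
rewrite -lef_pV2 ?posrE ?invr_gt0 ?mulr_gt0 ?invr_gt0 ?powR_gt0// invfM !invrK.
rewrite ler_pdivrMl// -powRM ?(ltW C0) ?(ltW Nx0)//; apply: ge0_ler_powR.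
- exact: ltW.
- by rewrite nnegrE ltW.
- by rewrite nnegrE mulr_ge0// ltW.
- exact: h.
Qed.

Lemma hardy_NS (p : R) (Om : set 'rV[R]_N) (u : 'rV[R]_N -> R) :
  (0 < m)%N -> 1 < p -> (m%:R - p < 0 -> forall x, Om x -> znorm m x != 0) -> C1_0 Om u ->
  eLe (eScale ((`|m%:R - p| / p) `^ p) (intOm Om (fun x => `|u x| `^ p / NS deg x `^ p)))
      (eScale ((`|m%:R - p| / p) `^ p) (intOm Om (fun x => `|u x| `^ p / znorm m x `^ p))).
Proof.
move=> m0 p1 hz hu.
have := hardy_dominated m0 ml p1 ltr01 hz hu (w := fun x => (NS deg x `^ p)^-1).
rewrite invr1 mul1r; apply.
  by move=> x; rewrite invr_ge0 powR_ge0.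
move=> x z0; have zN := znorm_le_NS hC m0 ml x.
have NS0 : 0 < NS deg x := lt_le_trans z0 zN.
have P1 : NS deg x `^ p \is Num.pos by rewrite posrE; exact: (powR_gt0 p NS0).
have P2 : znorm m x `^ p \is Num.pos by rewrite posrE; exact: (powR_gt0 p z0).
rewrite mul1r lef_pV2//; apply: ge0_ler_powR => //; rewrite ?nnegrE.
- lra.
- exact: ltW.
- exact: ltW.
Qed.

End HomogeneousNorm.

(** * Integrals of functions of [|z|] by the divergence theorem *)

Section RadialFunctional.
Context {R : realType}.

(** A continuously differentiable step from 0 to 1 on the unit interval; its derivative [hump] is
    thus a continuous bump of mass one with explicit primitive. *)
Definition hump_prim (t : R) : R := 1 - Num.max 0 (1 - Num.max 0 t ^+ 2) ^+ 2.
Definition hump (t : R) : R := 4 * Num.max 0 (1 - Num.max 0 t ^+ 2) * Num.max 0 t.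

Lemma is_derive_hump_prim t : is_derive t (1 : R) hump_prim (hump t).
Proof.
have d1 : is_derive t (1 : R) (fun t => 1 - Num.max 0 t ^+ 2) (0 - 2 * Num.max 0 t).
  exact: (is_deriveB (is_derive_cst (1 : R) t (1 : R)) (is_derive_pos2 t)).
have d2 := is_derive_comp1 d1 (is_derive_pos2 (1 - Num.max 0 t ^+ 2)).
have d3 := is_deriveB (is_derive_cst (1 : R) t (1 : R)) d2.
by apply: is_derive_eq d3 _; rewrite /hump; ring.
Qed.

Lemma hump_continuous : continuous hump.
Proof.
suff H : forall t : R, {for t, continuous hump} by exact: H.
move=> t.
have c1 : {for t, continuous (fun t : R => Num.max 0 t)} by exact: max0_continuous.
apply: continuousM; last exact: c1.
apply: continuousM; first exact: cst_continuous.
apply: (@continuous_comp _ _ _ (fun t : R => 1 - Num.max 0 t ^+ 2) (fun t : R => Num.max 0 t)); last exact: max0_continuous.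
by apply: continuousB; [exact: cst_continuous|apply: continuousM].
Qed.

Lemma hump_ge0 t : 0 <= hump t.
Proof. by rewrite /hump !mulr_ge0// le_max lexx. Qed.

Lemma hump_low t : t <= 0 -> hump t = 0 /\ hump_prim t = 0.
Proof.
move=> t0; rewrite /hump /hump_prim (max_l t0) mulr0 expr0n /= subr0 max_r// expr1n subrr.
by [].
Qed.

Lemma hump_high t : 1 <= t -> hump t = 0 /\ hump_prim t = 1.
Proof.
move=> t1; have h : 1 - Num.max 0 t ^+ 2 <= 0.
  by rewrite max_r; [rewrite subr_le0 exprn_ege1|lra].
by rewrite /hump /hump_prim (max_l h) mulr0 mul0r expr0n /= subr0.
Qed.

Lemma hump_le4 t : hump t <= 4.
Proof.
have [t0|t0] := leP t 0; first by rewrite (hump_low t0).1.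
have [t1|t1] := leP 1 t; first by rewrite (hump_high t1).1.
rewrite /hump (max_r (ltW t0)) max_r; first nra.
by rewrite subr_ge0 expr_le1 ?(ltW t0)// ltW.
Qed.

Lemma hump_lower t : 4^-1 <= t <= 3 / 4 -> 4^-1 <= hump t.
Proof.
move=> /andP[h1 h2]; rewrite /hump (max_r (_ : 0 <= t)); last lra.
rewrite max_r; first nra.
by rewrite subr_ge0 expr_le1//; lra.
Qed.

Variables (N m : nat).
Hypothesis m_bd : (0 < m <= N)%N.
Implicit Types (x : 'rV[R]_N).

Definition wsq x : R := sumsq (fun k : 'I_N => (m <= k)%N) x.

(** The two scales are [l = ln] with [om = 1], [R0 = 1], and [l r = - ln (ln (R0 / r))] with
    [om r = 1 / ln (R0 / r)]. The bounds [l_low] and [l_high] keep [r] away from 0 and [R0] when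
    [l r] stays in an interval bounded below and with negative upper end. *)
Variables (R0 : R) (l om : R -> R).
Hypothesis dl : forall r, 0 < r < R0 -> is_derive r (1 : R) l (om r / r).
Hypothesis om0 : forall r, 0 < r < R0 -> 0 < om r.
Hypothesis com : forall r, 0 < r < R0 -> {for r, continuous om}.
Hypothesis l_low : forall a, exists ra, 0 < ra /\ forall r, 0 < r < R0 -> a <= l r -> ra <= r.
Hypothesis l_high : forall b, b < 0 -> exists rb, rb < R0 /\ forall r, 0 < r < R0 -> l r <= b -> r <= rb.
Hypothesis l_onto : forall a, a < 0 -> exists r, 0 < r < R0 /\ l r = a.

(** Outside this interval the formulas in [l] carry only default values, which the extension by zero
    discards. *)
Definition radext (g : R -> R) (r : R) : R := if (0 < r < R0) then g r else 0.

Lemma rad_near (g : R -> R) r : 0 < r < R0 -> \forall s \near r, g s = radext g s.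
Proof.
move=> /andP[r0 rR]; near=> s; rewrite /radext ifT//; apply/andP; split; near: s.
  exact: lt_nbhsr.
exact: lt_nbhsl.
Unshelve. all: by end_near. Qed.

Lemma is_derive_radext (g : R -> R) r d : 0 < r < R0 ->
  is_derive r (1 : R) g d -> is_derive r (1 : R) (radext g) d.
Proof. by move=> rr; apply: near_eq_is_derive; exact: rad_near. Qed.

Lemma continuous_radext (g : R -> R) r : 0 < r < R0 ->
  {for r, continuous g} -> {for r, continuous (radext g)}.
Proof.
move=> rr cg.
have E : radext g r = g r by rewrite /radext rr.
have H : g @ r --> radext g r by rewrite E.
by apply: cvg_trans H; apply: near_eq_cvg; apply: filterS (rad_near g rr) => s ->.
Qed.

Lemma l_continuous r : 0 < r < R0 -> {for r, continuous l}.
Proof.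
by move=> /dl h; apply/differentiable_continuous/derivable1_diffP; exact: (@ex_derive _ _ _ _ _ _ _ h).
Qed.

(** Compact model of the supports; with [0 < ra] and [rb < R0] it avoids both singular sets of the
    weights. *)
Definition shell ra rb B : set 'rV[R]_N :=
  [set x | ra <= znorm m x <= rb /\ wsq x <= B].

Lemma shell_closed ra rb B : closed (shell ra rb B).
Proof.
rewrite (_ : shell ra rb B = [set x | ra <= znorm m x] `&` (znorm m @^-1` [set t | t <= rb]) `&` (wsq @^-1` [set t | t <= B])).
  apply: closedI; first apply: closedI.
  - exact: closed_znorm_ge.
  - by apply: closed_comp; [move=> x _; exact: znorm_continuous|exact: closed_le].
  - by apply: closed_comp; [move=> x _; exact: sumsq_continuous|exact: closed_le].
by apply/seteqP; split => x; [move=> [/andP[? ?] ?]|move=> [[? ?] ?]; split => //; apply/andP].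
Qed.

Lemma shell_norm ra rb B x : shell ra rb B x -> `|x| <= Num.max rb (1 + B).
Proof.
move=> [/andP[_ zb] wB]; have z0 := znorm_ge0 m x.
have B0 : 0 <= B by apply: le_trans wB; exact: sumsq_ge0.
apply: rV_norm_le; first by rewrite le_max (le_trans z0 zb).
move=> i; rewrite le_max; have [im|im] := ltnP i m.
  by rewrite (le_trans (znorm_coord x im)).
apply/orP; right; have := @sumsq_coord _ _ (fun k : 'I_N => (m <= k)%N) x i im.
rewrite -[X in X <= _](real_normK (num_real (x 0 i))) => h.
have := le_trans h wB; have := normr_ge0 (x 0 i); nra.
Qed.

Lemma shell_compact ra rb B : compact (shell ra rb B).
Proof.
apply: bounded_closed_compact; last exact: shell_closed.
exists (Num.max rb (1 + B)); split => [|M Mm x /shell_norm h]; first exact: num_real.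
exact: le_trans h (ltW Mm).
Qed.

Lemma shell_Cc ra rb B (f : 'rV[R]_N -> R) : 0 < ra -> rb < R0 ->
  (forall x, ~ shell ra rb B x -> f x = 0) ->
  (forall x, 0 < znorm m x < R0 -> {for x, continuous f}) -> Cc f.
Proof.
move=> ra0 rbR f0 cf; split.
  apply: (glue_continuous (@shell_closed ra rb B) (U := [set x | 0 < znorm m x < R0]) _ f0 cf).
  by move=> x [/andP[h1 h2] _] /=; rewrite (lt_le_trans ra0)//= (le_lt_trans h2).
exists (Num.max rb (1 + B)) => x; rewrite ltNge => /negP h; apply: f0.
by move=> /shell_norm.
Qed.

(* [radfun g q] integrates to [int g dt] up to a constant depending on [q]
   only: [om r / r = l'] turns [r^(m-1) dr] into the measure [dt], [t = l r]. *)
Definition radfun (g q : R -> R) x : R :=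
  radext (fun r => om r / r ^+ m * g (l r)) (znorm m x) * q (wsq x).

Lemma znorm_comp_continuous (f : R -> R) x : {for znorm m x, continuous f} -> {for x, continuous (fun y => f (znorm m y))}.
Proof. by move=> cf; apply: (@continuous_comp _ _ _ (znorm m) f) => //; exact: znorm_continuous. Qed.

Lemma wsq_comp_continuous (q : R -> R) x : continuous q -> {for x, continuous (fun y => q (wsq y))}.
Proof. by move=> cq; apply: (@continuous_comp _ _ _ wsq q); [exact: sumsq_continuous|exact: cq]. Qed.

Lemma radial_density_continuous r (g : R -> R) : 0 < r < R0 -> continuous g ->
  {for r, continuous (fun r => om r / r ^+ m * g (l r))}.
Proof.
move=> rr cg; have r0 : 0 < r by case/andP: rr.
apply: continuousM; last by apply: (@continuous_comp _ _ _ l g); [exact: l_continuous|exact: cg].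
apply: continuousM; first exact: com.
by apply: continuousV; [rewrite gt_eqF// exprn_gt0|exact: exprn_continuous].
Qed.

Lemma radfun_Cc (g q : R -> R) a b B : b < 0 -> continuous g -> continuous q ->
  (forall t, ~~ (a <= t <= b) -> g t = 0) -> (forall t, B < t -> q t = 0) -> Cc (radfun g q).
Proof.
move=> b0 cg cq g0 q0.
have [ra [ra0 hra]] := l_low a.
have [rb [rbR hrb]] := l_high b0.
apply: (@shell_Cc ra rb B) => //.
  move=> x nS; rewrite /radfun /radext; case: ifP => [zr|]; last by rewrite mul0r.
  have [wB|wB] := leP (wsq x) B; last by rewrite (q0 _ wB) mulr0.
  rewrite g0 ?mulr0 ?mul0r//; apply/negP => /andP[h1 h2]; apply: nS; split => //.
  by rewrite hra// hrb.
move=> x zx; apply: continuousM; last exact: wsq_comp_continuous.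
by apply: znorm_comp_continuous; apply: continuous_radext => //; exact: radial_density_continuous.
Qed.

(** Stands in for polar coordinates. In the first [m] variables [z |z|^(-m)] is divergence free off
    the origin, so the divergence of [z |z|^(-m) G(l |z|) q] keeps only the derivative of [G(l r)],
    and that is exactly [radfun g q]. *)
Lemma radfun_derive (G g q : R -> R) a b B : b < 0 -> continuous g -> continuous q ->
  (forall t, is_derive t (1 : R) G (g t)) ->
  (forall t, ~~ (a <= t <= b) -> G t = 0 /\ g t = 0) -> (forall t, B < t -> q t = 0) ->
  J (radfun g q) = 0.
Proof.
move=> b0 cg cq dG gab q0.
have [ra [ra0 hra]] := l_low a.
have [rb [rbR hrb]] := l_high b0.
have cG : continuous G.
  by move=> t; apply/differentiable_continuous/derivable1_diffP; exact: (@ex_derive _ _ _ _ _ _ _ (dG t)).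
pose phi0 r := (r ^+ m)^-1 * G (l r).
pose dphi0 r := - m%:R / r * phi0 r + (r ^+ m)^-1 * (g (l r) * (om r / r)).
pose F i x := x 0 i * radext phi0 (znorm m x) * q (wsq x).
pose dF (i : 'I_N) x := (radext phi0 (znorm m x) + x 0 i * (radext dphi0 (znorm m x) * dznorm m i x)) * q (wsq x).
have dphi r : 0 < r < R0 -> is_derive r (1 : R) phi0 (dphi0 r).
  move=> rr; have r0 : 0 < r by case/andP: rr.
  have dp : is_derive r (1 : R) (fun r : R => (r ^+ m)^-1) (- m%:R / r * (r ^+ m)^-1).
    apply: (@near_eq_is_derive _ _ _ (fun a => a `^ (- m%:R))).
      by near=> s; rewrite powR_invn// ltW//; near: s; exact: lt_nbhsr.
    apply: is_derive_eq (is_derive1_powR (- m%:R) r0) _.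
    by rewrite (powRDp _ _ r0) powR_invn ?(ltW r0)// powR_inv1 ?(ltW r0)//; ring.
  have dGl := is_derive1_comp (dG (l r)) (dl rr).
  apply: is_derive_eq (is_deriveM dp dGl) _.
  rewrite -[LHS]/((r ^+ m)^-1 * (g (l r) * (om r / r)) + G (l r) * (- m%:R / r * (r ^+ m)^-1)) /dphi0 /phi0.
  ring.
have vanish x : ~ shell ra rb B x -> (radext phi0 (znorm m x) = 0 /\ radext dphi0 (znorm m x) = 0) \/ q (wsq x) = 0.
  move=> nS; have [wB|wB] := leP (wsq x) B; last by right; exact: q0.
  left; rewrite /radext; case: ifP => // zr.
  have [h1 h2] : G (l (znorm m x)) = 0 /\ g (l (znorm m x)) = 0.
    by apply: gab; apply/negP => /andP[h1 h2]; apply: nS; split => //; rewrite hra// hrb.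
  by rewrite /dphi0 /phi0 h1 h2 !(mulr0, mul0r, addr0).
have F0 i x : ~ shell ra rb B x -> F i x = 0.
  by move=> /vanish [[h _]|h]; rewrite /F h !(mulr0, mul0r).
have dF0 i x : ~ shell ra rb B x -> dF i x = 0.
  by move=> /vanish [[h1 h2]|h]; rewrite /dF ?h ?h1 ?h2 !(mulr0, mul0r, addr0).
have cphi r : 0 < r < R0 -> {for r, continuous (radext phi0)}.
  move=> rr; apply: continuous_radext => //.
  by apply/differentiable_continuous/derivable1_diffP; exact: (@ex_derive _ _ _ _ _ _ _ (dphi r rr)).
have cdphi r : 0 < r < R0 -> {for r, continuous (radext dphi0)}.
  move=> rr; have r0 : 0 < r by case/andP: rr.
  have cinv : {for r, continuous (fun r : R => r^-1)} by apply: continuousV; [rewrite gt_eqF|exact: cvg_id].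
  have cinvm : {for r, continuous (fun r : R => (r ^+ m)^-1)}.
    by apply: continuousV; [rewrite gt_eqF// exprn_gt0|exact: exprn_continuous].
  apply: continuous_radext => //; apply: continuousD; apply: continuousM => //.
  - by apply: continuousM => //; exact: cst_continuous.
  - by apply: continuousM => //; apply: (@continuous_comp _ _ _ l G); [exact: l_continuous|exact: cG].
  - apply: continuousM; last by apply: continuousM => //; exact: com.
    by apply: (@continuous_comp _ _ _ l g); [exact: l_continuous|exact: cg].
have CF i : Cc (F i).
  apply: (shell_Cc ra0 rbR (F0 i)) => x zx.
  apply: continuousM; last exact: wsq_comp_continuous.
  by apply: continuousM; [exact: continuous_coord|exact/znorm_comp_continuous/cphi].
have CdF i : Cc (dF i).
  apply: (shell_Cc ra0 rbR (dF0 i)) => x zx.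
  apply: continuousM; last exact: wsq_comp_continuous.
  apply: continuousD; first exact/znorm_comp_continuous/cphi.
  apply: continuousM; first exact: continuous_coord.
  apply: continuousM; first exact/znorm_comp_continuous/cdphi.
  by apply: dznorm_continuous; case/andP: zx.
have qw (i : 'I_N) x : (i < m)%N -> is_derive x (ebas R i) (fun y => q (wsq y)) 0.
  move=> im; have := @is_derive_reparam R 'rV[R]_N 'rV[R]_N R (fun y => q (wsq y)) (cst (q (wsq x))) x (ebas R i) x (ebas R i).
  rewrite derive_cst; apply; last exact: derivable_cst.
  move=> h /=; congr q; apply: eq_bigr => k mk; rewrite !mxE eqxx /=.
  have -> : (k == i) = false by apply/eqP => ki; move: mk; rewrite ki leqNgt im.
  by rewrite mulr0 add0r.
have dFi (i : 'I_N) : (i < m)%N -> forall x, is_derive x (ebas R i) (F i) (dF i x).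
  move=> im; apply: (glue_derive (@shell_closed ra rb B) (U := [set x | 0 < znorm m x < R0])).
  - by move=> x [/andP[h1 h2] _] /=; rewrite (lt_le_trans ra0)//= (le_lt_trans h2).
  - exact: F0.
  - exact: dF0.
  move=> x zx; have z0 : 0 < znorm m x by case/andP: zx.
  have d1 := is_derive_comp1 (is_derive_znorm i z0) (is_derive_radext zx (dphi _ zx)).
  have d2 := is_deriveM (is_deriveM (is_derive_coord x (ebas R i) i) d1) (qw i x im).
  apply: is_derive_eq d2 _; rewrite /dF !mxE !eqxx /=.
  rewrite -[LHS]/(x 0 i * radext phi0 (znorm m x) * 0 + q (wsq x) * (x 0 i * (dphi0 (znorm m x) * dznorm m i x) + radext phi0 (znorm m x) * 1)).
  have -> : radext dphi0 (znorm m x) = dphi0 (znorm m x) by rewrite /radext zx.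
  ring.
have sumE : radfun g q = (fun x => \sum_(i < N | (i < m)%N) dF i x).
  apply/funext => x; rewrite /dF -mulr_suml big_split /=.
  rewrite (_ : \sum_(i < N | (i < m)%N) x 0 i * _ = radext dphi0 (znorm m x) * \sum_(i < N | (i < m)%N) x 0 i * dznorm m i x); last first.
    by rewrite mulr_sumr; apply: eq_bigr => i _; ring.
  rewrite sumr_const (_ : #|_| = m); last first.
    by case/andP: m_bd => _ mN; rewrite -sum1_card (big_ord_narrow mN) /= sum_nat_const card_ord muln1.
  rewrite /radfun; congr (_ * _); rewrite /radext; case: ifP => zx; last by rewrite mul0rn mul0r addr0.
  have z0 : 0 < znorm m x by case/andP: zx.
  rewrite sum_x_dznorm// /dphi0 -mulr_natr; field.
  by rewrite expf_neq0 gt_eqF.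
rewrite sumE J_sum; last by move=> i _; exact: CdF.
by apply: big1 => i im; apply: (J_derive (CF i) (CdF i) (dFi i im)).
Unshelve. all: by end_near. Qed.

Definition humps a L (t : R) : R := hump ((t - a) / L) / L.

Lemma humps_continuous a L : continuous (humps a L).
Proof.
suff H : forall t : R, {for t, continuous (humps a L)} by exact: H.
move=> t; apply: continuousM; last exact: cst_continuous.
apply: (@continuous_comp _ _ _ (fun t => (t - a) / L) hump); last exact: hump_continuous.
apply: continuousM; last exact: cst_continuous.
by apply: continuousB; [exact: cvg_id|exact: cst_continuous].
Qed.

Lemma is_derive_humps a L t : is_derive t (1 : R) (fun t => hump_prim ((t - a) / L)) (humps a L t).
Proof.
have d1 : is_derive t (1 : R) (fun t => (t - a) / L) L^-1.
  have H := is_deriveM (is_deriveB (is_derive_id t (1 : R)) (is_derive_cst a t (1 : R))) (is_derive_cst L^-1 t (1 : R)).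
  apply: is_derive_eq H _.
  by rewrite -[LHS]/((t - a) * 0 + L^-1 * (1 - 0)); ring.
exact: (is_derive1_comp (is_derive_hump_prim _) d1).
Qed.

Lemma humps_supp a L t : 0 < L -> ~~ (a <= t <= a + L) -> humps a L t = 0.
Proof.
move=> L0; rewrite negb_and -!ltNge /humps => /orP[h|h].
  by rewrite (hump_low _).1 ?mul0r// ler_pdivrMr// mul0r; lra.
by rewrite (hump_high _).1 ?mul0r// ler_pdivlMr// mul1r; lra.
Qed.

Lemma radfun_humps_Cc a L q B : 0 < L -> a + L < 0 -> continuous q ->
  (forall t, B < t -> q t = 0) -> Cc (radfun (humps a L) q).
Proof.
move=> L0 aL cq q0; apply: (radfun_Cc aL (@humps_continuous a L) cq _ q0) => t.
exact: humps_supp.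
Qed.

(** Both bumps have mass one, so the primitive of their difference has compact support and
    [radfun_derive] applies to it. *)
Lemma radfun_invariant a L a' L' q B : 0 < L -> 0 < L' -> a + L < 0 -> a' + L' < 0 ->
  continuous q -> (forall t, B < t -> q t = 0) ->
  J (radfun (humps a L) q) = J (radfun (humps a' L') q).
Proof.
move=> L0 L'0 aL aL' cq q0; apply/eqP; rewrite -subr_eq0; apply/eqP.
rewrite -JB; [|exact: radfun_humps_Cc aL cq q0|exact: radfun_humps_Cc aL' cq q0].
pose G t := hump_prim ((t - a) / L) - hump_prim ((t - a') / L').
have -> : (fun x => radfun (humps a L) q x - radfun (humps a' L') q x) =
    radfun (fun t => humps a L t - humps a' L' t) q.
  by apply/funext => x; rewrite /radfun /radext; case: ifP => _; ring.
apply: (@radfun_derive G (fun t => humps a L t - humps a' L' t) q (Num.min a a') (Num.max (a + L) (a' + L')) B) => //.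
- by rewrite gt_max aL.
- suff H : forall t : R, {for t, continuous (fun t => humps a L t - humps a' L' t)} by exact: H.
  by move=> t; apply: continuousB; exact: humps_continuous.
- by move=> t; apply: is_deriveB; exact: is_derive_humps.
move=> t; rewrite negb_and -!ltNge lt_min gt_max => /orP[/andP[h1 h2]|/andP[h1 h2]].
  have e1 : (t - a) / L <= 0 by rewrite ler_pdivrMr// mul0r; lra.
  have e2 : (t - a') / L' <= 0 by rewrite ler_pdivrMr// mul0r; lra.
  by rewrite /G /humps (hump_low e1).1 (hump_low e1).2 (hump_low e2).1 (hump_low e2).2 !mul0r subrr.
have e1 : 1 <= (t - a) / L by rewrite ler_pdivlMr// mul1r; lra.
have e2 : 1 <= (t - a') / L' by rewrite ler_pdivlMr// mul1r; lra.
by rewrite /G /humps (hump_high e1).1 (hump_high e1).2 (hump_high e2).1 (hump_high e2).2 !mul0r !subrr.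
Qed.

Lemma radfun_gt0 (q : R -> R) B : continuous q -> (forall t, B < t -> q t = 0) -> (forall t, 0 <= q t) ->
  0 < q 0 -> 0 < J (radfun (humps (-2) 1) q).
Proof.
move=> cq qB q_ge0 q_0.
(* Midpoint of the support of [humps (-2) 1], where the integrand is positive. *)
have n32 : - (3 / 2) < 0 :> R by lra.
have [r [rr lr]] := l_onto n32.
have r0 : 0 < r by case/andP: rr.
case/andP: m_bd => m0 mN.
pose i0 := Ordinal (leq_trans m0 mN).
have zx : znorm m (r *: ebas R i0) = r.
  rewrite /znorm (bigD1 i0)//= big1 ?addr0; last first.
    by move=> k /andP[_ /negbTE ki]; rewrite !mxE eqxx /= ki mulr0 expr0n.
  by rewrite !mxE !eqxx mulr1 sqrtr_sqr gtr0_norm.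
have wx : wsq (r *: ebas R i0) = 0.
  apply: big1 => k mk; rewrite !mxE eqxx /= (_ : (k == i0) = false) ?mulr0 ?expr0n//.
  by apply/eqP => ki; move: mk; rewrite ki leqNgt m0.
apply: (@J_gt0 _ _ _ (r *: ebas R i0)).
- by apply: (radfun_humps_Cc _ _ cq qB); lra.
- move=> x; rewrite /radfun mulr_ge0// /radext; case: ifP => // zr.
  have z0 : 0 < znorm m x by case/andP: zr.
  rewrite mulr_ge0//; last by rewrite /humps divr_ge0// hump_ge0.
  by rewrite divr_ge0 ?exprn_ge0 ?(ltW z0)// ltW// om0.
rewrite /radfun zx wx /radext rr mulr_gt0// mulr_gt0 ?divr_gt0 ?exprn_gt0 ?om0//.
rewrite /humps lr divr1; apply: lt_le_trans (hump_lower _); lra.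
Qed.

End RadialFunctional.

(** * Test functions and the comparison of the two integrals *)

Section Sharpness.
Context {R : realType}.

Lemma minkowski2 (I : finType) (P : pred I) (a b : I -> R) :
  Num.sqrt (\sum_(i | P i) (a i + b i) ^+ 2) <=
  Num.sqrt (\sum_(i | P i) a i ^+ 2) + Num.sqrt (\sum_(i | P i) b i ^+ 2).
Proof.
have CS := le_trans (ler_norm _) (cauchy_schwarz P a b).
set A := Num.sqrt (\sum_(i | P i) a i ^+ 2) in CS *.
set B := Num.sqrt (\sum_(i | P i) b i ^+ 2) in CS *.
have A2 : A ^+ 2 = \sum_(i | P i) a i ^+ 2 by rewrite sqr_sqrtr// sumr_ge0// => *; exact: sqr_ge0.
have B2 : B ^+ 2 = \sum_(i | P i) b i ^+ 2 by rewrite sqr_sqrtr// sumr_ge0// => *; exact: sqr_ge0.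
have AB0 : 0 <= A + B by rewrite addr_ge0// sqrtr_ge0.
rewrite -[leRHS](ger0_norm AB0) -sqrtr_sqr ler_wsqrtr//.
rewrite sqrrD A2 B2 (eq_bigr (fun i => (a i ^+ 2 + b i ^+ 2) + 2 * (a i * b i))); last by move=> i _; ring.
rewrite !big_split /= -mulr_sumr; lra.
Qed.

(** Young's inequality for [a + b] and [a] rearranges to the convexity bound with slope
    [p (a + b)^(p-1)], which is then bounded uniformly. *)
Lemma powR_add_le (p A a b : R) : 1 < p -> 0 <= a -> a <= A -> 0 <= b -> b <= 1 ->
  (a + b) `^ p <= a `^ p + p * (A + 1) `^ (p - 1) * b.
Proof.
move=> p1 a0 aA b0 b1.
have ab0 : 0 <= a + b by lra.
have Y := young_p p1 ab0 a0.
have E : (a + b) * (a + b) `^ (p - 1) = (a + b) `^ p by apply: mulr_powRB1 => //; lra.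
have M : (a + b) `^ (p - 1) <= (A + 1) `^ (p - 1).
  by apply: ge0_ler_powR; rewrite ?nnegrE; lra.
have M2 : p * (a + b) `^ (p - 1) * b <= p * (A + 1) `^ (p - 1) * b.
  by rewrite ler_wpM2r// ler_wpM2l//; lra.
move: Y; rewrite -E => Y.
set X := (a + b) `^ (p - 1) in Y M M2 *.
nra.
Qed.

Definition psi (t : R) : R := Num.max 0 (1 - t ^+ 2) ^+ 2.
Definition dpsi (t : R) : R := - 4 * t * Num.max 0 (1 - t ^+ 2).

Lemma sqr1_continuous : continuous (fun t : R => 1 - t ^+ 2).
Proof.
suff H : forall t : R, {for t, continuous (fun t : R => 1 - t ^+ 2)} by exact: H.
by move=> t; apply: continuousB; [exact: cst_continuous|exact: exprn_continuous].
Qed.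

Lemma max_sqr1_continuous : continuous (fun t : R => Num.max 0 (1 - t ^+ 2)).
Proof.
move=> t; apply: (@continuous_comp _ _ _ (fun t : R => 1 - t ^+ 2) (fun t => Num.max 0 t)).
  exact: sqr1_continuous.
exact: max0_continuous.
Qed.

Lemma is_derive_psi t : is_derive t (1 : R) psi (dpsi t).
Proof.
have d1 : is_derive t (1 : R) (fun t => 1 - t ^+ 2) (- 2 * t).
  have H := is_deriveB (is_derive_cst (1 : R) t (1 : R)) (is_deriveM (is_derive_id t (1 : R)) (is_derive_id t (1 : R))).
  rewrite (_ : (fun t : R => _) = cst 1 - (id * id)); last by apply/funext => y; rewrite !fctE expr2.
  apply: is_derive_eq H _.
  by rewrite -[LHS]/(0 - (t * 1 + t * 1)); ring.
apply: is_derive_eq (is_derive1_comp (is_derive_pos2 _) d1) _.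
by rewrite /dpsi; ring.
Qed.

Lemma psi_continuous : continuous psi.
Proof.
by move=> t; apply/differentiable_continuous/derivable1_diffP; exact: (@ex_derive _ _ _ _ _ _ _ (is_derive_psi t)).
Qed.

Lemma dpsi_continuous : continuous dpsi.
Proof.
suff H : forall t : R, {for t, continuous dpsi} by exact: H.
move=> t; apply: continuousM; last exact: max_sqr1_continuous.
by apply: continuousM; [exact: cst_continuous|exact: cvg_id].
Qed.

Lemma psi_ge0 t : 0 <= psi t. Proof. exact: sqr_ge0. Qed.

Lemma psi_off t : ~~ (-1 <= t <= 1) -> psi t = 0 /\ dpsi t = 0.
Proof.
move=> h; have t1 : 1 - t ^+ 2 <= 0.
  move: h; rewrite negb_and -!ltNge => /orP[h|h]; nra.
by rewrite /psi /dpsi (max_l t1) mulr0 expr0n.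
Qed.

Lemma psi_le1 t : psi t <= 1.
Proof.
have [h|h] := boolP (-1 <= t <= 1); last by rewrite (psi_off h).1.
case/andP: h => h1 h2; have t1 : 0 <= 1 - t ^+ 2 by nra.
rewrite /psi (max_r t1) expr_le1//; nra.
Qed.

Lemma dpsi_le4 t : `|dpsi t| <= 4.
Proof.
have [h|h] := boolP (-1 <= t <= 1); last by rewrite (psi_off h).2 normr0.
case/andP: h => h1 h2; have t1 : 0 <= 1 - t ^+ 2 by nra.
rewrite /dpsi (max_r t1) ler_norml; apply/andP; split; nra.
Qed.

Lemma psi_lower t : - (1 / 2) <= t <= 1 / 2 -> 9 / 16 <= psi t.
Proof.
case/andP => h1 h2; have t1 : 0 <= 1 - t ^+ 2 by nra.
rewrite /psi (max_r t1); have t2 : 3 / 4 <= 1 - t ^+ 2 by nra.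
nra.
Qed.

(** The shifted bump lives where [|t| <= 1/2]; there [psi >= 9/16], and the 4 is the upper bound of
    [hump]. *)
Lemma psi_hump (p t : R) : 1 < p -> (9 / 16) `^ p / 4 * hump (t + 1 / 2) <= psi t `^ p.
Proof.
move=> p1; have [h|h] := boolP (- (1 / 2) <= t <= 1 / 2).
  apply: (@le_trans _ _ ((9 / 16) `^ p)).
    have := hump_le4 (t + 1 / 2); have := powR_ge0 (9 / 16 : R) p; nra.
  by apply: ge0_ler_powR; rewrite ?nnegrE ?psi_lower ?psi_ge0//; lra.
have -> : hump (t + 1 / 2) = 0; last by rewrite mulr0 powR_ge0.
move: h; rewrite negb_and -!ltNge => /orP[h|h].
  by apply: (hump_low _).1; lra.
by apply: (hump_high _).1; lra.
Qed.

(** A bump stretched over the interval from -2 to 2 dominates the indicator of the support of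
    [psi]. *)
Lemma hump_cover (t : R) : -1 <= t <= 1 -> 1 <= 4 * hump ((t + 2) / 4).
Proof.
case/andP => h1 h2; have h : 4^-1 <= (t + 2) / 4 <= 3 / 4 by lra.
have := hump_lower h; lra.
Qed.

Variables (N : nat) (deg : 'I_N -> nat).
Variables (op : 'rV[R]_N -> 'rV[R]_N -> 'rV[R]_N) (inv : 'rV[R]_N -> 'rV[R]_N) (e : 'rV[R]_N).
Hypothesis hC : is_hom_carnot deg op inv e.
Hypothesis deg2 : forall k, (deg k <= 2)%N.
Variable m : nat.
Hypothesis m0 : (0 < m)%N.
Hypothesis mE : m = lay1 deg.
Implicit Types (x : 'rV[R]_N).

Let ml : (m <= lay1 deg)%N. Proof. by rewrite mE. Qed.
Let m_bd : (0 < m <= N)%N := m_bounds m0 ml.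

Lemma layer1_iff (k : 'I_N) : (deg k == 1%N) = (k < m)%N.
Proof.
apply/eqP/idP => [|km]; first by rewrite mE; exact: (layer1_lt hC).
exact: (deg_layer1 hC ml km).
Qed.

Variable s : R.
Hypothesis s0 : 0 < s.

Definition cutw (t : R) : R := Num.max 0 (1 - t / s) ^+ 2.
Definition dcutw (t : R) : R := 2 * Num.max 0 (1 - t / s) * (- s^-1).
(** Continuous majorant of the indicator of [t <= s], for error terms that carry no factor
    [cutw]. *)
Definition cutw1 (t : R) : R := Num.max 0 (2 - t / s).

Lemma is_derive_cutw t : is_derive t (1 : R) cutw (dcutw t).
Proof.
have d1 : is_derive t (1 : R) (fun t => 1 - t / s) (- s^-1).
  have H := is_deriveB (is_derive_cst (1 : R) t (1 : R)) (is_deriveM (is_derive_id t (1 : R)) (is_derive_cst s^-1 t (1 : R))).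
  apply: is_derive_eq H _.
  by rewrite -[LHS]/(0 - (t * 0 + s^-1 * 1)); ring.
exact: (is_derive1_comp (is_derive_pos2 _) d1).
Qed.

Let lin_continuous c : continuous (fun t : R => c - t / s).
Proof.
suff H : forall t : R, {for t, continuous (fun t : R => c - t / s)} by exact: H.
move=> t; apply: continuousB; first exact: cst_continuous.
by apply: continuousM; [exact: cvg_id|exact: cst_continuous].
Qed.

Let maxlin_continuous c : continuous (fun t : R => Num.max 0 (c - t / s)).
Proof.
move=> t; apply: (@continuous_comp _ _ _ (fun t : R => c - t / s) (fun t => Num.max 0 t)).
  exact: lin_continuous.
exact: max0_continuous.
Qed.

Lemma cutw_continuous : continuous cutw.
Proof.
by move=> t; apply/differentiable_continuous/derivable1_diffP; exact: (@ex_derive _ _ _ _ _ _ _ (is_derive_cutw t)).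
Qed.

Lemma dcutw_continuous : continuous dcutw.
Proof.
suff H : forall t : R, {for t, continuous dcutw} by exact: H.
move=> t; apply: continuousM; last exact: cst_continuous.
by apply: continuousM; [exact: cst_continuous|exact: maxlin_continuous].
Qed.

Lemma cutw_off t : s < t -> cutw t = 0 /\ dcutw t = 0.
Proof.
move=> st; have h : 1 - t / s <= 0 by rewrite subr_le0 ler_pdivlMr// mul1r ltW.
by rewrite /cutw /dcutw (max_l h) mulr0 mul0r expr0n.
Qed.

Lemma cutw_ge0 t : 0 <= cutw t. Proof. exact: sqr_ge0. Qed.

Lemma cutw_le1 t : 0 <= t -> cutw t <= 1.
Proof.
move=> t0; rewrite /cutw expr_le1//; last by rewrite le_max lexx.
by rewrite ge_max ler01 lerBlDr lerDl divr_ge0// ltW.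
Qed.

Lemma dcutw_bound t : 0 <= t -> `|dcutw t| <= 2 / s.
Proof.
move=> t0; rewrite /dcutw normrM normrN [`|s^-1|]ger0_norm ?invr_ge0 ?(ltW s0)//.
rewrite ler_wpM2r ?invr_ge0 ?(ltW s0)// normrM ger0_norm//.
rewrite ger0_norm ?le_max ?lexx// -[leRHS]mulr1 ler_wpM2l//.
by rewrite ge_max ler01 lerBlDr lerDl divr_ge0// ltW.
Qed.

Lemma cutw1_lower t : t <= s -> 1 <= cutw1 t.
Proof.
by move=> ts; rewrite /cutw1 le_max; apply/orP; right; rewrite lerBrDr -lerBrDl; have : t / s <= 1 by [rewrite ler_pdivrMr// mul1r]; lra.
Qed.

Definition dtheta (j : 'I_N) x : R := dcutw (wsq m x) * (if (m <= j)%N then 2 * x 0 j else 0).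

Lemma is_derive_theta j x : is_derive x (ebas R j) (fun y => cutw (wsq m y)) (dtheta j x).
Proof.
exact: (is_derive_comp1 (is_derive_sumsq (fun k : 'I_N => (m <= k)%N) x j) (is_derive_cutw _)).
Qed.

Lemma dtheta_continuous j : continuous (dtheta j).
Proof.
suff H : forall x, {for x, continuous (dtheta j)} by exact: H.
move=> x; apply: continuousM; first exact/wsq_comp_continuous/dcutw_continuous.
case: (m <= j)%N; last exact: cst_continuous.
by apply: continuousM; [exact: cst_continuous|exact: continuous_coord].
Qed.

Lemma dtheta_bound j x : wsq m x <= s -> `|dtheta j x| <= 2 / s * (2 * (1 + s)).
Proof.
move=> ws; rewrite /dtheta normrM.
have w0 : 0 <= wsq m x by exact: sumsq_ge0.
apply: ler_pM => //; first exact: dcutw_bound.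
case: ifP => mj; last by rewrite normr0; lra.
rewrite normrM ger0_norm// ler_wpM2l//.
have := @sumsq_coord _ _ (fun k : 'I_N => (m <= k)%N) x j mj.
rewrite -[X in X <= _](real_normK (num_real (x 0 j))) => h.
have := le_trans h ws; have := normr_ge0 (x 0 j); nra.
Qed.

(* In step two the coefficients of [d/dx_j], [deg j = 2], are linear in [z]. *)
Lemma Xtheta_bound : exists C2, 0 <= C2 /\ forall k x, deg k = 1%N ->
  `|\sum_j vfcoef op k j x * dtheta j x| <= C2 * znorm m x * (wsq m x <= s)%R%:R.
Proof.
pose D := 2 / s * (2 * (1 + s)).
have D0 : 0 <= D by rewrite /D mulr_ge0 ?divr_ge0 ?(ltW s0)//; have := s0; lra.
pose b k j := \sum_(i | deg i == 1%N) `|dvfcoef op k j i 0|.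
have b0 k j : 0 <= b k j by apply: sumr_ge0 => *.
exists (\sum_k \sum_j b k j * D); split.
  by apply: sumr_ge0 => k _; apply: sumr_ge0 => j _; rewrite mulr_ge0.
move=> k x k1; have z0 := znorm_ge0 m x.
have [ws|ws] := leP (wsq m x) s; last first.
  rewrite mulr0 big1 ?normr0// => j _.
  by rewrite /dtheta (cutw_off ws).2 mul0r mulr0.
rewrite mulr1; apply: le_trans (ler_norm_sum _ _ _) _.
apply: (@le_trans _ _ (\sum_j b k j * D * znorm m x)); last first.
  rewrite -mulr_suml ler_wpM2r// [leRHS](bigD1 k)//= lerDl.
  by apply: sumr_ge0 => i _; apply: sumr_ge0 => j _; rewrite mulr_ge0.
apply: ler_sum => j _; rewrite normrM.
have [jm|mj] := ltnP j m.
  rewrite /dtheta leqNgt jm /= mulr0 normr0 mulr0.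
  by apply: mulr_ge0 => //; apply: mulr_ge0 => //; exact: b0.
have j2 : deg j = 2%N.
  have := deg2 j; have := carnot_deg_gt0 hC j; have := layer1_iff j.
  by rewrite ltnNge mj /=; case: (deg j) => [|[|[|]]].
rewrite -mulrA [D * _]mulrC mulrA; apply: ler_pM => //; last exact: dtheta_bound.
rewrite (vfcoef_layer2 hC x k1 j2) /b mulr_suml.
apply: le_trans (ler_norm_sum _ _ _) _; apply: ler_sum => i i1.
rewrite normrM mulrC ler_wpM2l//; apply: znorm_coord.
by rewrite -layer1_iff.
Qed.

Lemma wsq_ge0 x : 0 <= wsq m x. Proof. exact: sumsq_ge0. Qed.

Variables (R0 : R) (l om : R -> R).
Hypothesis dl : forall r, 0 < r < R0 -> is_derive r (1 : R) l (om r / r).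
Hypothesis om0 : forall r, 0 < r < R0 -> 0 < om r.
Hypothesis com : forall r, 0 < r < R0 -> {for r, continuous om}.
Hypothesis l_low : forall a, exists ra, 0 < ra /\ forall r, 0 < r < R0 -> a <= l r -> ra <= r.
Hypothesis l_high : forall b, b < 0 -> exists rb, rb < R0 /\ forall r, 0 < r < R0 -> l r <= b -> r <= rb.
Hypothesis l_onto : forall a, a < 0 -> exists r, 0 < r < R0 /\ l r = a.
Variable kap : R.

(** The exponential is [r^(-(m + beta)/p)], respectively [ln(R0/r)^(-(beta+1)/p)], a borderline
    extremal; the shift by 3 puts the support of the cutoff in [-4 L <= l r <= -2 L], close to
    [z = 0] for large [L]. *)
Definition profile L (r : R) : R := expR (- kap * l r) * psi (l r / L + 3).
Definition dprofile L (r : R) : R :=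
  expR (- kap * l r) * (om r / r) * (dpsi (l r / L + 3) / L - kap * psi (l r / L + 3)).

Lemma is_derive_profile L r : 0 < r < R0 -> is_derive r (1 : R) (profile L) (dprofile L r).
Proof.
move=> rr.
have d1 : is_derive r (1 : R) (fun r => expR (- kap * l r)) (expR (- kap * l r) * (- kap * (om r / r))).
  apply: (is_derive1_comp (f := expR) (g := fun r => - kap * l r)).
  exact: (is_deriveZ (- kap) (dl rr)).
have d2 : is_derive r (1 : R) (fun r => l r / L + 3) (om r / r / L).
  have H := is_deriveD (is_deriveM (dl rr) (is_derive_cst L^-1 r (1 : R))) (is_derive_cst (3 : R) r (1 : R)).
  apply: is_derive_eq H _.
  by rewrite -[LHS]/((l r * 0 + L^-1 * (om r / r)) + 0); ring.
have d3 := is_derive1_comp (is_derive_psi _) d2.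
apply: is_derive_eq (is_deriveM d1 d3) _.
rewrite -[LHS]/(expR (- kap * l r) * (dpsi (l r / L + 3) * (om r / r / L)) + psi (l r / L + 3) * (expR (- kap * l r) * (- kap * (om r / r)))) /dprofile.
ring.
Qed.

Lemma comp_l_continuous (g : R -> R) L r : 0 < r < R0 -> continuous g ->
  {for r, continuous (fun r => g (l r / L + 3))}.
Proof.
move=> rr cg; apply: (@continuous_comp _ _ _ (fun r => l r / L + 3) g); last exact: cg.
apply: continuousD; last exact: cst_continuous.
by apply: continuousM; [exact: (l_continuous dl)|exact: cst_continuous].
Qed.

Lemma dprofile_continuous L r : 0 < r < R0 -> {for r, continuous (dprofile L)}.
Proof.
move=> rr; have r0 : 0 < r by case/andP: rr.
have ce : {for r, continuous (fun r => expR (- kap * l r))}.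
  apply: (@continuous_comp _ _ _ (fun r => - kap * l r) expR); last exact: continuous_expR.
  by apply: continuousM; [exact: cst_continuous|exact: (l_continuous dl)].
apply: continuousM.
  apply: continuousM => //; apply: continuousM; first exact: com.
  by apply: continuousV; [rewrite gt_eqF|exact: cvg_id].
apply: continuousB.
  apply: continuousM; last exact: cst_continuous.
  by apply: comp_l_continuous => //; exact: dpsi_continuous.
apply: continuousM; first exact: cst_continuous.
by apply: comp_l_continuous => //; exact: psi_continuous.
Qed.

Definition testfun L x : R := radext R0 (profile L) (znorm m x) * cutw (wsq m x).
Definition dtestfun L (j : 'I_N) x : R :=
  radext R0 (dprofile L) (znorm m x) * dznorm m j x * cutw (wsq m x) +
  radext R0 (profile L) (znorm m x) * dtheta j x.

Lemma support_interval (L t : R) : 0 < L -> -1 <= t / L + 3 <= 1 -> - (4 * L) <= t <= - (2 * L).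
Proof.
move=> L0 /andP[h1 h2].
have h1' : - 4 <= t / L by lra. have h2' : t / L <= - 2 by lra.
rewrite ler_pdivlMr// in h1'; rewrite ler_pdivrMr// in h2'.
by apply/andP; split; lra.
Qed.

Section Support.
Variables (L ra rb : R).
Hypothesis L0 : 0 < L.
Hypothesis ra0 : 0 < ra.
Hypothesis rbR : rb < R0.
Hypothesis hra : forall r, 0 < r < R0 -> - (4 * L) <= l r -> ra <= r.
Hypothesis hrb : forall r, 0 < r < R0 -> l r <= - (2 * L) -> r <= rb.
Let K := @shell R N m ra rb s.
Let U := [set x : 'rV[R]_N | 0 < znorm m x < R0].

Lemma shell_sub : K `<=` U.
Proof. by move=> x [/andP[h1 h2] _]; apply/andP; split; [exact: lt_le_trans ra0 h1|exact: le_lt_trans h2 rbR]. Qed.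

Lemma off_shell x : ~ K x -> (radext R0 (profile L) (znorm m x) = 0 /\ radext R0 (dprofile L) (znorm m x) = 0)
   \/ s < wsq m x.
Proof.
move=> nK; have [ws|ws] := leP (wsq m x) s; last by right.
left; rewrite /radext; case: ifP => // zr.
have h : ~~ (-1 <= l (znorm m x) / L + 3 <= 1).
  apply/negP => /(support_interval L0) /andP[h1 h2]; apply: nK; split => //.
  by rewrite hra// hrb.
by rewrite /profile /dprofile (psi_off h).1 (psi_off h).2 mul0r !mulr0 subr0 mulr0.
Qed.

Lemma testfun_off x : ~ K x -> testfun L x = 0.
Proof.
move=> /off_shell [[h _]|h]; rewrite /testfun ?h ?mul0r//.
by rewrite (cutw_off h).1 mulr0.
Qed.

Lemma dtestfun_off j x : ~ K x -> dtestfun L j x = 0.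
Proof.
move=> /off_shell [[h1 h2]|h]; rewrite /dtestfun ?h1 ?h2 ?mul0r ?addr0//.
by rewrite /dtheta (cutw_off h).1 (cutw_off h).2 mulr0 mul0r mulr0 addr0.
Qed.

Lemma is_derive_testfun j x : is_derive x (ebas R j) (testfun L) (dtestfun L j x).
Proof.
apply: (glue_derive (@shell_closed R N m ra rb s) shell_sub) => [y|y|y zy].
- exact: testfun_off.
- exact: dtestfun_off.
have z0 : 0 < znorm m y by case/andP: zy.
have d1 := is_derive_comp1 (is_derive_znorm j z0) (is_derive_radext zy (is_derive_profile L zy)).
apply: is_derive_eq (is_deriveM d1 (is_derive_theta j y)) _.
rewrite -[LHS]/(radext R0 (profile L) (znorm m y) * dtheta j y + cutw (wsq m y) * (dprofile L (znorm m y) * dznorm m j y)).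
have E : radext R0 (dprofile L) (znorm m y) = dprofile L (znorm m y) by rewrite /radext zy.
by rewrite /dtestfun E; ring.
Qed.

Lemma profile_radext_continuous r : 0 < r < R0 -> {for r, continuous (radext R0 (profile L))}.
Proof.
move=> rr; apply: continuous_radext => //.
by apply/differentiable_continuous/derivable1_diffP; exact: (@ex_derive _ _ _ _ _ _ _ (is_derive_profile L rr)).
Qed.

Lemma testfun_C1 : C1 (testfun L).
Proof.
move=> j; split; first by move=> x; exact: (@ex_derive _ _ _ _ _ _ _ (is_derive_testfun j x)).
have -> : (fun x => 'D_(ebas R j) (testfun L) x) = dtestfun L j.
  by apply/funext => x; exact: (@derive_val _ _ _ _ _ _ _ (is_derive_testfun j x)).
apply: (glue_continuous (@shell_closed R N m ra rb s) shell_sub) => [y|y zy]; first exact: dtestfun_off.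
have z0 : 0 < znorm m y by case/andP: zy.
apply: continuousD.
  apply: continuousM; last by apply: wsq_comp_continuous; exact: cutw_continuous.
  apply: continuousM; last exact: dznorm_continuous.
  by apply: znorm_comp_continuous; apply: continuous_radext => //; exact: dprofile_continuous.
apply: continuousM; last exact: dtheta_continuous.
by apply: znorm_comp_continuous; exact: profile_radext_continuous.
Qed.

(** Minkowski separates the derivative of the profile, a multiple of [z / |z|] of exact length, from
    the derivative of the cutoff in [w]; the factor [Num.sqrt N%:R] bounds the latter crudely over
    at most [N] fields. *)
Lemma gradL_testfun C2 x : 0 < znorm m x < R0 -> 0 <= C2 ->
  (forall k, deg k = 1%N ->
    `|\sum_j vfcoef op k j x * dtheta j x| <= C2 * znorm m x * (wsq m x <= s)%R%:R) ->
  gradL deg op e (testfun L) x <=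
    `|dprofile L (znorm m x)| * cutw (wsq m x) +
    profile L (znorm m x) * (Num.sqrt N%:R * C2 * znorm m x * (wsq m x <= s)%R%:R).
Proof.
move=> zx C20 hb; have z0 : 0 < znorm m x by case/andP: zx.
set z := znorm m x in zx z0 *.
have pE : radext R0 (profile L) z = profile L z by rewrite /radext zx.
have dE : radext R0 (dprofile L) z = dprofile L z by rewrite /radext zx.
have p0 : 0 <= profile L z by rewrite /profile mulr_ge0 ?psi_ge0// expR_ge0.
have th0 : 0 <= cutw (wsq m x) by exact: cutw_ge0.
pose A k := dprofile L z * cutw (wsq m x) * (x 0 k / z).
pose B k := profile L z * (\sum_j vfcoef op k j x * dtheta j x).
have XE k : deg k = 1%N -> Xf op e (ebas R k) (testfun L) x = A k + B k.
  move=> k1; rewrite (Xf_C1 hC _ testfun_C1).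
  transitivity (\sum_j (dprofile L z * cutw (wsq m x) * (vfcoef op k j x * dznorm m j x) +
     profile L z * (vfcoef op k j x * dtheta j x))).
    apply: eq_bigr => j _.
    rewrite (@derive_val _ _ _ _ _ _ _ (is_derive_testfun j x)) /dtestfun -/z pE dE; ring.
  rewrite big_split /= -!mulr_sumr; congr (_ * _ + _).
  have km : (k < m)%N by rewrite -layer1_iff k1.
  rewrite (bigD1 k)//= (vfcoef_layer1 hC)// eqxx mul1r /dznorm km big1 ?addr0// => j jk.
  case: ifP => jm; last by rewrite mulr0.
  by rewrite (vfcoef_layer1 hC)//; [rewrite eq_sym (negbTE jk) mul0r|apply/eqP; rewrite layer1_iff].
rewrite /gradL (eq_bigr (fun k => (A k + B k) ^+ 2)); last by move=> k /eqP k1; rewrite XE.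
apply: le_trans (minkowski2 _ _ _) _; apply: lerD.
  rewrite (eq_bigr (fun k => (dprofile L z * cutw (wsq m x) / z) ^+ 2 * x 0 k ^+ 2)); last first.
    by move=> k _; rewrite /A -exprMn; congr (_ ^+ 2); ring.
  rewrite -mulr_sumr (eq_bigl (fun k : 'I_N => (k < m)%N)); last by move=> k; exact: layer1_iff.
  rewrite -[X in _ * X]/(sumsq (fun k : 'I_N => (k < m)%N) x) -znorm_sqr -/z -exprMn.
  rewrite sqrtr_sqr divfK ?gt_eqF// normrM (ger0_norm th0)//.
set M := C2 * z * (wsq m x <= s)%R%:R.
have M0 : 0 <= M by rewrite !mulr_ge0// ltW.
have PM0 : 0 <= profile L z * M by exact: mulr_ge0.
have -> : profile L z * (Num.sqrt N%:R * C2 * z * (wsq m x <= s)%R%:R) = Num.sqrt (N%:R * (profile L z * M) ^+ 2).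
  rewrite sqrtrM ?ler0n// sqrtr_sqr ger0_norm; last exact: mulr_ge0.
  rewrite /M; move: (profile L z) (Num.sqrt N%:R) => P q; ring.
rewrite ler_wsqrtr//; apply: (@le_trans _ _ (\sum_(k < N) (profile L z * M) ^+ 2)).
  rewrite [leRHS](bigID (fun k => deg k == 1%N)) /= -[leLHS]addr0; apply: lerD.
    apply: ler_sum => k /eqP k1.
    rewrite -[X in X <= _]real_normK ?num_real// ler_sqr ?nnegrE ?PM0//.
    by rewrite /B normrM (ger0_norm p0) ler_wpM2l// hb.
  by apply: sumr_ge0 => *; exact: sqr_ge0.
by rewrite sumr_const card_ord mulr_natl.
Qed.

End Support.

(** The formulas for [V0] and [W0] are the weights in the variable [l]: their exponential cancels
    that of [profile], and [om r / r^m] is the density of [radfun]. The smallness hypothesis makes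
    the contribution of the derivative in [w], of relative size [r^2 / om r], negligible. *)
Lemma sharp_core (p C rho : R) (V0 W0 : R -> R) (Om : set 'rV[R]_N) :
  1 < p -> 0 < rho ->
  (forall eps, 0 < eps -> exists La, forall r, 0 < r < R0 -> l r <= - La ->
     r <= eps /\ r ^+ 2 <= eps * om r) ->
  (forall r, 0 < r < R0 -> V0 r = (expR (kap * l r) * r / om r) `^ p * (om r / r ^+ m)) ->
  (forall r, 0 < r < R0 -> W0 r = expR (kap * l r) `^ p * (om r / r ^+ m)) ->
  (forall r, 0 < r < R0 -> {for r, continuous V0}) ->
  (forall r, 0 < r < R0 -> {for r, continuous W0}) ->
  (forall x, 0 < znorm m x < rho -> wsq m x <= s -> Om x) ->
  `|kap| `^ p < C ->
  exists u : 'rV[R]_N -> R, C1_0 Om u /\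
    eLt (intOm Om (fun x => gradL deg op e u x `^ p * V0 (znorm m x)))
        (eScale C (intOm Om (fun x => `|u x| `^ p * W0 (znorm m x)))).
Proof.
move=> p1 rho0 l_small hV hW cV cW hOm kC.
have p0 : 0 < p by lra.
have pw0 : `|0 : R| `^ p = 0 by rewrite normr0 powR0// gt_eqF.
have [C2 [C20 hC2]] := Xtheta_bound.
pose C3 := Num.sqrt N%:R * C2.
have C30 : 0 <= C3 by rewrite mulr_ge0// sqrtr_ge0.
pose qa t := cutw t `^ p.
have qa_c : continuous qa.
  have -> : qa = (fun t => `|cutw t| `^ p) by apply/funext => t; rewrite ger0_norm// cutw_ge0.
  move=> t; apply: (@continuous_comp _ _ _ cutw (fun t => `|t| `^ p)); first exact: cutw_continuous.
  exact: powRn_continuous0.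
have qa_off t : s < t -> qa t = 0 by move=> /cutw_off [h _]; rewrite /qa h powR0// gt_eqF.
have q1_c : continuous cutw1 by move=> t; exact: maxlin_continuous.
have q1_off t : 2 * s < t -> cutw1 t = 0.
  by move=> st; rewrite /cutw1 max_l// subr_le0 ler_pdivlMr// ltW.
have q1_ge0 t : 0 <= cutw1 t by rewrite /cutw1 le_max lexx.
have E00 : 0 < J (radfun m R0 l om (humps (-2) 1) qa : 'rV[R]_N -> R).
  apply: (radfun_gt0 m_bd dl om0 com l_low l_high l_onto qa_c qa_off) => [t|]; first exact: powR_ge0.
  by rewrite /qa powR_gt0// /cutw mul0r subr0 max_r// expr1n.
have E10 : 0 < J (radfun m R0 l om (humps (-2) 1) cutw1 : 'rV[R]_N -> R).
  apply: (radfun_gt0 m_bd dl om0 com l_low l_high l_onto q1_c q1_off q1_ge0).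
  by rewrite /cutw1 mul0r subr0 max_r.
(* By [radfun_invariant] these numbers serve every interval of the negative axis, so they do not
   depend on [L]. *)
set E0 := J _ in E00; set E1 := J _ in E10.
pose Cp := p * (`|kap| + 1) `^ (p - 1).
have Cp0 : 0 < Cp by rewrite mulr_gt0// powR_gt0// ltr_wpDl.
pose c0 : R := (9 / 16) `^ p / 4.
have c00 : 0 < c0 by rewrite divr_gt0// powR_gt0//; lra.
pose D := (C - `|kap| `^ p) * c0 * E0.
have D0 : 0 < D by rewrite !mulr_gt0// subr_gt0.
(* [D * L] bounds from below the gain [(C - |kap|^p) * J g], while the error will be
   [16 * Cp * E1 * e1 * L]; this choice makes the error smaller, whatever [L] is. *)
pose e1 := Num.min 1 (D / (16 * Cp * E1 + 1)).
have X0 : 0 < 16 * Cp * E1 by rewrite !mulr_gt0.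
have e10 : 0 < e1 by rewrite lt_min ltr01 divr_gt0// addr_gt0.
have e11 : e1 <= 1 by rewrite ge_min lexx.
have e1D : 16 * Cp * E1 * e1 < D.
  have h : e1 <= D / (16 * Cp * E1 + 1) by rewrite ge_min lexx orbT.
  rewrite ler_pdivlMr ?addr_gt0// in h; lra.
pose eps := Num.min (rho / 2) (e1 / (2 * (C3 + 1))).
have C31 : 0 < 2 * (C3 + 1) by lra.
have eps0 : 0 < eps by rewrite lt_min !divr_gt0.
have epsr : eps <= rho / 2 by rewrite ge_min lexx.
have epse : C3 * eps <= e1 / 2.
  have h : eps <= e1 / (2 * (C3 + 1)) by rewrite ge_min lexx orbT.
  rewrite ler_pdivlMr// in h; nra.
have [La hLa] := l_small _ eps0.
(* The error [e1] is shared equally between the derivative of [psi], at most [4 / L], and the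
   derivative in [w], at most [C3 * eps]. *)
pose L := Num.max 1 (Num.max (8 / e1) La).
have L1 : 1 <= L by rewrite le_max lexx.
have L0 : 0 < L by exact: lt_le_trans ltr01 L1.
have LLa : La <= L by rewrite !le_max lexx !orbT.
have L4 : 4 / L <= e1 / 2.
  have h : 8 / e1 <= L by rewrite !le_max lexx orbT.
  rewrite ler_pdivrMr// in h; rewrite ler_pdivrMr//; lra.
have [ra [ra0 hra]] := l_low (- (4 * L)).
have nL : - (2 * L) < 0 by lra.
have [rb1 [rb1R hrb1]] := l_high nL.
pose rb := Num.min rb1 (rho / 2).
have rbR : rb < R0 by rewrite gt_min rb1R.
have small r : 0 < r < R0 -> l r <= - (2 * L) -> r <= eps /\ r ^+ 2 <= eps * om r.
  by move=> rr h; apply: hLa => //; lra.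
have hrb r : 0 < r < R0 -> l r <= - (2 * L) -> r <= rb.
  by move=> rr h; rewrite le_min hrb1//= (le_trans (small _ rr h).1).
pose u := testfun L.
have u1 : C1 u by exact: (testfun_C1 L0 ra0 rbR hra hrb).
have u0 x : ~ shell m ra rb s x -> u x = 0 by exact: (testfun_off L0 hra hrb).
have sU := shell_sub ra0 rbR.
have cK := @shell_closed R N m ra rb s.
have KO : shell m ra rb s `<=` Om.
  move=> x /[dup] /sU /= /andP[z0 _] [/andP[_ zb] ws]; apply: hOm => //; rewrite z0 /=.
  by apply: le_lt_trans zb _; rewrite gt_min; apply/orP; right; lra.
exists u; split.
  by split => //; exists (shell m ra rb s); split; [exact: shell_compact|split].
pose f x := gradL deg op e u x `^ p * V0 (znorm m x).
pose g x := `|u x| `^ p * W0 (znorm m x).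
have f0 x : ~ shell m ra rb s x -> f x = 0.
  by move=> nK; rewrite /f (gradL_off hC u1 cK u0 nK) powR0 ?gt_eqF// mul0r.
have g0 x : ~ shell m ra rb s x -> g x = 0 by move=> nK; rewrite /g u0// pw0 mul0r.
have Cf : Cc f.
  apply: (shell_Cc ra0 rbR f0) => x zx; apply: continuousM; last exact/znorm_comp_continuous/cV.
  rewrite (_ : (fun _ => _) = (fun y => `|gradL deg op e u y| `^ p)); last first.
    by apply/funext => y; rewrite ger0_norm// gradL_ge0.
  apply: (@continuous_comp _ _ _ (gradL deg op e u) (fun t => `|t| `^ p)); first exact: (gradL_continuous hC).
  exact: powRn_continuous0.
have Cg : Cc g.
  apply: (shell_Cc ra0 rbR g0) => x zx; apply: continuousM; last exact/znorm_comp_continuous/cW.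
  apply: (@continuous_comp _ _ _ u (fun t => `|t| `^ p)); first exact: C1_continuous.
  exact: powRn_continuous0.
have -> : intOm Om (fun x => gradL deg op e u x `^ p * V0 (znorm m x)) = (J f)%:E.
  rewrite -iint_J// /intOm; congr iint; apply/funext => x; congr (_%:E).
  exact: (indic_drop (f := f) x KO f0).
have -> : intOm Om (fun x => `|u x| `^ p * W0 (znorm m x)) = (J g)%:E.
  rewrite -iint_J// /intOm; congr iint; apply/funext => x; congr (_%:E).
  exact: (indic_drop (f := g) x KO g0).
rewrite /eLt /eScale -EFinM lte_fin.
(* A bump on [[-5 L, -L]] covers the profile's support and bounds the error; one on
   [[-7 L / 2, -5 L / 2]], the middle half of that support, bounds [g] from below. *)
pose r1 := radfun m R0 l om (humps (-5 * L) (4 * L)) cutw1 : 'rV[R]_N -> R.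
pose r0 := radfun m R0 l om (humps (- (7 / 2) * L) L) qa : 'rV[R]_N -> R.
have L40 : 0 < 4 * L by lra.
have n1 : -5 * L + 4 * L < 0 by lra.
have n0 : - (7 / 2) * L + L < 0 by lra.
have n2 : -2 + 1 < 0 :> R by lra.
have Cr1 : Cc r1 by exact: (radfun_humps_Cc _ _ dl com l_low l_high L40 n1 q1_c q1_off).
have Cr0 : Cc r0 by exact: (radfun_humps_Cc _ _ dl com l_low l_high L0 n0 qa_c qa_off).
have Jr1 : J r1 = E1.
  exact: (radfun_invariant m_bd dl com l_low l_high L40 ltr01 n1 n2 q1_c q1_off).
have Jr0 : J r0 = E0.
  exact: (radfun_invariant m_bd dl com l_low l_high L0 ltr01 n0 n2 qa_c qa_off).
have gE x : 0 < znorm m x < R0 ->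
    g x = (om (znorm m x) / znorm m x ^+ m) * (psi (l (znorm m x) / L + 3) `^ p * qa (wsq m x)).
  move=> zx; have z0 : 0 < znorm m x by case/andP: zx.
  rewrite /g hW// /u /testfun /radext zx /profile /qa.
  have A0 := mulr_ge0 (expR_ge0 (- kap * l (znorm m x))) (psi_ge0 (l (znorm m x) / L + 3)).
  rewrite (ger0_norm (mulr_ge0 A0 (cutw_ge0 _))).
  rewrite (powRM p A0 (cutw_ge0 _)) (powRM p (expR_ge0 _) (psi_ge0 _)).
  set a := _ `^ p; set b := _ `^ p; set c := _ `^ p; set d := _ `^ p.
  have ad : a * d = 1.
    rewrite /a /d -powRM ?expR_ge0// -expRD (_ : _ + _ = 0); last by ring.
    by rewrite expR0 powR1.
  have -> : a * b * c * (d * (om (znorm m x) / znorm m x ^+ m)) =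
    (a * d) * (b * c * (om (znorm m x) / znorm m x ^+ m)) by ring.
  by rewrite ad; ring.
have P2 x : c0 * L * r0 x <= g x.
  rewrite /r0 /radfun /radext; case: ifP => zx; last first.
    by rewrite mul0r mulr0 /g /u /testfun /radext zx mul0r pw0 mul0r.
  have z0 : 0 < znorm m x by case/andP: zx.
  rewrite gE//; set z := znorm m x in zx z0 *.
  have w0 : 0 <= om z / z ^+ m by rewrite divr_ge0 ?exprn_ge0 ?(ltW z0)// ltW// om0.
  have -> : c0 * L * (om z / z ^+ m * humps (- (7 / 2) * L) L (l z) * qa (wsq m x)) =
    om z / z ^+ m * ((c0 * (L * humps (- (7 / 2) * L) L (l z))) * qa (wsq m x)) by ring.
  rewrite ler_wpM2l// ler_wpM2r ?powR_ge0//.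
  have -> : L * humps (- (7 / 2) * L) L (l z) = hump (l z / L + 3 + 1 / 2).
    rewrite /humps mulrC divfK ?gt_eqF//; congr hump.
    by field; rewrite gt_eqF.
  exact: psi_hump.
have r1_ge0 x : 0 <= r1 x.
  rewrite /r1 /radfun mulr_ge0// /radext; case: ifP => // zx.
  have z0 : 0 < znorm m x by case/andP: zx.
  rewrite mulr_ge0//; last by rewrite /humps divr_ge0 ?hump_ge0// ltW.
  by rewrite divr_ge0 ?exprn_ge0 ?(ltW z0)// ltW// om0.
have P1 x : f x <= `|kap| `^ p * g x + Cp * e1 * (16 * L) * r1 x.
  have t0 : 0 <= Cp * e1 * (16 * L) * r1 x.
    by rewrite mulr_ge0// !mulr_ge0// ltW.
  have [Kx|nK] := pselect (shell m ra rb s x); last first.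
    by rewrite f0// g0// mulr0 add0r.
  have zx := sU _ Kx; have z0 : 0 < znorm m x by case/andP: zx.
  have ws : wsq m x <= s by case: Kx.
  have H := gradL_testfun L0 ra0 rbR hra hrb zx C20 (fun k k1 => hC2 k x k1).
  rewrite -/u in H.
  rewrite /f hV// gE//.
  have -> : r1 x = om (znorm m x) / znorm m x ^+ m * humps (-5 * L) (4 * L) (l (znorm m x)) * cutw1 (wsq m x).
    by rewrite /r1 /radfun /radext zx.
  set z := znorm m x in zx z0 H *; set G := gradL _ _ _ _ _ in H *.
  have omz : 0 < om z by exact: om0.
  have w0 : 0 <= om z / z ^+ m by rewrite divr_ge0 ?exprn_ge0 ?(ltW z0)// ltW.
  have G0 : 0 <= G by exact: gradL_ge0.
  set Em := expR (kap * l z); have Em0 : 0 < Em by exact: expR_gt0.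
  have F0 : 0 < Em * z / om z by rewrite divr_gt0// mulr_gt0.
  rewrite mulrA -powRM ?(ltW F0)//.
  set t := l z / L + 3; set th := cutw (wsq m x).
  have th0 : 0 <= th by exact: cutw_ge0.
  have th1 : th <= 1 by apply: cutw_le1; exact: wsq_ge0.
  have Emi : expR (- kap * l z) = Em^-1 by rewrite mulNr expRN.
  have ps0 := psi_ge0 t. have ps1 := psi_le1 t.
  (* Rescaled by the weight, the gradient is at most [a + b]: [a] reproduces [|kap|] times the test
     function, and [b] collects what involves derivatives of the cutoffs. *)
  pose a := `|kap| * psi t * th.
  pose b := `|dpsi t| / L * th + psi t * (C3 * (z ^+ 2 / om z)).
  have kp0 : 0 <= `|kap| * psi t by exact: mulr_ge0.
  have a0 : 0 <= a by exact: mulr_ge0.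
  have ak : a <= `|kap|.
    by rewrite /a -mulrA -[leRHS]mulr1 ler_wpM2l// mulr_ile1.
  have b0 : 0 <= b.
    apply: addr_ge0; first by apply: mulr_ge0 => //; rewrite divr_ge0// ltW.
    by apply: mulr_ge0 => //; rewrite mulr_ge0// divr_ge0 ?sqr_ge0// ltW.
  have Hab : G * (Em * z / om z) <= a + b.
    apply: le_trans (ler_wpM2r (ltW F0) H) _.
    rewrite ws mulr1 /profile /dprofile -/t Emi.
    have -> : (`|Em^-1 * (om z / z) * (dpsi t / L - kap * psi t)| * th +
       Em^-1 * psi t * (Num.sqrt N%:R * C2 * z)) * (Em * z / om z) =
       `|dpsi t / L - kap * psi t| * th + psi t * (C3 * (z ^+ 2 / om z)).
      rewrite !normrM (ger0_norm (_ : 0 <= Em^-1)) ?invr_ge0 ?(ltW Em0)//.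
      rewrite (ger0_norm (ltW omz)) (ger0_norm (_ : 0 <= z^-1)) ?invr_ge0 ?(ltW z0)// /C3.
      by field; rewrite !gt_eqF.
    rewrite /a /b addrA lerD2r -mulrDl ler_wpM2r//.
    apply: le_trans (ler_normB _ _) _; rewrite (normrM kap (psi t)) (normrM (dpsi t) L^-1) (ger0_norm ps0) normfV (ger0_norm (ltW L0)).
    by rewrite addrC.
  have [bE bcase] : b <= e1 /\ b <= e1 * (4 * hump ((t + 2) / 4) * cutw1 (wsq m x)).
    have [ti|to] := boolP (-1 <= t <= 1); last first.
      have -> : b = 0 by rewrite /b (psi_off to).1 (psi_off to).2 normr0 !mul0r addr0.
      split; first exact: ltW.
      exact: mulr_ge0 (ltW e10) (mulr_ge0 (mulr_ge0 (ler0n _ 4) (hump_ge0 _)) (q1_ge0 _)).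
    have /andP[_ lz] := support_interval L0 ti.
    have [_ sm] := small _ zx lz.
    have be : b <= e1.
      have h1 : `|dpsi t| / L * th <= 4 / L.
        apply: (@le_trans _ _ (`|dpsi t| / L)); first by rewrite ler_piMr// divr_ge0// ltW.
        by rewrite ler_wpM2r ?invr_ge0 ?(ltW L0)// dpsi_le4.
      have h2 : psi t * (C3 * (z ^+ 2 / om z)) <= C3 * eps.
        apply: (@le_trans _ _ (C3 * (z ^+ 2 / om z))).
          by rewrite ler_piMl// mulr_ge0// divr_ge0 ?sqr_ge0// ltW.
        by rewrite ler_wpM2l// ler_pdivrMr.
      by rewrite /b; lra.
    split => //; apply: le_trans be _; rewrite -[leLHS]mulr1 ler_wpM2l ?(ltW e10)//.
    have h1 := hump_cover ti.
    exact: le_trans (h1) (ler_peMr (le_trans ler01 h1) (cutw1_lower ws)).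
  have b1 : b <= 1 by exact: le_trans bE e11.
  have S1 : (G * (Em * z / om z)) `^ p <= a `^ p + Cp * b.
    apply: (@le_trans _ _ ((a + b) `^ p)); last exact: powR_add_le.
    apply: ge0_ler_powR => //; rewrite ?nnegrE; [exact: ltW| |exact: addr_ge0].
    exact: mulr_ge0 G0 (ltW F0).
  have S2 : a `^ p = `|kap| `^ p * (psi t `^ p * qa (wsq m x)).
    by rewrite /a (powRM p kp0 th0) (powRM p (normr_ge0 _) ps0) mulrA.
  have S3 : 16 * L * humps (-5 * L) (4 * L) (l z) = 4 * hump ((t + 2) / 4).
    rewrite /humps (_ : (l z - -5 * L) / (4 * L) = (t + 2) / 4); last first.
      by rewrite /t; field; rewrite gt_eqF.
    by field; rewrite gt_eqF.
  apply: le_trans (ler_wpM2r w0 S1) _.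
  rewrite S2 -[X in _ <= _ + X](_ : om z / z ^+ m * (Cp * (e1 * (16 * L * humps (-5 * L) (4 * L) (l z) * cutw1 (wsq m x)))) = _); last by ring.
  rewrite S3.
  have S4 : Cp * b <= Cp * (e1 * (4 * hump ((t + 2) / 4) * cutw1 (wsq m x))).
    by rewrite ler_wpM2l// ltW.
  rewrite mulrDl; apply: lerD; last by rewrite mulrC ler_wpM2l.
  by rewrite le_eqVlt; apply/orP; left; apply/eqP; ring.
have Jf : J f <= `|kap| `^ p * J g + Cp * e1 * (16 * L) * E1.
  rewrite -Jr1 -!JZ// -JD; [|exact: Cc_scale|exact: Cc_scale].
  by apply: J_le => //; apply: Cc_add; exact: Cc_scale.
have Jg : c0 * L * E0 <= J g.
  by rewrite -Jr0 -JZ//; apply: J_le => //; exact: Cc_scale.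
have J1 : Cp * e1 * (16 * L) * E1 < D * L.
  have -> : Cp * e1 * (16 * L) * E1 = 16 * Cp * E1 * e1 * L by ring.
  by rewrite ltr_pM2r.
have J2 : D * L <= (C - `|kap| `^ p) * J g.
  have -> : D * L = (C - `|kap| `^ p) * (c0 * L * E0) by rewrite /D; ring.
  by rewrite ler_wpM2l// subr_ge0 ltW.
rewrite mulrBl in J2; lra.
Qed.

End Sharpness.

(** * Sharpness for the power and logarithmic weights *)

Section SharpConstants.
Context {R : realType}.
Variables (N : nat) (deg : 'I_N -> nat).
Variables (op : 'rV[R]_N -> 'rV[R]_N -> 'rV[R]_N) (inv : 'rV[R]_N -> 'rV[R]_N) (e : 'rV[R]_N).
Hypothesis hC : is_hom_carnot deg op inv e.
Hypothesis deg2 : forall k, (deg k <= 2)%N.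
Variable m : nat.
Hypothesis m0 : (0 < m)%N.
Hypothesis mE : m = lay1 deg.
Implicit Types (x : 'rV[R]_N) (r t y p : R).

Lemma sharp_power p beta C (Om : set 'rV[R]_N) : 1 < p ->
  (exists rho, 0 < rho /\ [set x | 0 < znorm m x < rho /\ wnorm m x < rho] `<=` Om) ->
  (`|m%:R + beta| / p) `^ p < C ->
  exists u : 'rV[R]_N -> R, C1_0 Om u /\
    eLt (intOm Om (fun x => gradL deg op e u x `^ p * znorm m x `^ (p + beta)))
        (eScale C (intOm Om (fun x => `|u x| `^ p * znorm m x `^ beta))).
Proof.
move=> p1 [rho [rho0 hO]] kC; have p0 : 0 < p by lra.
pose kap := (m%:R + beta) / p.
have kE : `|kap| = `|m%:R + beta| / p by rewrite normrM normfV (gtr0_norm p0).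
(* The bound on [wsq] is the square of [rho / 2], which keeps [wnorm] strictly below [rho]. *)
have s0 : 0 < (rho / 2) ^+ 2 by rewrite exprn_gt0// divr_gt0.
(* Writing [r] as an exponential turns the identities between powers into linear identities between
   exponents. *)
have lnE r : 0 < r -> exists y, r = expR y by move=> r0; exists (ln r); rewrite lnK.
have dl r : 0 < r < 1 -> is_derive r (1 : R) (@ln R) (1 / r).
  by case/andP => r0 _; rewrite div1r; exact: is_derive1_ln.
have cpow a r : 0 < r < 1 -> {for r, continuous (fun r => r `^ a)}.
  by case/andP => r0 _; exact: powR_continuous_pos.
apply: (@sharp_core R N deg op inv e hC deg2 m m0 mE _ s0 1 (@ln R) (fun=> 1) dl _ _ _ _ _ kap p C rho
  (fun r => r `^ (p + beta)) (fun r => r `^ beta) Om) => //.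
- by move=> r _; exact: cst_continuous.
- move=> a; exists (expR a); split; first exact: expR_gt0.
  by move=> r /andP[/lnE[y ->] _]; rewrite expRK ler_expR.
- move=> b b0; exists (expR b); split; first by rewrite -expR0 ltr_expR.
  by move=> r /andP[/lnE[y ->] _]; rewrite expRK ler_expR.
- move=> a a0; exists (expR a); rewrite expRK expR_gt0 -[X in _ < X]expR0 ltr_expR.
  by split.
- move=> eps eps0; pose d := Num.min 1 eps.
  have d0 : 0 < d by rewrite lt_min ltr01.
  exists (- ln d) => r /andP[r0 r1]; rewrite opprK ler_ln ?posrE// le_min => /andP[_ re].
  by split => //; rewrite mulr1; nra.
- move=> r /andP[/lnE[y ->] _]; rewrite expRK divr1 div1r -!expRD -!expRM -expRM_natl -expRN -expRD.
  by congr expR; rewrite /kap; field; rewrite gt_eqF.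
- move=> r /andP[/lnE[y ->] _]; rewrite expRK div1r -!expRM -expRM_natl -expRN -expRD.
  by congr expR; rewrite /kap; field; rewrite gt_eqF.
- by move=> r rr; exact: cpow.
- by move=> r rr; exact: cpow.
- move=> x zx ws; apply: hO; split => //.
  have -> : wnorm m x = Num.sqrt (wsq m x) by [].
  apply: (@le_lt_trans _ _ (rho / 2)); last by lra.
  by rewrite -[leRHS]ger0_norm -?sqrtr_sqr ?ler_wsqrtr//; lra.
by rewrite kE.
Qed.

Lemma sharp_log p R0 beta C : p = m%:R -> 1 < p -> 0 < R0 ->
  (`|beta + 1| / p) `^ p < C ->
  exists u : 'rV[R]_N -> R, C1_0 [set x | znorm m x < R0] u /\
    eLt (intOm [set x | znorm m x < R0]
           (fun x => gradL deg op e u x `^ p * ln (R0 / znorm m x) `^ (p + beta)))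
        (eScale C (intOm [set x | znorm m x < R0]
           (fun x => `|u x| `^ p / znorm m x `^ p * ln (R0 / znorm m x) `^ beta))).
Proof.
move=> pm p1 R00 kC; have p0 : 0 < p by lra.
pose kap := - (beta + 1) / p.
have kE : `|kap| = `|beta + 1| / p by rewrite normrM normfV (gtr0_norm p0) normrN.
pose T r := ln R0 - ln r.
have T0 r : 0 < r < R0 -> 0 < T r.
  by case/andP => r0 rR; rewrite subr_gt0 ltr_ln.
have R0E : R0 = expR (ln R0) by rewrite lnK.
(* The substitution [r = R0 * exp (- exp t)] turns [- ln (ln (R0 / r))] into [- t]. *)
have parE r : 0 < r < R0 -> exists t, r = expR (ln R0 - expR t).
  move=> rr; exists (ln (T r)); rewrite lnK ?posrE ?T0// /T.
  by rewrite opprB addrC subrK lnK// posrE; case/andP: rr.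
have Tpar t : T (expR (ln R0 - expR t)) = expR t by rewrite /T expRK; ring.
have lnT r : 0 < r -> ln (R0 / r) = T r by move=> r0; rewrite ln_div.
have dT r : 0 < r < R0 -> is_derive r (1 : R) T (- r^-1).
  case/andP => r0 _; have H := is_deriveB (is_derive_cst (ln R0) r (1 : R)) (is_derive1_ln r0).
  by apply: is_derive_eq H _; rewrite sub0r.
have cT r : 0 < r < R0 -> {for r, continuous T}.
  move=> rr; apply/differentiable_continuous/derivable1_diffP.
  exact: (@ex_derive _ _ _ _ _ _ _ (dT _ rr)).
have dl r : 0 < r < R0 -> is_derive r (1 : R) (fun r => - ln (T r)) ((T r)^-1 / r).
  move=> rr; have H := is_deriveN (is_derive1_comp (is_derive1_ln (T0 _ rr)) (dT _ rr)).
  by apply: is_derive_eq H _; rewrite mulrN opprK.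
have cln a r : 0 < r < R0 -> {for r, continuous (fun r => ln (R0 / r) `^ a)}.
  move=> rr; have r0 : 0 < r by case/andP: rr.
  apply: (@continuous_comp _ _ _ (fun r => ln (R0 / r)) (fun t => t `^ a)); last first.
    by apply: powR_continuous_pos; rewrite lnT// T0.
  apply: (@continuous_comp _ _ _ (fun r => R0 / r) (@ln R)); last first.
    by apply: continuous_ln; rewrite divr_gt0.
  apply: continuousM; first exact: cst_continuous.
  by apply: continuousV; [rewrite gt_eqF|exact: cvg_id].
have [u [hu H]] : exists u : 'rV[R]_N -> R, C1_0 [set x | znorm m x < R0] u /\
    eLt (intOm [set x | znorm m x < R0]
           (fun x => gradL deg op e u x `^ p * ln (R0 / znorm m x) `^ (p + beta)))
        (eScale C (intOm [set x | znorm m x < R0]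
           (fun x => `|u x| `^ p * ((znorm m x `^ p)^-1 * ln (R0 / znorm m x) `^ beta)))); last first.
  exists u; split => //.
  rewrite (_ : (fun x => _ / _ * _) =
    (fun x => `|u x| `^ p * ((znorm m x `^ p)^-1 * ln (R0 / znorm m x) `^ beta)))//.
  by apply/funext => x; rewrite mulrA.
(* The domain leaves [w] unrestricted, so the cutoff width 1 is arbitrary and [rho = R0]. *)
apply: (@sharp_core R N deg op inv e hC deg2 m m0 mE 1 ltr01 R0 (fun r => - ln (T r))
  (fun r => (T r)^-1) dl _ _ _ _ _ kap p C R0 (fun r => ln (R0 / r) `^ (p + beta))
  (fun r => (r `^ p)^-1 * ln (R0 / r) `^ beta) [set x | znorm m x < R0]) => //.
- by move=> r rr; rewrite invr_gt0 T0.
- by move=> r rr; apply: continuousV; [rewrite gt_eqF ?T0|exact: cT].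
- move=> a; exists (expR (ln R0 - expR (- a))); split; first exact: expR_gt0.
  by move=> r /parE[t ->]; rewrite Tpar expRK lerNr ler_expR lerD2l lerN2 ler_expR.
- move=> b b0; exists (expR (ln R0 - expR (- b))); split.
    by rewrite [ltRHS]R0E ltr_expR ltrBlDr ltrDl expR_gt0.
  by move=> r /parE[t ->]; rewrite Tpar expRK lerNl ler_expR lerD2l lerN2 ler_expR.
- move=> a a0; exists (expR (ln R0 - expR (- a))).
  by rewrite Tpar expRK opprK expR_gt0 [ltRHS]R0E ltr_expR ltrBlDr ltrDl expR_gt0.
(* For [r = R0 exp(-tau)] with [tau = exp t] one has [om r = 1 / tau]; both bounds follow from
   [t <= tau] and [tau exp(-tau) <= 1]. *)
- move=> eps eps0; pose La := Num.max 0 (Num.max (R0 / eps) (R0 ^+ 2 / eps)).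
  exists La => r /parE[t ->]; rewrite Tpar expRK lerN2 => Lt.
  have t0 : 0 <= t by apply: le_trans Lt; rewrite le_max lexx.
  have h1 : R0 <= t * eps.
    by rewrite -ler_pdivrMr//; apply: le_trans Lt; rewrite !le_max lexx orbT.
  have h2 : R0 ^+ 2 <= t * eps.
    by rewrite -ler_pdivrMr//; apply: le_trans Lt; rewrite !le_max lexx !orbT.
  rewrite expRD -R0E; set tau := expR t; set E := expR (- tau).
  have tt : t <= tau by have := expR_ge1Dx t; rewrite -/tau; lra.
  have tau0 : 0 < tau by exact: expR_gt0.
  have E0 : 0 < E by exact: expR_gt0.
  have Et : E * tau <= 1.
    have EE : E * expR tau = 1 by rewrite /E -expRD addrC subrr expR0.
    have := expR_ge1Dx tau; nra.
  have k1 : E * t * eps <= eps.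
    by rewrite -[leRHS]mul1r ler_wpM2r ?(ltW eps0)//; nra.
  have k2 : R0 * E <= eps by nra.
  have k3 : R0 ^+ 2 * E <= eps by nra.
  split => //; rewrite ler_pdivlMr//.
  have -> : (R0 * E) ^+ 2 * tau = (R0 ^+ 2 * E) * (E * tau) by ring.
  apply: le_trans k3; rewrite ler_piMr// mulr_ge0 ?(ltW E0)//; exact: sqr_ge0.
- move=> r rr; have r0 : 0 < r by case/andP: rr.
  rewrite lnT//; case: (parE _ rr) => t ->; rewrite Tpar expRK -expRN -!expRD -!expRM -expRM_natl -!expRN -!expRD -expRM -expRD.
  by congr expR; rewrite -pm /kap; field; rewrite gt_eqF.
- move=> r rr; have r0 : 0 < r by case/andP: rr.
  rewrite lnT//; case: (parE _ rr) => t ->; rewrite Tpar expRK -!expRM -expRM_natl -!expRN -!expRD.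
  by congr expR; rewrite -pm /kap; field; rewrite gt_eqF.
- by move=> r rr; exact: cln.
- move=> r rr; have r0 : 0 < r by case/andP: rr.
  apply: continuousM; last exact: cln.
  by apply: continuousV; [rewrite gt_eqF// powR_gt0|exact: powR_continuous_pos].
- by move=> x /andP[].
by rewrite kE.
Qed.
End SharpConstants.

Theorem mainTheorem16 (R : realType) (N : nat) (deg : 'I_N -> nat)
  (op : 'rV[R]_N -> 'rV[R]_N -> 'rV[R]_N) (inv : 'rV[R]_N -> 'rV[R]_N)
  (e : 'rV[R]_N) (m : nat) :
  is_hom_carnot deg op inv e ->
  (1 <= m)%N -> (m <= lay1 deg)%N ->
  let z := @znorm R N m in
  let X := gradL deg op e in
  (* (1) *)
  (forall (p beta : R) (Om : set 'rV[R]_N) (u : 'rV[R]_N -> R),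
     1 < p -> open Om ->
     (m%:R + beta < 0 -> forall x, Om x -> z x != 0) ->
     C1_0 Om u ->
     eLe (eScale ((`|m%:R + beta| / p) `^ p)
                 (intOm Om (fun x => `|u x| `^ p * z x `^ beta)))
         (intOm Om (fun x => X u x `^ p * z x `^ (p + beta)))) /\
  (forall (p : R) (Om : set 'rV[R]_N) (u : 'rV[R]_N -> R),
     1 < p -> open Om ->
     (m%:R - p < 0 -> forall x, Om x -> z x != 0) ->
     C1_0 Om u ->
     eLe (eScale ((`|m%:R - p| / p) `^ p)
                 (intOm Om (fun x => `|u x| `^ p / NS deg x `^ p)))
         (eScale ((`|m%:R - p| / p) `^ p)
                 (intOm Om (fun x => `|u x| `^ p / z x `^ p))) /\
     eLe (eScale ((`|m%:R - p| / p) `^ p)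
                 (intOm Om (fun x => `|u x| `^ p / z x `^ p)))
         (intOm Om (fun x => X u x `^ p))) /\
  (forall (p : R) (Om : set 'rV[R]_N),
     1 < p -> open Om ->
     (m%:R - p < 0 -> forall x, Om x -> z x != 0) ->
     p != m%:R ->
     forall Nf : 'rV[R]_N -> R, hom_norm deg inv Nf ->
     exists c : R, 0 < c /\
       forall u : 'rV[R]_N -> R, C1_0 Om u ->
         eLe (eScale c (intOm Om (fun x => `|u x| `^ p / Nf x `^ p)))
             (intOm Om (fun x => X u x `^ p))) /\
  (* (2) *)
  (forall (p R0 beta : R) (u : 'rV[R]_N -> R),
     p = m%:R -> 1 < p -> 0 < R0 -> beta < -1 ->
     C1_0 [set x | z x < R0] u ->
     eLe (eScale ((`|beta + 1| / p) `^ p)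
            (intOm [set x | z x < R0]
               (fun x => `|u x| `^ p / z x `^ p * ln (R0 / z x) `^ beta)))
         (intOm [set x | z x < R0]
               (fun x => X u x `^ p * ln (R0 / z x) `^ (p + beta)))) /\
  (forall (p R0 : R) (u : 'rV[R]_N -> R),
     p = m%:R -> 1 < p -> 0 < R0 ->
     C1_0 [set x | z x < R0] u ->
     eLe (eScale (((p - 1) / p) `^ p)
            (intOm [set x | z x < R0]
               (fun x => `|u x| `^ p / (z x * ln (R0 / z x)) `^ p)))
         (intOm [set x | z x < R0] (fun x => X u x `^ p))) /\
  (* sharpness of the constants for H-type groups with m = l *)
  (is_Htype deg op e -> m = lay1 deg ->
    (forall (p beta : R) (Om : set 'rV[R]_N),
       1 < p -> open Om ->
       (m%:R + beta < 0 -> forall x, Om x -> z x != 0) ->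
       (exists rho : R, 0 < rho /\
          [set x | 0 < z x < rho /\ @wnorm R N m x < rho] `<=` Om) ->
       forall C : R, (`|m%:R + beta| / p) `^ p < C ->
       exists u : 'rV[R]_N -> R, C1_0 Om u /\
         eLt (intOm Om (fun x => X u x `^ p * z x `^ (p + beta)))
             (eScale C (intOm Om (fun x => `|u x| `^ p * z x `^ beta)))) /\
    (forall (p R0 beta : R),
       p = m%:R -> 1 < p -> 0 < R0 -> beta < -1 ->
       (exists rho : R, 0 < rho /\
          [set x | 0 < z x < rho /\ @wnorm R N m x < rho] `<=` [set x | z x < R0]) ->
       forall C : R, (`|beta + 1| / p) `^ p < C ->
       exists u : 'rV[R]_N -> R, C1_0 [set x | z x < R0] u /\
         eLt (intOm [set x | z x < R0]
                (fun x => X u x `^ p * ln (R0 / z x) `^ (p + beta)))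
             (eScale C (intOm [set x | z x < R0]
                (fun x => `|u x| `^ p / z x `^ p * ln (R0 / z x) `^ beta))))).
Proof.
move=> hC m0 ml z X; split.
  by move=> p beta Om u p1 _ hz hu; exact: (hardy_power hC m0 ml p1 hz hu).
split.
  move=> p Om u p1 _ hz hu; split; first exact: (hardy_NS hC ml m0 p1 hz hu).
  exact: (hardy_unweighted hC m0 ml p1 hz hu).
split.
  by move=> p Om p1 _ hz pm Nf hN; exact: (hardy_hom_norm hC ml m0 p1 hz pm hN).
split.
  by move=> p R0 beta u pm p1 R00 b1 hu; exact: (hardy_log hC m0 ml pm p1 R00 b1 hu).
split.
  by move=> p R0 u pm p1 R00 hu; exact: (hardy_log_unweighted hC m0 ml pm p1 R00 hu).
move=> [deg2 _] mE; split.
  by move=> p beta Om p1 _ _ hO C kC; exact: (sharp_power hC deg2 m0 mE p1 hO kC).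
by move=> p R0 beta pm p1 R00 _ _ C kC; exact: (sharp_log hC deg2 m0 mE pm p1 R00 kC).
Qed.
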